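(* Let $M$ be an oriented closed connected aspherical manifold of non-zero dimension with amenable fundamental group $\Gamma$. Let $\alpha=\Gamma\curvearrowright(X,\mu)$ be a free standard $\Gamma$-space. Then $$\boldsymbol{|}M\boldsymbol{|}=\boldsymbol{|}M\boldsymbol{|}^\alpha=0 .$$
   Context: Let $M$ be an oriented closed connected $n$-manifold with fundamental group $\Gamma$ and universal covering $\pi:\widetilde M\to M$. A standard $\Gamma$-space $\alpha=\Gamma\curvearrowright(X,\mu)$ is a standard Borel probability space with a measurable $\mu$-preserving left $\Gamma$-action; the action of $g$ is denoted $g^\alpha$. It is called free if the action is free on a subset of full measure (essentially free). Equip $L^\infty(X,\mu,\mathbb Z)$ (essentially bounded measurable $\mathbb Z$-valued functions modulo a.e. equality) with the right $\Gamma$-action $(f\cdot g)(x)=f(g^\alpha(x))$, and set $C_*(M;\alpha)=L^\infty(X,\mu,\mathbb Z)\otimes_{\mathbb Z\Gamma}C_*(\widetilde M;\mathbb Z)$ (singular chains, $\Gamma$ acting by deck transformations). The inclusion of $\mathbb Z$ as constant functions induces a chain map $C_*(M;\mathbb Z)\cong\mathbb Z\otimes_{\mathbb Z\Gamma}C_*(\widetilde M;\mathbb Z)\to C_*(M;\alpha)$; cycles representing the image of the integral fundamental class $[M]_{\mathbb Z}$ in $H_n(C_*(M;\alpha))$ are $\alpha$-parametrized fundamental cycles. For a chain $c=\sum_{j=1}^k f_j\otimes\sigma_j$ in reduced form (i.e. $\pi\circ\sigma_j\ne\pi\circ\sigma_l$ for $j\neq l$) put $\boldsymbol{|}c\boldsymbol{|}^\alpha=\sum_{j=1}^k\int_X|f_j|\,d\mu$.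 Then $\boldsymbol{|}M\boldsymbol{|}^\alpha$ is the infimum of $\boldsymbol{|}c\boldsymbol{|}^\alpha$ over all $\alpha$-parametrized fundamental cycles, and the integral foliated simplicial volume $\boldsymbol{|}M\boldsymbol{|}$ is the infimum of $\boldsymbol{|}M\boldsymbol{|}^\alpha$ over all (isomorphism classes of) standard $\Gamma$-spaces $\alpha$. *)

(* Defs.v *)
From HB Require Import structures.
From mathcomp Require Import freeg.
From mathcomp Require Import all_boot all_order all_algebra.
From mathcomp Require Import generic_quotient ring_quotient.
From mathcomp Require Import all_classical all_reals all_analysis.
Import Order.TTheory GRing.Theory Num.Theory.
Import numFieldNormedType.Exports.

Set Implicit Arguments.
Unset Strict Implicit.
Unset Printing Implicit Defensive.

Local Open Scope classical_set_scope.
Local Open Scope quotient_scope.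
Local Open Scope ring_scope.

Section FreeAbelianGroup.
Context {K : choiceType}.

Definition fgen (k : K) : {freeg K / int} := [freeg [:: (1, k)]].

Definition zlift {V : zmodType} (f : K -> V) (c : {freeg K / int}) : V :=
  @fglift int (zmodule V) K f c.

Lemma zlift_fgen {V : zmodType} (f : K -> V) k : zlift f (fgen k) = f k.
Proof. by rewrite /zlift /fgen liftU scale1r. Qed.

Lemma zliftB {V : zmodType} (f : K -> V) : {morph zlift f : x y / x - y}.
Proof. exact: (@lift_is_additive int K (zmodule V) f). Qed.

Lemma zlift0 {V : zmodType} (f : K -> V) : zlift f 0 = 0.
Proof. by have := zliftB f 0 0; rewrite !subrr. Qed.

Lemma zliftN {V : zmodType} (f : K -> V) : {morph zlift f : x / - x}.
Proof. by move=> x; have := zliftB f 0 x; rewrite zlift0 !sub0r. Qed.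

Lemma zliftD {V : zmodType} (f : K -> V) : {morph zlift f : x y / x + y}.
Proof. by move=> x y; have := zliftB f x (- y); rewrite zliftN !opprK. Qed.

Lemma zliftMz {V : zmodType} (f : K -> V) x k : zlift f (x *~ k) = zlift f x *~ k.
Proof.
have zliftMn n : zlift f (x *+ n) = zlift f x *+ n.
  by elim: n => [|n IHn]; rewrite ?mulr0n ?zlift0// !mulrS zliftD IHn.
by case: k => n; rewrite ?NegzE ?mulrNz ?zliftN -!pmulrn zliftMn.
Qed.

Lemma zlift_sum {V : zmodType} (f : K -> V) I (r : seq I)
    (F : I -> {freeg K / int}) :
  zlift f (\sum_(i <- r) F i) = \sum_(i <- r) zlift f (F i).
Proof.
by elim: r => [|i r IHr]; rewrite ?big_nil ?zlift0// !big_cons zliftD IHr.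
Qed.

Lemma additive_fgen {V : zmodType} (phi : {freeg K / int} -> V) c :
  {morph phi : x y / x - y} -> phi c = zlift (fun k => phi (fgen k)) c.
Proof.
move=> phiB.
have phi0 : phi 0 = 0 by have := phiB 0 0; rewrite !subrr.
have phiN x : phi (- x) = - phi x by have := phiB 0 x; rewrite phi0 !sub0r.
have phiD x y : phi (x + y) = phi x + phi y.
  by have := phiB x (- y); rewrite phiN !opprK.
have phiMn n x : phi (x *+ n) = phi x *+ n.
  by elim: n => [|n IHn]; rewrite ?mulr0n// !mulrS phiD IHn.
have phiMz k x : phi (x *~ k) = phi x *~ k.
  by case: k => n; rewrite ?NegzE ?mulrNz ?phiN -!pmulrn phiMn.
have -> : c = \sum_(z <- freeg.dom c) fgen z *~ freeg.coeff z c.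
  rewrite -[LHS]freeg_sumE; apply: eq_bigr => z _.
  by rewrite /fgen freegU_mulz intz.
rewrite zlift_sum; elim: (freeg.dom c) => [|z r IHr]; rewrite ?big_nil//.
by rewrite !big_cons phiD IHr phiMz zliftMz zlift_fgen.
Qed.

Lemma zlift_ind {V : zmodType} (phi psi : {freeg K / int} -> V) c :
    {morph phi : x y / x - y} -> {morph psi : x y / x - y} ->
  (forall k, phi (fgen k) = psi (fgen k)) -> phi c = psi c.
Proof.
move=> phiB psiB phipsi; rewrite (additive_fgen c phiB) (additive_fgen c psiB).
by congr zlift; apply/funext.
Qed.

End FreeAbelianGroup.

Section TensorProduct.
Context {G : groupType} {A C : zmodType}.
Variables (ra : A -> G -> A) (la : G -> C -> C).

Inductive tens_rel : {freeg (A * C)%type / int} -> Prop :=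
| tens_rel0 : tens_rel 0
| tens_relB x y : tens_rel x -> tens_rel y -> tens_rel (x - y)
| tens_relDl a a' c :
    tens_rel (fgen (a + a', c) - fgen (a, c) - fgen (a', c))
| tens_relDr a c c' :
    tens_rel (fgen (a, c + c') - fgen (a, c) - fgen (a, c'))
| tens_relG a g c : tens_rel (fgen (ra a g, c) - fgen (a, la g c)).

Definition tens_ideal : {pred {freeg (A * C)%type / int}} :=
  [pred x | `[< tens_rel x >]].

Lemma tens_ideal_zmod_closed : zmod_closed tens_ideal.
Proof.
split; first exact/asboolP/tens_rel0.
by move=> x y /asboolP ? /asboolP ?; exact/asboolP/tens_relB.
Qed.

HB.instance Definition _ :=
  GRing.isZmodClosed.Build _ tens_ideal tens_ideal_zmod_closed.

(* $A \otimes_{\mathbb Z G} C$ for the right action [ra] on A and the left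
   action [la] on C; being balanced over G and biadditive amounts to being
   balanced over $\mathbb Z G$. *)
Definition tensor : zmodType := Quotient.quot tens_ideal.

Definition tens (a : A) (c : C) : tensor := \pi_(Quotient.quot tens_ideal) (fgen (a, c)).

Lemma tens_pi_eq x y : tens_rel (x - y) ->
  \pi_(Quotient.quot tens_ideal) x = \pi_(Quotient.quot tens_ideal) y.
Proof. by move=> ?; apply/eqP; rewrite -Quotient.idealrBE; exact/asboolP. Qed.

Lemma tensDl a a' c : tens (a + a') c = tens a c + tens a' c.
Proof.
rewrite /tens -(raddfD (\pi_(Quotient.quot tens_ideal))); apply: tens_pi_eq.
by rewrite opprD addrA; exact: tens_relDl.
Qed.

Lemma tensDr a c c' : tens a (c + c') = tens a c + tens a c'.
Proof.
rewrite /tens -(raddfD (\pi_(Quotient.quot tens_ideal))); apply: tens_pi_eq.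
by rewrite opprD addrA; exact: tens_relDr.
Qed.

Lemma tensG a g c : tens (ra a g) c = tens a (la g c).
Proof. exact/tens_pi_eq/tens_relG. Qed.

(* Only meaningful for [b] biadditive and balanced: see tens_lift_tens. *)
Definition tens_lift {V : zmodType} (b : A -> C -> V) (t : tensor) : V :=
  zlift (fun ac => b ac.1 ac.2) (repr (t : Quotient.quot tens_ideal)).

Section Balanced.
Context {V : zmodType} (b : A -> C -> V).
Hypothesis bDl : forall a a' c, b (a + a') c = b a c + b a' c.
Hypothesis bDr : forall a c c', b a (c + c') = b a c + b a c'.
Hypothesis bG : forall a g c, b (ra a g) c = b a (la g c).

Lemma zlift_tens_rel x : tens_rel x -> zlift (fun ac => b ac.1 ac.2) x = 0.
Proof.
elim=> [|{}x y _ xE _ yE|a a' c|a c c'|a g c].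
- exact: zlift0.
- by rewrite zliftB xE yE subrr.
- by rewrite !zliftB !zlift_fgen /= bDl addrAC addrK subrr.
- by rewrite !zliftB !zlift_fgen /= bDr addrAC addrK subrr.
- by rewrite !zliftB !zlift_fgen /= bG subrr.
Qed.

Lemma tens_lift_pi x :
  tens_lift b (\pi_(Quotient.quot tens_ideal) x) = zlift (fun ac => b ac.1 ac.2) x.
Proof.
rewrite /tens_lift; apply/eqP; rewrite -subr_eq0 -zliftB; apply/eqP.
apply: zlift_tens_rel; apply/asboolP.
have : repr (\pi_(Quotient.quot tens_ideal) x) - x \in tens_ideal.
  by rewrite Quotient.idealrBE reprK.
by [].
Qed.

Lemma tens_lift_tens a c : tens_lift b (tens a c) = b a c.
Proof. by rewrite tens_lift_pi zlift_fgen. Qed.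

Lemma tens_liftB : {morph tens_lift b : x y / x - y}.
Proof.
move=> x y; rewrite -[x in LHS]reprK -[y in LHS]reprK.
by rewrite -(raddfB (\pi_(Quotient.quot tens_ideal))) tens_lift_pi zliftB.
Qed.

End Balanced.
End TensorProduct.

Section SingularChains.
Context {R : realType}.

Definition std_simplex (n : nat) : set 'rV[R]_n.+1 :=
  [set x | (forall j, 0 <= x ord0 j) /\ \sum_j x ord0 j = 1].

Arguments std_simplex : clear implicits.

Definition insert0 n (i : 'I_n.+2) (x : 'rV[R]_n.+1) : 'rV[R]_n.+2 :=
  \row_j (if unlift i j is Some k then x ord0 k else 0).

Arguments insert0 {n} i x.

Lemma insert0_std_simplex n (i : 'I_n.+2) (x : set_type (std_simplex n)) :
  insert0 i (val x) \in std_simplex n.+1.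
Proof.
case: x => x /= /set_mem[x0 x1]; apply/mem_set; split=> [j|].
  by rewrite mxE; case: unliftP => // k _; exact: x0.
rewrite (bigD1_ord i) //= mxE unlift_none add0r -x1.
by apply: eq_bigr => k _; rewrite mxE liftK.
Qed.

Definition face n (i : 'I_n.+2) (x : set_type (std_simplex n)) :
    set_type (std_simplex n.+1) :=
  Sub (insert0 i (val x)) (insert0_std_simplex i x).

Lemma insert0_continuous n (i : 'I_n.+2) : continuous (@insert0 n i).
Proof.
move=> x A [P Px PA]; exists (fun (_ : 'I_1) (k : 'I_n.+1) => P ord0 (lift i k)).
  move=> /= i0 k; have := Px ord0 (lift i k); rewrite mxE liftK (ord1 i0); exact.
move=> y Py; apply: PA => i0 j; rewrite mxE (ord1 i0).
case: unliftP => [k ->|->]; first exact: Py.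
by have := Px ord0 i; rewrite mxE unlift_none => /nbhs_singleton.
Qed.

Lemma face_continuous n (i : 'I_n.+2) : continuous (@face n i).
Proof.
apply: continuous_comp_initial => x.
apply: (@continuous_comp _ _ _ (set_val : set_type (std_simplex n) -> _)).
  exact: initial_continuous.
exact: insert0_continuous.
Qed.

HB.instance Definition _ n (i : 'I_n.+2) :=
  @isContinuous.Build _ _ (@face n i) (@face_continuous n i).

Definition singular_simplex (n : nat) (X : topologicalType) : choiceType :=
  continuousType (set_type (std_simplex n)) X.

Definition chain (n : nat) (X : topologicalType) : zmodType :=
  {freeg (singular_simplex n X) / int}.

Arguments singular_simplex : clear implicits.
Arguments chain : clear implicits.

Definition simplex_push n (X Y : topologicalType) (f : continuousType X Y)
    (s : singular_simplex n X) : singular_simplex n Y := f \o s.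

Definition push n (X Y : topologicalType) (f : continuousType X Y)
    (c : chain n X) : chain n Y :=
  zlift (fun s => fgen (simplex_push f s)) c.

Definition simplex_face n (X : topologicalType) (i : 'I_n.+2)
    (s : singular_simplex n.+1 X) : singular_simplex n X := s \o @face n i.

(* In degree 0 the boundary is the zero map from chains of degree 0 to
   themselves, since [0.-1] is [0]. *)
Definition boundary (n : nat) (X : topologicalType) :
    chain n X -> chain n.-1 X :=
  match n return chain n X -> chain n.-1 X with
  | 0 => fun=> 0
  | k.+1 => zlift (fun s : singular_simplex k.+1 X =>
      \sum_(i < k.+2) fgen (simplex_face i s) *~ (-1) ^+ i)
  end.
Arguments boundary {n X} c.

Definition chain_in n (X : topologicalType) (A : set X) (c : chain n X) : Prop :=
  forall s : singular_simplex n X, s \in dom c -> range s `<=` A.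

Definition rel_cycle n (X : topologicalType) (A : set X) (c : chain n X) : Prop :=
  chain_in A (boundary c).

Definition rel_homologous n (X : topologicalType) (A : set X)
    (c c' : chain n X) : Prop :=
  exists b : chain n.+1 X, chain_in A (c - c' - boundary b).

(* [o x] is a relative cycle representing the local orientation, a generator
   of H_n(X, X \ {x}). *)
Definition is_orientation n (X : topologicalType) (o : X -> chain n X) : Prop :=
  [/\ forall x, rel_cycle (~` [set x]) (o x),
      forall x c, rel_cycle (~` [set x]) c ->
        exists k : int, rel_homologous (~` [set x]) c (o x *~ k) &
      forall x, exists U : set X, [/\ open U, U x &
        exists2 b : chain n X, rel_cycle (~` U) b &
          forall y, U y -> rel_homologous (~` [set y]) b (o y)]].

(* A cycle restricting to the local orientation at every point, i.e. a
   representative of the integral fundamental class. *)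
Definition is_fundamental_cycle n (X : topologicalType) (o : X -> chain n X)
    (z : chain n X) : Prop :=
  boundary z = 0 /\ forall x, rel_homologous (~` [set x]) z (o x).

Lemma pushB n (X Y : topologicalType) (f : continuousType X Y) :
  {morph @push n X Y f : c c' / c - c'}.
Proof. exact: zliftB. Qed.

Lemma boundaryB n (X : topologicalType) :
  {morph @boundary n X : c c' / c - c'}.
Proof. by case: n => [|n] c c'; [rewrite /= subrr|exact: zliftB]. Qed.

Lemma pushD n (X Y : topologicalType) (f : continuousType X Y) :
  {morph @push n X Y f : c c' / c + c'}.
Proof. exact: zliftD. Qed.

Lemma boundaryD n (X : topologicalType) :
  {morph @boundary n X : c c' / c + c'}.
Proof. by case: n => [|n] c c'; [rewrite /= addr0|exact: zliftD]. Qed.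

Lemma boundary_push n (X Y : topologicalType) (f : continuousType X Y)
    (c : chain n X) :
  boundary (push f c) = push f (boundary c).
Proof.
case: n c => [|n] c; first by rewrite /= /push zlift0.
rewrite /boundary /push.
apply: (zlift_ind (phi := fun c => zlift _ (zlift _ c))
                  (psi := fun c => zlift _ (zlift _ c))) => [x y|x y|s].
- by rewrite !zliftB.
- by rewrite !zliftB.
rewrite !zlift_fgen zlift_sum; apply: eq_bigr => i _.
by rewrite zliftMz zlift_fgen; congr (fgen _ *~ _); apply/continuousEP.
Qed.

End SingularChains.
Arguments std_simplex R n _ : clear implicits.
Arguments singular_simplex R n X : clear implicits.
Arguments chain R n X : clear implicits.

Section Topology.
Context {R : realType}.

Local Notation I01 := (`[0, 1]%classic : set R).

Definition closed_manifold (n : nat) (M : topologicalType) : Prop :=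
  [/\ hausdorff_space M, @second_countable M, compact [set: M] &
    forall x : M, exists (U : set M) (V : set 'rV[R]_n)
        (phi : M -> 'rV[R]_n) (psi : 'rV[R]_n -> M),
      [/\ open U, U x & open V] /\
      [/\ {homo phi : y / U y >-> V y}, {homo psi : v / V v >-> U v},
          {within U, continuous phi}, {within V, continuous psi} &
          (forall y, U y -> psi (phi y) = y) /\
          (forall v, V v -> phi (psi v) = v)]].

(* Only the restriction of [g] to [0, 1] matters. *)
Definition is_path (X : topologicalType) (x y : X) (g : R -> X) : Prop :=
  [/\ {within I01, continuous g}, g 0 = x & g 1 = y].

Definition path_concat (X : topologicalType) (g h : R -> X) (t : R) : X :=
  if t <= 2^-1 then g (2 * t) else h (2 * t - 1).

Definition path_homotopic (X : topologicalType) (x y : X) (g h : R -> X) : Prop :=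
  exists H : R * R -> X,
  [/\ {within I01 `*` I01, continuous H},
      forall t, I01 t -> H (t, 0) = g t /\ H (t, 1) = h t &
      forall s, I01 s -> H (0, s) = x /\ H (1, s) = y].

(* [cls] exhibits [G] as the quotient of the loops at [x] by homotopy. *)
Definition is_fundamental_group (X : topologicalType) (x : X) (G : groupType)
    (cls : (R -> X) -> G) : Prop :=
  [/\ forall a, exists2 g, is_path x x g & cls g = a,
      forall g h, is_path x x g -> is_path x x h ->
        (cls g = cls h <-> path_homotopic x x g h) &
      forall g h, is_path x x g -> is_path x x h ->
        cls (path_concat g h) = (cls g * cls h)%g].

Definition simply_connected (X : topologicalType) : Prop :=
  (forall x y : X, exists g, is_path x y g) /\
  (forall (x : X) g, is_path x x g -> path_homotopic x x g (cst x)).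

Definition contractible (X : topologicalType) : Prop :=
  exists (x0 : X) (H : X * R -> X),
  {within [set: X] `*` I01, continuous H} /\
  forall x, H (x, 0) = x /\ H (x, 1) = x0.

Definition is_covering (E B : topologicalType) (p : E -> B) : Prop :=
  [/\ continuous p, forall b, exists e, p e = b &
    forall b, exists U : set B, [/\ open U, U b &
      exists (I : Type) (V : I -> set E),
      [/\ forall i, open (V i), trivIset [set: I] V,
          p @^-1` U = \bigcup_i V i &
          forall i, exists s : B -> E,
          [/\ {within U, continuous s}, {homo s : u / U u >-> V i u},
              forall u, U u -> p (s u) = u &
              forall e, V i e -> s (p e) = e]]]].

Definition is_universal_covering (E B : topologicalType) (p : E -> B) : Prop :=
  is_covering p /\ simply_connected E.

(* The left action of the fundamental group, given by [cls], on the covering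
   space by deck transformations: the class of a loop at [p e0] sends [e0] to
   the end point of the lift of this loop starting at [e0]. *)
Definition is_deck_action (E B : topologicalType) (p : E -> B) (e0 : E)
    (G : groupType) (cls : (R -> B) -> G) (deck : G -> continuousType E E) : Prop :=
  [/\ forall e, deck 1%g e = e,
      forall a b e, deck (a * b)%g e = deck a (deck b e),
      forall a e, p (deck a e) = p e &
      forall (g : R -> E) e, is_path e0 e g -> p e = p e0 ->
        deck (cls (p \o g)) e0 = e].

End Topology.
Arguments closed_manifold R n M : clear implicits.
Arguments simply_connected R X : clear implicits.
Arguments contractible R X : clear implicits.
Arguments is_universal_covering R {E B} p.

Section Amenability.
Context {R : realType}.

Definition fun_bounded (T : Type) (f : T -> R) : Prop :=
  exists B : R, forall x, `|f x| <= B.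

Definition amenable (G : groupType) : Prop :=
  exists m : (G -> R) -> R,
  [/\ forall f g, fun_bounded f -> fun_bounded g -> m (f \+ g) = m f + m g,
      forall a f, fun_bounded f -> m (fun x => a * f x) = a * m f,
      forall f, fun_bounded f -> (forall x, 0 <= f x) -> 0 <= m f,
      m (cst 1) = 1 &
      forall a f, fun_bounded f -> m (fun x => f (a * x)%g) = m f].

End Amenability.
Arguments amenable R G : clear implicits.
Section StandardSpaces.
Context {R : realType}.

(* A standard Borel space: isomorphic to a complete separable metric space
   with its Borel sigma-algebra. *)
Definition standard_borel d (X : measurableType d) : Prop :=
  exists (T : metricType R) (f : X -> T),
  [/\ forall F : set_system T, ProperFilter F -> cauchy F -> exists t : T, F --> t,
      exists2 D : set T, countable D & dense D,
      bijective f &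
      forall A : set X, measurable A <-> <<s [set U : set T | open U] >> (f @` A)].

Record standard_space (G : groupType) := StandardSpace {
  space_display : measure_display;
  space_type :> measurableType space_display;
  space_prob : probability space_type R;
  space_act : G -> space_type -> space_type;
  space_standard : standard_borel space_type;
  space_act1 : forall x, space_act 1%g x = x;
  space_actM : forall a b x, space_act (a * b)%g x = space_act a (space_act b x);
  space_act_measurable : forall a, measurable_fun [set: space_type] (space_act a);
  space_act_preserving : forall a (B : set space_type), measurable B ->
    space_prob (space_act a @^-1` B) = space_prob B
}.

Definition essentially_free G (alpha : standard_space G) : Prop :=
  exists A : set alpha, [/\ measurable A, space_prob alpha A = 1%E &
    forall x a, A x -> space_act a x = x -> a = 1%g].

End StandardSpaces.
Arguments standard_space R G : clear implicits.

Section EssentiallyBoundedFunctions.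
Context {R : realType} {d : measure_display} {X : measurableType d}.
Variable mu : probability X R.

Definition ess_bounded_fun : {pred X -> int} :=
  [pred f | `[< (forall B : set int, measurable (f @^-1` B)) /\
    (exists N : nat, {ae mu, forall x, (`|f x| <= N)%N}) >]].

Lemma ess_bounded_fun_zmod_closed : zmod_closed ess_bounded_fun.
Proof.
split.
  apply/asboolP; split=> [B|].
    rewrite (_ : _ @^-1` B = if 0 \in B then setT else set0).
      by case: ifP.
    by apply/seteqP; split=> x /=; case: ifPn; rewrite ?inE// notin_setE.
  by exists 0%N; apply: aeW.
move=> f g /asboolP[mf [M fM]] /asboolP[mg [N gN]]; apply/asboolP; split.
  move=> B; rewrite (_ : _ @^-1` B =
      \bigcup_k (f @^-1` [set l | B (l - k)] `&` g @^-1` [set k])).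
    apply: countable_bigcupT_measurable => [|k]; first exact: countableP.
    exact: measurableI.
  apply/seteqP; split=> [x /= Bx|x [k _ [/= Bx gk]]]; first by exists (g x).
  by rewrite /preimage/= -gk in Bx *.
exists (M + N)%N; apply: filterS2 fM gN => x fM gN.
rewrite -lez_nat abszE PoszD (le_trans (ler_normB _ _))// lerD//.
Qed.

HB.instance Definition _ := GRing.isZmodClosed.Build _ ess_bounded_fun
  ess_bounded_fun_zmod_closed.

Record bounded_fun := BoundedFun {
  bounded_fun_val :> X -> int;
  _ : bounded_fun_val \in ess_bounded_fun }.

HB.instance Definition _ := [isSub for bounded_fun_val].
HB.instance Definition _ := [Choice of bounded_fun by <:].
HB.instance Definition _ := [SubChoice_isSubZmodule of bounded_fun by <:].

Definition ae_zero : {pred bounded_fun} :=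
  [pred f : bounded_fun | `[< {ae mu, forall x, f x = 0} >]].

Lemma ae_zero_zmod_closed : zmod_closed ae_zero.
Proof.
split; first by apply/asboolP; apply: aeW.
move=> f g /asboolP f0 /asboolP g0; apply/asboolP.
apply: filterS2 f0 g0 => x fx gx.
by rewrite [LHS](_ : _ = f x - g x)// fx gx subrr.
Qed.

HB.instance Definition _ := GRing.isZmodClosed.Build _ ae_zero
  ae_zero_zmod_closed.

(* $L^\infty(X, \mu, \mathbb Z)$ *)
Definition Linf : zmodType := Quotient.quot ae_zero.

Definition Linf_pi (f : bounded_fun) : Linf := \pi_(Quotient.quot ae_zero) f.

Definition Linf_repr (f : Linf) : bounded_fun := repr (f : Quotient.quot ae_zero).

Definition Linf_norm (f : Linf) : \bar R :=
  (\int[mu]_x (`|Linf_repr f x|%:~R)%:E)%E.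

Lemma cst_ess_bounded (k : int) : (fun=> k) \in ess_bounded_fun.
Proof.
apply/asboolP; split=> [B|]; last by exists `|k|%N; apply: aeW.
rewrite (_ : _ @^-1` B = if k \in B then setT else set0); first by case: ifP.
by apply/seteqP; split=> x /=; case: ifPn; rewrite ?inE// notin_setE.
Qed.

Definition Linf_cst (k : int) : Linf := Linf_pi (BoundedFun (cst_ess_bounded k)).

Lemma Linf_cstD k l : Linf_cst (k + l) = Linf_cst k + Linf_cst l.
Proof.
rewrite /Linf_cst /Linf_pi -(raddfD (\pi_(Quotient.quot ae_zero))).
by congr (\pi _); exact: val_inj.
Qed.

End EssentiallyBoundedFunctions.

Section RightAction.
Context {R : realType} {G : groupType} (alpha : standard_space R G).
Local Notation mu := (space_prob alpha).

Lemma space_act_ae a (P : alpha -> Prop) :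
  {ae mu, forall x, P x} -> {ae mu, forall x, P (space_act a x)}.
Proof.
move=> [N [mN N0 PN]]; exists (space_act a @^-1` N); split.
- by rewrite -[_ @^-1` _]setTI; exact: (space_act_measurable a).
- by rewrite space_act_preserving.
- by move=> x Px; apply: PN.
Qed.

Lemma comp_act_ess_bounded (f : bounded_fun mu) a :
  f \o space_act a \in ess_bounded_fun mu.
Proof.
case: f => f /= /asboolP[mf [N fN]]; apply/asboolP; split=> [B|].
  rewrite comp_preimage -[_ @^-1` _]setTI.
  by apply: (space_act_measurable a) => //; exact: mf.
by exists N; exact: (space_act_ae a fN).
Qed.

Definition Linf_act (f : Linf mu) (a : G) : Linf mu :=
  Linf_pi (BoundedFun (comp_act_ess_bounded (Linf_repr f) a)).

Lemma Linf_act_pi (f : bounded_fun mu) a :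
  Linf_act (Linf_pi f) a = Linf_pi (BoundedFun (comp_act_ess_bounded f a)).
Proof.
apply/eqP; rewrite /Linf_act /Linf_pi -Quotient.idealrBE; apply/asboolP.
have : Linf_repr (Linf_pi f) - f \in @ae_zero _ _ _ mu.
  by rewrite Quotient.idealrBE reprK.
move=> /asboolP /(space_act_ae a); apply: filterS => x /= fx.
exact: fx.
Qed.

Lemma Linf_act_cst k a : Linf_act (Linf_cst mu k) a = Linf_cst mu k.
Proof. by rewrite Linf_act_pi; congr Linf_pi; exact: val_inj. Qed.

End RightAction.

Section ParametrizedChains.
Context {R : realType} {G : groupType} {M E : topologicalType}.
Variables (p : continuousType E M) (deck : G -> continuousType E E).

Definition deck_push n (a : G) (c : chain R n E) : chain R n E := push (deck a) c.
#[local] Arguments deck_push : clear implicits.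

(* $\mathbb Z \otimes_{\mathbb Z G} C_n(E; \mathbb Z)$ *)
Definition coinv_chain n : zmodType :=
  tensor (fun (k : int) (_ : G) => k) (deck_push n).

(* the canonical isomorphism of coinv_chain with $C_n(M; \mathbb Z)$ *)
Definition coinv_to_base n : coinv_chain n -> chain R n M :=
  tens_lift (fun k c => push p c *~ k).

Lemma coinv_to_base_tens n k (c : chain R n E) :
    (forall a e, p (deck a e) = p e) ->
  coinv_to_base (tens _ (deck_push n) k c) = push p c *~ k.
Proof.
move=> pdeck; apply: tens_lift_tens => [j l e|j e e'|j a e].
- exact: mulrzDr.
- by rewrite pushD mulrzDl.
- congr (_ *~ j); apply: (zlift_ind (phi := push p)
    (psi := fun c => push p (deck_push n a c))) => [x y|x y|s].
  + exact: pushB.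
  + by rewrite /deck_push !pushB.
  rewrite /deck_push /push !zlift_fgen; congr fgen.
  by apply/continuousEP => x /=; rewrite /simplex_push /= pdeck.
Qed.

Section Space.
Variable alpha : standard_space R G.
Local Notation mu := (space_prob alpha).

(* $C_n(M; \alpha)$ *)
Definition param_chain n : zmodType := tensor (@Linf_act R G alpha) (deck_push n).

Definition param_tens n (f : Linf mu) (c : chain R n E) : param_chain n :=
  tens (@Linf_act R G alpha) (deck_push n) f c.

Definition param_boundary n : param_chain n -> param_chain n.-1 :=
  tens_lift (fun f c => param_tens f (boundary c)).

Definition cst_to_param n : coinv_chain n -> param_chain n :=
  tens_lift (fun k c => param_tens (Linf_cst mu k) c).

Lemma param_boundary_tens n f (c : chain R n E) :
  param_boundary (param_tens f c) = param_tens f (boundary c).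
Proof.
apply: tens_lift_tens => [g h e|g e e'|g a e].
- exact: tensDl.
- by rewrite boundaryD; exact: tensDr.
- by rewrite /param_tens tensG /deck_push boundary_push.
Qed.

Lemma cst_to_param_tens n k (c : chain R n E) :
  cst_to_param (tens _ (deck_push n) k c) = param_tens (Linf_cst mu k) c.
Proof.
apply: tens_lift_tens => [j l e|j e e'|j a e].
- by rewrite Linf_cstD; exact: tensDl.
- exact: tensDr.
- by rewrite -[in LHS](Linf_act_cst alpha j a); exact: tensG.
Qed.

(* [cst_to_param t] represents the image of the fundamental class under
   $C_n(M) \cong \mathbb Z \otimes_{\mathbb Z G} C_n(E) \to C_n(M; \alpha)$,
   and [c] is a homologous cycle. *)
Definition is_param_fundamental_cycle n (o : M -> chain R n M)
    (c : param_chain n) : Prop :=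
  param_boundary c = 0 /\
  exists t : coinv_chain n, is_fundamental_cycle o (coinv_to_base t) /\
    exists b : param_chain n.+1, c - cst_to_param t = param_boundary b.

Definition is_reduced_form n (s : seq (Linf mu * singular_simplex R n E))
    (c : param_chain n) : Prop :=
  uniq [seq simplex_push p fs.2 | fs <- s] /\
  c = \sum_(fs <- s) param_tens fs.1 (fgen fs.2).

(* [v] is the norm of [c], read off a reduced form, which determines it. *)
Definition is_param_norm n (c : param_chain n) (v : \bar R) : Prop :=
  exists2 s, is_reduced_form s c & v = (\sum_(fs <- s) Linf_norm fs.1)%E.

Definition param_simplicial_volume n (o : M -> chain R n M) : \bar R :=
  ereal_inf [set v | exists2 c, is_param_fundamental_cycle o c & is_param_norm c v].

End Space.

Definition integral_foliated_simplicial_volume n (o : M -> chain R n M) : \bar R :=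
  ereal_inf [set v | exists alpha : standard_space R G,
    v = param_simplicial_volume alpha o].

End ParametrizedChains.

(* Main.v *)
(* Let z~ be a lift to the universal covering of a fine subdivision of an
   integral fundamental cycle, so that dz~ is a sum of terms s - g s with g in a
   finite set S of deck transformations. Amenability and freeness give, by the
   Rokhlin lemma, a map tau : X -> G with finitely many values such that
   tau(g x) g = tau(x) for all g in S, outside a set of measure e. Contractibility
   of E gives a cone operator h with d h = id - h d, and
     c = sum_a 1_{tau = a} (x) a^-1 h(a dz~)
   is homologous to 1 (x) z~, through sum_a 1_{tau = a} (x) a^-1 h(a z~). The
   terms of c coming from s and g s cancel except where tau(g x) g <> tau(x), so
   the norm of c is O(e).
   The cycle z exists because H_i(M, M - A) is controlled by the points of A when
   A is compact and i >= n, and subdivision makes its simplices liftable. *)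

Require Import Defs.
From HB Require Import structures.
From mathcomp Require Import freeg.
From mathcomp Require Import all_boot all_order all_algebra.
From mathcomp Require Import generic_quotient ring_quotient.
From mathcomp Require Import all_classical all_reals all_analysis measurable_realfun.
From mathcomp Require Import ring lra zify.
Import Order.TTheory GRing.Theory Num.Theory.
Import numFieldNormedType.Exports.

Set Implicit Arguments.
Unset Strict Implicit.
Unset Printing Implicit Defensive.

Local Open Scope classical_set_scope.
Local Open Scope ring_scope.

(** * Chains *)

(** If the cone operator commuted with the deck transformations, coning the boundary of the lifted
    cycle would give 0 at once, because that boundary vanishes in the coinvariants. A contraction of
    [E] has no reason to be equivariant, and [tau] is the repair: translating by [tau x] before
    coning and back afterwards behaves equivariantly under [g] at every point where
    [tau (g x) * g = tau x]. Finitely many values of [tau] keep the chain a finite sum. Only the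
    finitely many [g] occurring in the boundary have to be respected, up to small measure. Hence no
    tiling of the group is needed: greedy towers modelled on a single Folner set suffice.
    Amenability is given as an invariant mean, so that Folner sets have to be extracted by a
    Hahn-Banach argument. The volume is an infimum over a set that could be empty, so a fundamental
    cycle has to be built from local orientations alone. The cone formula fails in degree 0, whence
    the positive dimension. *)

Section FreeAbelianGroupTheory.
Context {K : choiceType}.

(** Closure under subtraction alone matches the morphism lemmas, which are all stated for
    differences. Restricting the generators to the support of [c] lets hypotheses on the simplices
    of [c] enter the induction. *)
Lemma freeg_subgroup_ind (P : {freeg K / int} -> Prop) (c : {freeg K / int}) :
  P 0 -> (forall x y, P x -> P y -> P (x - y)) ->
  (forall k, k \in freeg.dom c -> P (fgen k)) -> P c.
Proof.
move=> P0 PB Pgen.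
have PN x : P x -> P (- x) by rewrite -sub0r; exact: PB.
have PD x y : P x -> P y -> P (x + y).
  by move=> Px Py; rewrite -[y]opprK; apply: PB => //; exact: PN.
have PMn x n : P x -> P (x *+ n).
  by move=> Px; elim: n => // n IHn; rewrite mulrS; exact: PD.
rewrite -[c]freeg_sumE big_seq; elim/big_ind: _ => // k /Pgen Pk.
have -> : << freeg.coeff k c *g k >> = fgen k *~ freeg.coeff k c.
  by rewrite /fgen freegU_mulz intz.
by case: (freeg.coeff k c) => n; rewrite ?NegzE ?mulrNz; [|apply: PN]; exact: PMn.
Qed.

Lemma dom_fgen (k : K) : freeg.dom (fgen k) = [:: k].
Proof. by rewrite /fgen domU1. Qed.

End FreeAbelianGroupTheory.

Section ChainsIn.
Context {R : realType}.

Section Support.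
Context {n : nat} {X : topologicalType}.
Implicit Types (A B : set X) (c : chain R n X).

Lemma chain_in_ind A (P : chain R n X -> Prop) c :
  P 0 -> (forall x y, P x -> P y -> P (x - y)) ->
  (forall s : singular_simplex R n X, range s `<=` A -> P (fgen s)) ->
  chain_in A c -> P c.
Proof.
by move=> P0 PB Pgen cA; apply: freeg_subgroup_ind => // s /cA; exact: Pgen.
Qed.

Lemma chain_in0 A : chain_in A (0 : chain R n X).
Proof. by move=> s; rewrite dom0. Qed.

Lemma chain_inB A c c' : chain_in A c -> chain_in A c' -> chain_in A (c - c').
Proof.
by move=> cA c'A s /domB; rewrite mem_cat => /orP[/cA|/c'A].
Qed.

Lemma chain_inN A c : chain_in A c -> chain_in A (- c).
Proof. by move=> cA; rewrite -sub0r; apply: chain_inB => //; exact: chain_in0. Qed.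

Lemma chain_inD A c c' : chain_in A c -> chain_in A c' -> chain_in A (c + c').
Proof.
by move=> cA c'A; rewrite -[c']opprK; apply: chain_inB => //; exact: chain_inN.
Qed.

Lemma chain_inMz A c k : chain_in A c -> chain_in A (c *~ k).
Proof.
move=> cA; have h m : chain_in A (c *+ m).
  elim: m => [|m IHm]; first exact: chain_in0.
  by rewrite mulrS; exact: chain_inD.
by case: k => m; rewrite ?NegzE ?mulrNz; [|apply: chain_inN]; exact: h.
Qed.

Lemma chain_in_sum A I (r : seq I) (P : pred I) (F : I -> chain R n X) :
  (forall i, P i -> chain_in A (F i)) -> chain_in A (\sum_(i <- r | P i) F i).
Proof.
by move=> FA; elim/big_ind: _ => //; [exact: chain_in0|exact: chain_inD].
Qed.

Lemma chain_in_fgen A (s : singular_simplex R n X) :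
  range s `<=` A -> chain_in A (fgen s).
Proof. by move=> sA t; rewrite dom_fgen inE => /eqP ->. Qed.

Lemma sub_chain_in A B c : A `<=` B -> chain_in A c -> chain_in B c.
Proof. by move=> AB cA s /cA sA; exact: subset_trans AB. Qed.

Lemma chain_inI A B c : chain_in A c -> chain_in B c -> chain_in (A `&` B) c.
Proof. by move=> cA cB s sc; rewrite subsetI; split; [exact: cA|exact: cB]. Qed.

Lemma chain_in_split A B c :
  (forall s : singular_simplex R n X, s \in freeg.dom c ->
    range s `<=` A \/ range s `<=` B) ->
  exists a b, [/\ c = a + b, chain_in A a & chain_in B b].
Proof.
move=> cAB; apply: (freeg_subgroup_ind (P := fun c => exists a b : chain R n X,
  [/\ c = a + b, chain_in A a & chain_in B b])) => [|x y|s sc].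
- by exists 0, 0; rewrite addr0; split=> //; exact: chain_in0.
- move=> [a [b [-> aA bB]]] [a' [b' [-> aA' bB']]].
  exists (a - a'), (b - b'); split; [|exact: chain_inB|exact: chain_inB].
  by rewrite opprD addrACA.
- case: (cAB s sc) => sAB; [exists (fgen s), 0|exists 0, (fgen s)].
  + by split; [rewrite addr0|exact: chain_in_fgen|exact: chain_in0].
  + by split; [rewrite add0r|exact: chain_in0|exact: chain_in_fgen].
Qed.

End Support.

Lemma chain_in_zlift n m (X Y : topologicalType) (A : set X) (B : set Y)
    (f : singular_simplex R n X -> chain R m Y) c :
  (forall s : singular_simplex R n X, range s `<=` A -> chain_in B (f s)) ->
  chain_in A c -> chain_in B (zlift f c).
Proof.
move=> fAB; apply: (chain_in_ind (P := fun c => chain_in B (zlift f c)))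
  => [|x y xB yB|s sA].
- by rewrite zlift0; exact: chain_in0.
- by rewrite zliftB; exact: chain_inB.
- by rewrite zlift_fgen; exact: fAB.
Qed.

Lemma chain_in_boundary n (X : topologicalType) (A : set X) (c : chain R n X) :
  chain_in A c -> chain_in A (boundary c).
Proof.
case: n c => [|n] c; first by move=> _; exact: chain_in0.
apply: chain_in_zlift => s sA; apply: chain_in_sum => i _.
apply: chain_inMz; apply: chain_in_fgen => _ [x _ <-]; apply: sA.
by exists (face i x).
Qed.

Lemma chain_in_push n (X Y : topologicalType) (A : set X) (B : set Y)
    (f : continuousType X Y) (c : chain R n X) :
  (forall x, A x -> B (f x)) -> chain_in A c -> chain_in B (push f c).
Proof.
move=> fAB; apply: chain_in_zlift => s sA; apply: chain_in_fgen.
by move=> _ [x _ <-]; apply/fAB/sA; exists x.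
Qed.

Lemma push_fgen n (X Y : topologicalType) (f : continuousType X Y)
    (s : singular_simplex R n X) : push f (fgen s) = fgen (simplex_push f s).
Proof. exact: zlift_fgen. Qed.

Lemma eq_simplex n (X : topologicalType) (s t : singular_simplex R n X) :
  (forall x, s x = t x) -> s = t.
Proof. by move=> e; apply/continuousEP. Qed.

Lemma push_comp n (X Y Z : topologicalType) (f : continuousType X Y)
    (g : continuousType Y Z) (h : continuousType X Z) (c : chain R n X) :
  (forall x, h x = g (f x)) -> push g (push f c) = push h c.
Proof.
move=> hE; apply: (zlift_ind (phi := fun c => push g (push f c)))
  => [x y|x y|s]; rewrite ?pushB// !push_fgen.
by congr fgen; apply: eq_simplex => x; rewrite /= hE.
Qed.

Lemma push_id n (X : topologicalType) (h : continuousType X X) (c : chain R n X) :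
  (forall x, h x = x) -> push h c = c.
Proof.
move=> hE; apply: (zlift_ind (psi := id)) => [x y|//|s]; first exact: pushB.
by rewrite push_fgen; congr fgen; apply: eq_simplex => x; rewrite /= hE.
Qed.

Lemma push0 n (X Y : topologicalType) (f : continuousType X Y) :
  @push R n X Y f 0 = 0.
Proof. exact: zlift0. Qed.

Lemma boundary0 n (X : topologicalType) : boundary (0 : chain R n X) = 0.
Proof. by rewrite -(subrr 0) boundaryB subrr. Qed.

Lemma boundaryMz n (X : topologicalType) k :
  {morph @boundary R n X : c / c *~ k}.
Proof. by case: n => [|n] c; [rewrite /= mul0rz|exact: zliftMz]. Qed.

Lemma boundary_sum n (X : topologicalType) I (r : seq I) (F : I -> chain R n X) :
  boundary (\sum_(i <- r) F i) = \sum_(i <- r) boundary (F i).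
Proof.
by elim: r => [|i r IHr]; rewrite ?big_nil ?boundary0// !big_cons boundaryD IHr.
Qed.

Lemma boundary_fgen n (X : topologicalType) (s : singular_simplex R n.+1 X) :
  boundary (fgen s) = \sum_(i < n.+2) fgen (simplex_face i s) *~ (-1) ^+ i.
Proof. by rewrite /= zlift_fgen. Qed.

(** The cosimplicial identity on indices; [i'] and [j'] are [i] and [j.+1] read in the other ordinal
    type. The last two equalities locate the two inserted zeros. *)
Lemma lift_lift n (i : 'I_n.+3) (j : 'I_n.+2) (i' : 'I_n.+2) (j' : 'I_n.+3) :
  (i <= j)%N -> i' = i :> nat -> j' = j.+1 :> nat ->
  [/\ forall k : 'I_n.+1, lift i (lift j k) = lift j' (lift i' k),
      lift j' i' = i & lift i j = j'].
Proof.
move=> ij ei ej; split=> [k||]; apply: val_inj; rewrite /= ?ei ?ej /bump; lia.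
Qed.

Lemma face_face n (i : 'I_n.+3) (j : 'I_n.+2) (i' : 'I_n.+2) (j' : 'I_n.+3)
    (x : set_type (std_simplex R n)) :
  (i <= j)%N -> i' = i :> nat -> j' = j.+1 :> nat ->
  face i (face j x) = face j' (face i' x).
Proof.
move=> ij ei ej; have [e1 e2 e3] := lift_lift ij ei ej.
apply: val_inj; apply/rowP => l /=; rewrite !mxE.
case: (unliftP i l) => [k ->|->]; last first.
  by rewrite -e2 liftK mxE unlift_none.
rewrite mxE; case: (unliftP j k) => [m ->|->].
  by rewrite e1 liftK mxE liftK.
by rewrite e3 unlift_none.
Qed.

(** Passing from [m] to [m.+1] adds the row [m.+1] and the column [m], and these cancel term by
    term. *)
Lemma alternating_double_sum (V : zmodType) (F : nat -> nat -> V) m :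
  (forall i j, (i <= j < m)%N -> F j.+1 i = - F i j) ->
  \sum_(0 <= i < m.+1) \sum_(0 <= j < m) F i j = 0.
Proof.
elim: m => [|m IHm] Fanti; first by rewrite big_nat1 big_geq.
rewrite big_nat_recr //=.
under eq_bigr do rewrite big_nat_recr //=.
rewrite big_split /= IHm ?add0r => [|i j /andP[ij jm]]; last first.
  by apply: Fanti; rewrite ij ltnW.
rewrite -big_split /= big_nat big1 // => i /andP[_ im].
by rewrite Fanti ?subrr// -ltnS im /=.
Qed.

Lemma boundary_boundary n (X : topologicalType) (c : chain R n X) :
  boundary (boundary c) = 0.
Proof.
case: n c => [|[|n]] c //.
apply: (zlift_ind (phi := fun c => boundary (boundary c)) (psi := fun=> 0))
  => [x y|x y|s]; [by rewrite !boundaryB|by rewrite subrr|].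
rewrite boundary_fgen boundary_sum.
(* Reading the indices through [inord] replaces two ordinal types by natural numbers, as the
   cancellation lemma requires. *)
pose F i j := fgen (simplex_face (inord j : 'I_n.+2)
  (simplex_face (inord i : 'I_n.+3) s)) *~ ((-1) ^+ i * (-1) ^+ j).
transitivity (\sum_(0 <= i < n.+3) \sum_(0 <= j < n.+2) F i j).
  rewrite big_mkord; apply: eq_bigr => i _.
  rewrite big_mkord boundaryMz boundary_fgen mulrz_suml.
  by apply: eq_bigr => j _; rewrite /F !inord_val -mulrzA mulrC.
apply: alternating_double_sum => i j /andP[ij jn].
rewrite /F exprS mulN1r mulNr mulrNz mulrC; congr (- (fgen _ *~ _)).
apply: eq_simplex => x /=; congr (s _); symmetry.
by apply: face_face; rewrite !inordK//; lia.
Qed.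

End ChainsIn.

(** * Continuity on subspaces and the topology of the standard simplex *)

Section PointwiseContinuity.

Lemma nbhs_set_typeP (X : topologicalType) (A : set X) (x : set_type A)
    (U : set (set_type A)) :
  nbhs x U <-> exists2 V, nbhs (val x) V & forall y : set_type A, V (val y) -> U y.
Proof.
split=> [[_ [[W Wop <-] Wx] WU]|[V Vx VU]].
  by exists W => [|y Wy]; [exact: open_nbhs_nbhs|exact: WU].
have : nbhs x (set_val @^-1` V) by exact: (@initial_continuous _ _ set_val x V).
by apply: filterS => y /VU.
Qed.

Lemma cvg_set_type (Z X : topologicalType) (A : set X) (f : Z -> set_type A) z :
  (fun y => val (f y)) @ z --> val (f z) -> f @ z --> f z.
Proof.
move=> fz U /nbhs_set_typeP[V Vfz VU].
have : \forall y \near z, V (val (f y)) by exact: fz.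
by apply: filterS => y; exact: VU.
Qed.

Lemma val_continuous (X : topologicalType) (A : set X) :
  continuous (val : set_type A -> X).
Proof. by move=> x U Ux; apply/nbhs_set_typeP; exists U. Qed.

(** Near coverings transport from the subtype to [X]: the covering property is read at [y] for every
    proof [h] that [y] lies in [A]. *)
Lemma compact_set_typeT (X : topologicalType) (A : set X) :
  compact A -> compact [set: set_type A].
Proof.
move=> /compact_near_coveringP /near_covering_withinP Ac.
apply/compact_near_coveringP => I F P FF FP.
have : \forall i \near F, A `<=` fun y => forall h : y \in A, P i (exist _ y h).
  apply: (Ac I F (fun i y => forall h : y \in A, P i (exist _ y h)) FF) => x Ax.
  have [[U D] [/= /nbhs_set_typeP[V Vx VU] FD] UDP] :=
    FP (exist _ x (mem_set Ax)) Logic.I.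
  exists (V, D) => //= -[y i] [/= Vy Di] Ay h.
  by apply: (UDP (exist _ y h, i)); split=> //=; exact: VU.
by apply: filterS => i iP [y yA] _; exact: (iP y (set_mem yA)).
Qed.

Lemma for_continuous_pair (Z X Y : topologicalType) (f : Z -> X) (g : Z -> Y) z :
  {for z, continuous f} -> {for z, continuous g} ->
  {for z, continuous (fun z => (f z, g z))}.
Proof. by move=> fz gz; exact: (cvg_pair fz gz). Qed.

Lemma for_continuous_comp (Z X Y : topologicalType) (f : Z -> X) (g : X -> Y) z :
  {for z, continuous f} -> {for f z, continuous g} ->
  {for z, continuous (fun z => g (f z))}.
Proof. exact: continuous_comp. Qed.

Context {R : realType}.

Lemma cvg_mx (Z : topologicalType) m n (f : Z -> 'M[R]_(m, n)) z :
  (forall i j, (fun y => f y i j) @ z --> f z i j) -> f @ z --> f z.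
Proof.
move=> fz U [P Pfz PU].
have : \forall y \near z, forall i j, P i j (f y i j).
  apply: filter_forall => i; apply: filter_forall => j.
  by have := Pfz i j => /(fz i j).
by apply: filterS => y /PU.
Qed.

Lemma within_continuous_comp_in (Z Y W : topologicalType) (A : set Y)
    (f : Z -> Y) (g : Y -> W) :
  continuous f -> (forall z, A (f z)) -> {within A, continuous g} ->
  continuous (g \o f).
Proof.
move=> fc fA /subspace_continuousP gc z U Ugfz.
have : \forall y \near f z, A y -> U (g y) by exact: (gc (f z) (fA z) U Ugfz).
move=> /(fc z) gU; have : \forall y \near z, A (f y) -> U (g (f y)) by exact: gU.
by apply: filterS => y; exact.
Qed.

Definition continuous_bundle (X Y : topologicalType) (f : X -> Y)
    (fc : continuous f) : continuousType X Y :=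
  HB.pack f (isContinuous.Build _ _ f fc).

End PointwiseContinuity.

Section StandardSimplex.
Context {R : realType}.

Lemma continuous_sumr (Z : topologicalType) (V : normedModType R) I (r : seq I)
    (f : I -> Z -> V) :
  (forall i, continuous (f i)) -> continuous (fun x => \sum_(i <- r) f i x).
Proof.
move=> fc z; elim: r => [|i r IHr].
  rewrite (_ : (fun x => _) = cst 0); first exact: cst_continuous.
  by apply/funext => x; rewrite big_nil.
rewrite (_ : (fun x => _) = f i \+ (fun x => \sum_(j <- r) f j x)).
  by apply: continuousD; [exact: fc|exact: IHr].
by apply/funext => x; rewrite big_cons.
Qed.

Lemma std_simplex_ge0 n (x : set_type (std_simplex R n)) j : 0 <= val x ord0 j.
Proof. by have [] := set_mem (valP x). Qed.

Lemma std_simplex_sum n (x : set_type (std_simplex R n)) :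
  \sum_j val x ord0 j = 1.
Proof. by have [] := set_mem (valP x). Qed.

Lemma std_simplex_le1 n (x : set_type (std_simplex R n)) j : val x ord0 j <= 1.
Proof.
rewrite -(std_simplex_sum x) (bigD1 j)//= lerDl sumr_ge0// => k _.
exact: std_simplex_ge0.
Qed.

Lemma std_simplex_compact n : compact (std_simplex R n).
Proof.
have /(_ R n.+1 (fun=> `[0, 1]%classic)) := @rV_compact.
move=> /(_ (fun=> @segment_compact _ _ _)) cK.
have -> : std_simplex R n = [set v : 'rV[R]_n.+1 | forall i, `[0, 1]%classic (v ord0 i)]
    `&` [set v | \sum_j v ord0 j = 1].
  apply/seteqP; split=> [x [x0 x1]|x [x01 x1]]; split=> // j; last first.
    by have := x01 j; rewrite /= in_itv/= => /andP[].
  rewrite /= in_itv/= x0 -x1 (bigD1 j)//= lerDl sumr_ge0// => k _; exact: x0.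
apply: compact_closedI => //.
have c : continuous (fun v : 'rV[R]_n.+1 => \sum_j v ord0 j).
  by apply: continuous_sumr => j; exact: coord_continuous.
by move/continuous_closedP: c => /(_ _ (@closed_eq _ 1)).
Qed.

Lemma std_simplex_barycenter n :
  const_mx n.+1%:R^-1 \in std_simplex R n.
Proof.
apply/mem_set; split=> [j|]; first by rewrite mxE invr_ge0 ler0n.
under eq_bigr do rewrite mxE.
by rewrite sumr_const card_ord -[LHS]mulr_natr mulVf// pnatr_eq0.
Qed.

Definition barycenter n : set_type (std_simplex R n) :=
  Sub (const_mx n.+1%:R^-1) (std_simplex_barycenter n).

(* The projection of the standard simplex from its vertex 0 to the opposite
   face, with a junk value at that vertex. *)
Definition simplex_tail n (x : set_type (std_simplex R n.+1)) :
    set_type (std_simplex R n) :=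
  insubd (barycenter n) (\row_j (val x ord0 (lift ord0 j) / (1 - val x ord0 ord0))).

Lemma simplex_tailE n (x : set_type (std_simplex R n.+1)) :
  val x ord0 ord0 != 1 ->
  val (simplex_tail x) = \row_j (val x ord0 (lift ord0 j) / (1 - val x ord0 ord0)).
Proof.
move=> x1; rewrite /simplex_tail insubdK//; apply/mem_set.
have x1' : 0 < 1 - val x ord0 ord0.
  by rewrite subr_gt0 lt_neqAle x1 std_simplex_le1.
split=> [j|]; first by rewrite mxE divr_ge0 ?std_simplex_ge0 ?ltW.
under eq_bigr do rewrite mxE.
rewrite -mulr_suml; apply: (canLR (mulfK _)); first by rewrite gt_eqF.
by have := std_simplex_sum x; rewrite big_ord_recl mul1r => <-; rewrite addrAC subrr add0r.
Qed.

Lemma simplex_coord_continuous n k :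
  continuous (fun y : set_type (std_simplex R n) => val y ord0 k).
Proof.
rewrite -/((fun v : 'rV[R]_n.+1 => v ord0 k) \o
  (val : set_type (std_simplex R n) -> _)) => x.
by apply: continuous_comp; [exact: val_continuous|exact: coord_continuous].
Qed.

Lemma simplex_tail_cvg n (x : set_type (std_simplex R n.+1)) :
  val x ord0 ord0 != 1 -> {for x, continuous (@simplex_tail n)}.
Proof.
move=> x1; apply: cvg_set_type.
pose g (y : set_type (std_simplex R n.+1)) : 'rV[R]_n.+1 :=
  \row_j (val y ord0 (lift ord0 j) / (1 - val y ord0 ord0)).
have e : {near x, g =1 (fun y => val (simplex_tail y))}.
  have : \forall y \near x, val (y : set_type (std_simplex R n.+1)) ord0 ord0 != 1.
    have := @simplex_coord_continuous n.+1 ord0 x [set t | t != 1]; apply.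
    by apply: open_nbhs_nbhs; split; [exact: open_neq|exact: x1].
  by apply: filterS => y y1; rewrite simplex_tailE.
rewrite simplex_tailE// -/(g x); apply: (cvg_trans (near_eq_cvg e)).
apply: cvg_mx => i j; have -> : (fun y => g y i j) =
    (fun y => val y ord0 (lift ord0 j) / (1 - val y ord0 ord0)).
  by apply/funext => y; rewrite mxE.
have c k := @simplex_coord_continuous n.+1 k x.
rewrite /g mxE; apply: (cvgM (c _)); apply: cvgV; first by rewrite subr_eq0 eq_sym.
by apply: (cvgB _ (c _)); exact: cvg_cst.
Qed.

End StandardSimplex.

(** * The cone operator of a contraction *)

Section Cone.
Context {R : realType}.

(** The map lives on all of [X * R], so that its continuity is global and composes freely; a
    homotopy given on [0, 1] is extended by clamping the time. *)
Record contraction (X : topologicalType) := Contraction {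
  contraction_pt : X;
  contraction_map :> X * R -> X;
  contraction_continuous : continuous contraction_map;
  contraction_map0 : forall x, contraction_map (x, 0) = x;
  contraction_map1 : forall x, contraction_map (x, 1) = contraction_pt
}.

Definition unit_clamp (t : R) : R := Num.max 0 (Num.min 1 t).

Lemma unit_clamp_le t : 0 <= unit_clamp t <= 1.
Proof. by rewrite /unit_clamp le_max lexx/= ge_max ler01/= ge_min lexx. Qed.

Lemma unit_clamp0 : unit_clamp 0 = 0.
Proof. by rewrite /unit_clamp minEle ler10 maxxx. Qed.

Lemma unit_clamp1 : unit_clamp 1 = 1.
Proof. by rewrite /unit_clamp minxx maxEle ler01. Qed.

Lemma unit_clamp_continuous : continuous unit_clamp.
Proof.
move=> t; apply: continuous_max; first exact: cst_continuous.
by apply: continuous_min; [exact: cst_continuous|exact: cvg_id].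
Qed.

Lemma contractible_contraction (X : topologicalType) :
  contractible R X -> inhabited (contraction X).
Proof.
move=> [x0 [H [Hc H01]]]; split.
have Kc : continuous (fun z : X * R => H (z.1, unit_clamp z.2)).
  have c : continuous (fun z : X * R => (z.1, unit_clamp z.2)).
    move=> z; apply: for_continuous_pair; first exact: cvg_fst.
    by apply: for_continuous_comp; [exact: cvg_snd|exact: unit_clamp_continuous].
  apply: (within_continuous_comp_in c _ Hc) => z.
  by split=> //; rewrite /= in_itv/=; exact: unit_clamp_le.
apply: (Contraction Kc (contraction_pt := x0)) => x /=.
- by rewrite unit_clamp0 (H01 x).1.
- by rewrite unit_clamp1 (H01 x).2.
Qed.

Section ConeOperator.
Context {X : topologicalType} (H : contraction X).

(** Vertex 0 is the apex. The coordinate of index 0 serves as the time of the contraction: it is 0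
    on the opposite face, where [s] is recovered, and 1 at the apex, where the contraction forgets
    the junk tail. *)
Definition cone_fun n (s : singular_simplex R n X)
    (x : set_type (std_simplex R n.+1)) : X :=
  H (s (simplex_tail x), val x ord0 ord0).

(* At the apex the tail is a junk value, and continuity comes from the
   compactness of the simplex. *)
Lemma cone_fun_continuous n (s : singular_simplex R n X) : continuous (cone_fun s).
Proof.
move=> x; have [x1|x1] := eqVneq (val x ord0 ord0) 1; last first.
  apply: (for_continuous_comp (f := fun y => (s (simplex_tail y), _))).
    apply: for_continuous_pair; last exact: simplex_coord_continuous.
    apply: for_continuous_comp; first exact: simplex_tail_cvg.
    exact: cts_fun.
  exact: contraction_continuous.
move=> U; rewrite /cone_fun x1 contraction_map1 => UH.
have Kc := (compact_near_coveringP _).1 (compact_set_typeT (@std_simplex_compact R n)).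
have HU : \forall t \near (1 : R), [set: set_type (std_simplex R n)] `<=`
    (fun w => U (H (s w, t))).
  apply: (Kc R (nbhs (1 : R)) (fun t w => U (H (s w, t))) _) => w _.
  have c : {for (w, 1), continuous (fun z => H (s z.1, z.2))}.
    apply: (for_continuous_comp (f := fun z => (s z.1, z.2))).
      apply: for_continuous_pair; last exact: cvg_snd.
      by apply: for_continuous_comp; [exact: cvg_fst|exact: cts_fun].
    exact: contraction_continuous.
  by apply: c => /=; rewrite contraction_map1.
have c0 := @simplex_coord_continuous R n.+1 ord0 x.
rewrite -x1 in HU.
have : \forall y \near x, [set: set_type (std_simplex R n)] `<=`
  (fun w => U (H (s w, val (y : set_type (std_simplex R n.+1)) ord0 ord0))) := c0 _ HU.
by apply: filterS => y; exact.
Qed.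

Definition cone_simplex n (s : singular_simplex R n X) :
  singular_simplex R n.+1 X := continuous_bundle (@cone_fun_continuous n s).

Definition cone n (c : chain R n X) : chain R n.+1 X :=
  zlift (fun s => fgen (cone_simplex s)) c.

Lemma coneB n : {morph @cone n : c c' / c - c'}. Proof. exact: zliftB. Qed.

Lemma coneMz n k : {morph @cone n : c / c *~ k}.
Proof. by move=> c; exact: zliftMz. Qed.

Lemma cone_sum n I (r : seq I) (F : I -> chain R n X) :
  cone (\sum_(i <- r) F i) = \sum_(i <- r) cone (F i).
Proof. exact: zlift_sum. Qed.

Lemma cone_fgen n (s : singular_simplex R n X) :
  cone (fgen s) = fgen (cone_simplex s).
Proof. exact: zlift_fgen. Qed.

Lemma cone_face0 n (s : singular_simplex R n X) :
  simplex_face ord0 (cone_simplex s) = s.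
Proof.
apply: eq_simplex => x; rewrite /= /cone_fun /= mxE unlift_none.
rewrite contraction_map0; congr (s _); apply: val_inj => /=.
rewrite simplex_tailE /= mxE ?unlift_none ?[0 == 1]eq_sym ?oner_neq0//.
by apply/rowP => j; rewrite !mxE liftK subr0 divr1.
Qed.

Lemma cone_face_lift n (s : singular_simplex R n.+1 X) (i : 'I_n.+2) :
  simplex_face (lift ord0 i) (cone_simplex s) = cone_simplex (simplex_face i s).
Proof.
apply: eq_simplex => x; rewrite /= /cone_fun.
have x0 : val (face (lift ord0 i) x) ord0 ord0 = val x ord0 ord0.
  rewrite /= mxE; case: unliftP => [k /(congr1 val)/= e|/(congr1 val)//].
  by have -> : k = ord0 by apply: val_inj; move: e; rewrite /= /bump; lia.
rewrite x0; have [->|x1] := eqVneq (val x ord0 ord0) 1; first by rewrite !contraction_map1.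
congr (H (s _, _)); apply: val_inj; rewrite /= simplex_tailE x0//.
apply/rowP => j; rewrite !mxE; case: (unliftP i j) => [k ->|->].
  have -> : lift ord0 (lift i k) = lift (lift ord0 i) (lift ord0 k).
    by apply: val_inj; rewrite /= /bump; lia.
  by rewrite liftK simplex_tailE// mxE.
by rewrite unlift_none mul0r.
Qed.

(** Face 0 of a cone is its base, and face [i + 1] is the cone over face [i], with the sign
    reversed. In degree 0 the formula is false: the cone over a vertex has a second face, constant
    at the contraction point. *)
Lemma boundary_cone n (c : chain R n.+1 X) :
  boundary (cone c) = c - cone (boundary c).
Proof.
apply: (zlift_ind (phi := fun c => boundary (cone c))
    (psi := fun c => c - cone (boundary c))) => [x y|x y|s].
- by rewrite coneB boundaryB.
- by rewrite boundaryB coneB !opprB addrACA [RHS]addrACA [- y + _]addrC.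
rewrite cone_fgen !boundary_fgen big_ord_recl expr0 cone_face0; congr (_ + _).
rewrite cone_sum -sumrN; apply: eq_bigr => i _.
by rewrite cone_face_lift coneMz cone_fgen exprS mulN1r mulrNz.
Qed.

Lemma chain_in_cone n (A B : set X) (c : chain R n X) :
  (forall x t, A x -> 0 <= t <= 1 -> B (H (x, t))) ->
  chain_in A c -> chain_in B (cone c).
Proof.
move=> HAB; apply: chain_in_zlift => s sA; apply: chain_in_fgen => _ [x _ <-].
apply: HAB; first by apply: sA; exists (simplex_tail x).
by rewrite std_simplex_ge0 std_simplex_le1.
Qed.

End ConeOperator.
End Cone.
Arguments contraction R X : clear implicits.

(** * Barycentric subdivision *)

Section FreeAbelianGroupDomain.
Context {K L : choiceType}.

Lemma mem_dom_fgen (k l : K) : k \in freeg.dom (fgen l) -> k = l.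
Proof. by rewrite dom_fgen inE => /eqP. Qed.

Lemma dom_zlift (f : K -> {freeg L / int}) (c : {freeg K / int}) t :
  t \in freeg.dom (zlift f c) -> exists2 s, s \in freeg.dom c & t \in freeg.dom (f s).
Proof.
pose P (d : {freeg K / int}) := forall t, t \in freeg.dom (zlift f d) ->
  exists2 s, s \in freeg.dom c & t \in freeg.dom (f s).
move: t; apply: (freeg_subgroup_ind (P := P)).
- by move=> t; rewrite zlift0 dom0.
- by move=> x y xP yP t; rewrite zliftB => /domB; rewrite mem_cat => /orP[/xP|/yP].
- by move=> k kc t; rewrite zlift_fgen; exists k.
Qed.

Lemma dom_sum_Mz I (r : seq I) (F : I -> {freeg L / int}) (k : I -> int) t :
  t \in freeg.dom (\sum_(i <- r) F i *~ k i) -> exists i, t \in freeg.dom (F i).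
Proof.
elim: r => [|i r IHr]; first by rewrite big_nil dom0.
rewrite big_cons => /domD_subset; rewrite mem_cat => /orP[|//].
rewrite mem_dom (_ : freeg.coeff t (F i *~ k i) = freeg.coeff t (F i) *~ k i).
  by move=> h; exists i; rewrite mem_dom; apply: contra_neq h => ->; rewrite mul0rz.
by case: (k i) => m; rewrite ?NegzE ?mulrNz ?coeffN -?pmulrn coeffMn.
Qed.

End FreeAbelianGroupDomain.

Lemma subrACA (V : zmodType) (x y a b : V) : x - y - (a - b) = x - a - (y - b).
Proof. by rewrite opprD addrACA -opprD. Qed.

Section BarycentricSubdivision.
Context {R : realType}.

Lemma boundary_boundaryS n (X : topologicalType) (c : chain R n.+2 X) :
  @boundary R n.+1 X (boundary c) = 0.
Proof. exact: (boundary_boundary c). Qed.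

Lemma std_simplex_convex n (x y : set_type (std_simplex R n)) t :
  0 <= t <= 1 -> (1 - t) *: val x + t *: val y \in std_simplex R n.
Proof.
move=> /andP[t0 t1]; apply/mem_set; split=> [j|].
  by rewrite !mxE addr_ge0// mulr_ge0 ?std_simplex_ge0// subr_ge0.
under eq_bigr do rewrite !mxE.
by rewrite big_split/= -!mulr_sumr !std_simplex_sum !mulr1 subrK.
Qed.

Definition bary_map n (z : set_type (std_simplex R n) * R) : set_type (std_simplex R n) :=
  exist (fun x => x \in std_simplex R n) _
    (std_simplex_convex z.1 (barycenter n) (unit_clamp_le z.2)).

Lemma bary_map_continuous n : continuous (@bary_map n).
Proof.
move=> z; apply: cvg_set_type => /=.
have tc : {for z, continuous (fun z : set_type (std_simplex R n) * R => unit_clamp z.2)}.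
  by apply: for_continuous_comp; [exact: cvg_snd|exact: unit_clamp_continuous].
apply: cvgD; apply: cvgZ => //.
- by apply: cvgB; [exact: cvg_cst|exact: tc].
- by apply: (for_continuous_comp (f := fst)); [exact: cvg_fst|exact: val_continuous].
- exact: cvg_cst.
Qed.

Lemma bary_map0 n x : @bary_map n (x, 0) = x.
Proof.
by apply: val_inj; rewrite /= unit_clamp0 subr0 scale1r scale0r addr0.
Qed.

Lemma bary_map1 n x : @bary_map n (x, 1) = barycenter n.
Proof.
by apply: val_inj; rewrite /= unit_clamp1 subrr scale1r scale0r add0r.
Qed.

Definition bary_contraction n : contraction R (set_type (std_simplex R n)) :=
  Contraction (@bary_map_continuous n) (@bary_map0 n) (@bary_map1 n).

Definition face_map n (i : 'I_n.+2) :
  continuousType (set_type (std_simplex R n)) (set_type (std_simplex R n.+1)) := @face R n i.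

Definition idsimplex n : singular_simplex R n (set_type (std_simplex R n)) :=
  @idfun (set_type (std_simplex R n)).

(** Acyclic models: an operator natural in the space is determined by its value on the identity
    simplex, where the convex simplex allows coning from the barycenter. *)
Fixpoint sd_id n : chain R n (set_type (std_simplex R n)) :=
  match n with
  | 0 => fgen (idsimplex 0)
  | k.+1 => cone (bary_contraction k.+1)
      (\sum_(i < k.+2) push (face_map i) (sd_id k) *~ (-1) ^+ i)
  end.

Definition sd n (X : topologicalType) (c : chain R n X) : chain R n X :=
  zlift (fun s : singular_simplex R n X => push s (sd_id n)) c.

(** The cone solves the homotopy equation [boundary T = id - sd - T boundary] for [T] on the
    identity simplex, the right-hand side being a cycle known from lower degree. *)
Fixpoint sd_htpy_id n : chain R n.+1 (set_type (std_simplex R n)) :=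
  match n with
  | 0 => 0
  | k.+1 => cone (bary_contraction k.+1)
      (fgen (idsimplex k.+1) - sd_id k.+1
        - \sum_(i < k.+2) push (face_map i) (sd_htpy_id k) *~ (-1) ^+ i)
  end.

Definition sd_htpy n (X : topologicalType) (c : chain R n X) : chain R n.+1 X :=
  zlift (fun s : singular_simplex R n X => push s (sd_htpy_id n)) c.

Section Operators.
Context {X : topologicalType}.

Lemma sdB n : {morph @sd n X : c c' / c - c'}. Proof. exact: zliftB. Qed.
Lemma sd0 n : @sd n X 0 = 0. Proof. exact: zlift0. Qed.
Lemma sd_sum n I (r : seq I) (F : I -> chain R n X) :
  sd (\sum_(i <- r) F i) = \sum_(i <- r) sd (F i).
Proof. exact: zlift_sum. Qed.
Lemma sdMz n k : {morph @sd n X : c / c *~ k}.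
Proof. by move=> c; exact: zliftMz. Qed.
Lemma sd_fgen n (s : singular_simplex R n X) : sd (fgen s) = push s (sd_id n).
Proof. exact: zlift_fgen. Qed.

Lemma sd_htpyB n : {morph @sd_htpy n X : c c' / c - c'}. Proof. exact: zliftB. Qed.
Lemma sd_htpyD n : {morph @sd_htpy n X : c c' / c + c'}. Proof. exact: zliftD. Qed.
Lemma sd_htpy0 n : @sd_htpy n X 0 = 0. Proof. exact: zlift0. Qed.
Lemma sd_htpy_sum n I (r : seq I) (F : I -> chain R n X) :
  sd_htpy (\sum_(i <- r) F i) = \sum_(i <- r) sd_htpy (F i).
Proof. exact: zlift_sum. Qed.
Lemma sd_htpyMz n k : {morph @sd_htpy n X : c / c *~ k}.
Proof. by move=> c; exact: zliftMz. Qed.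
Lemma sd_htpy_fgen n (s : singular_simplex R n X) :
  sd_htpy (fgen s) = push s (sd_htpy_id n).
Proof. exact: zlift_fgen. Qed.

Lemma chain_in_sd n (A : set X) (c : chain R n X) : chain_in A c -> chain_in A (sd c).
Proof.
apply: chain_in_zlift => s sA; apply: (@chain_in_push R _ _ _ setT A s) => // x _.
by apply: sA; exists x.
Qed.

Lemma chain_in_sd_htpy n (A : set X) (c : chain R n X) :
  chain_in A c -> chain_in A (sd_htpy c).
Proof.
apply: chain_in_zlift => s sA; apply: (@chain_in_push R _ _ _ setT A s) => // x _.
by apply: sA; exists x.
Qed.

End Operators.

Lemma eq_push n (X Y : topologicalType) (f g : continuousType X Y)
    (c : chain R n X) : f =1 g -> push f c = push g c.
Proof. by move=> fg; have -> : f = g by apply/continuousEP. Qed.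

Lemma push_sd n (X Y : topologicalType) (f : continuousType X Y) (c : chain R n X) :
  push f (sd c) = sd (push f c).
Proof.
apply: (zlift_ind (phi := fun c => push f (sd c)) (psi := fun c => sd (push f c)))
  => [x y|x y|s]; rewrite ?pushB ?sdB ?pushB// push_fgen !sd_fgen.
exact: push_comp.
Qed.

Lemma push_sd_htpy n (X Y : topologicalType) (f : continuousType X Y)
    (c : chain R n X) :
  push f (sd_htpy c) = sd_htpy (push f c).
Proof.
apply: (zlift_ind (phi := fun c => push f (sd_htpy c))
  (psi := fun c => sd_htpy (push f c)))
  => [x y|x y|s]; rewrite ?pushB ?sd_htpyB ?pushB// push_fgen !sd_htpy_fgen.
exact: push_comp.
Qed.

Lemma sd_idS k : sd_id k.+1 =
  cone (bary_contraction k.+1) (sd (boundary (fgen (idsimplex k.+1)))).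
Proof.
rewrite /= zlift_fgen sd_sum; congr cone; apply: eq_bigr => i _.
rewrite sdMz sd_fgen; congr (_ *~ _).
exact: eq_push.
Qed.

Lemma sd_htpy_idS k : sd_htpy_id k.+1 = cone (bary_contraction k.+1)
  (fgen (idsimplex k.+1) - sd_id k.+1 - sd_htpy (boundary (fgen (idsimplex k.+1)))).
Proof.
rewrite /= zlift_fgen sd_htpy_sum; congr (cone _ (_ - _)); apply: eq_bigr => i _.
by rewrite sd_htpyMz sd_htpy_fgen; congr (_ *~ _); exact: eq_push.
Qed.

Lemma simplex_pushE n (X : topologicalType) (s : singular_simplex R n X) :
  push s (fgen (idsimplex n)) = fgen s.
Proof. by rewrite push_fgen; congr fgen; exact: eq_simplex. Qed.

(** Substitute for the cone formula in degree 0: in a difference of two vertices the faces at the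
    contraction point cancel. *)
Lemma boundary_cone_vertex (X : topologicalType) (H : contraction R X)
    (s t : singular_simplex R 0 X) :
  boundary (cone H (fgen s - fgen t)) = fgen s - fgen t.
Proof.
have e (u : singular_simplex R 0 X) : boundary (cone H (fgen u)) =
    fgen u - fgen (continuous_bundle (@cst_continuous _ X (contraction_pt H))).
  rewrite cone_fgen boundary_fgen !big_ord_recl big_ord0 addr0 cone_face0.
  rewrite expr0 expr1 mulrNz; congr (_ - fgen _); apply: eq_simplex => x.
  rewrite /= /cone_fun /= mxE; case: unliftP => [k _|//].
  rewrite (_ : sval x ord0 k = 1) ?contraction_map1//.
  by rewrite -(std_simplex_sum x) big_ord1 (ord1 k).
by rewrite coneB boundaryB !e opprB addrA subrK.
Qed.

(** Naturality reduces to the identity simplex, where [sd] is the cone over the subdivided boundary.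
    That chain is a cycle by induction, so the cone formula returns it unchanged; degree 1 uses the
    vertex version of the formula. *)
Lemma boundary_sd n (X : topologicalType) (c : chain R n.+1 X) :
  boundary (sd c) = sd (boundary c).
Proof.
elim: n X c => [|n IHn] X c.
  apply: (zlift_ind (phi := fun c => boundary (sd c)) (psi := fun c => sd (boundary c)))
    => [x y|x y|s]; rewrite ?boundaryB ?sdB ?boundaryB// -(simplex_pushE s).
  rewrite -push_sd !boundary_push -push_sd; congr push.
  rewrite sd_fgen push_id// sd_idS boundary_fgen !big_ord_recl big_ord0 addr0.
  rewrite expr0 expr1 mulrNz sdB !sd_fgen /= !push_fgen.
  exact: boundary_cone_vertex.
apply: (zlift_ind (phi := fun c => boundary (sd c)) (psi := fun c => sd (boundary c)))
  => [x y|x y|s]; rewrite ?boundaryB ?sdB ?boundaryB// -(simplex_pushE s).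
rewrite -push_sd !boundary_push -push_sd; congr push.
rewrite sd_fgen push_id// sd_idS boundary_cone IHn boundary_boundaryS sd0.
by rewrite /cone zlift0 subr0.
Qed.

Lemma sd_deg0 (X : topologicalType) (c : chain R 0 X) : sd c = c.
Proof.
apply: (zlift_ind (phi := @sd _ X) (psi := id)) => [x y|//|s]; first exact: sdB.
by rewrite sd_fgen /= simplex_pushE.
Qed.

Lemma sd_htpy_deg0 (X : topologicalType) (c : chain R 0 X) : sd_htpy c = 0.
Proof.
apply: (zlift_ind (phi := @sd_htpy _ X) (psi := fun=> 0)) => [x y|x y|s].
- exact: sd_htpyB.
- by rewrite subrr.
- by rewrite sd_htpy_fgen push0.
Qed.

Lemma boundary_sd_htpy n (X : topologicalType) (c : chain R n.+1 X) :
  boundary (sd_htpy c) = c - sd c - sd_htpy (boundary c).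
Proof.
have phiB m (Y : topologicalType) :
    {morph (fun c : chain R m.+1 Y => boundary (sd_htpy c)) : x y / x - y}.
  by move=> x y; rewrite sd_htpyB boundaryB.
have psiB m (Y : topologicalType) :
    {morph (fun c : chain R m.+1 Y => c - sd c - sd_htpy (boundary c)) : x y / x - y}.
  move=> x y; rewrite (boundaryB x y) (sdB x y) (sd_htpyB (boundary x)).
  by rewrite (subrACA x y) (subrACA (x - sd x)).
elim: n X c => [|n IHn] X c; apply: (zlift_ind _ (phiB _ X) (psiB _ X)) => s.
all: rewrite -(simplex_pushE s) -push_sd_htpy !boundary_push -push_sd.
all: rewrite -push_sd_htpy -!pushB; congr push.
all: rewrite sd_htpy_fgen push_id// sd_htpy_idS boundary_cone sd_fgen [push _ (sd_id _)]push_id//.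
(* The cone formula leaves one term, the cone over the boundary of the coned chain; it vanishes as
   soon as that chain is a cycle. In degree 1 this holds because the homotopy is 0 on vertices,
   above it by the induction hypothesis. *)
all: rewrite [X in _ - X](_ : _ = 0) ?subr0// -[RHS](zlift0 (fun s => fgen (cone_simplex (bary_contraction _) s))).
all: congr zlift; rewrite !boundaryB -[sd_id _](push_id (h := idsimplex _))// -sd_fgen boundary_sd.
  by rewrite sd_htpy_deg0 boundary0 sd_deg0 !subrr.
by rewrite IHn boundary_boundaryS sd_htpy0 subr0 subrr.
Qed.

End BarycentricSubdivision.

(** * Shrinking of simplices under subdivision *)

Section SmallSimplices.
Context {R : realType}.

Definition lin n (w : 'I_n.+1 -> R) (x : set_type (std_simplex R n)) : R :=
  \sum_l val x ord0 l * w l.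

Definition lin_osc n (w : 'I_n.+1 -> R) (D : R) :=
  forall x y, lin w x - lin w y <= D.

Lemma lin_vertex n (w : 'I_n.+1 -> R) l : exists x, lin w x = w l.
Proof.
have h : delta_mx ord0 l \in std_simplex R n.
  apply/mem_set; split=> [j|]; first by rewrite mxE ler0n.
  by rewrite (bigD1 l)//= mxE !eqxx big1 ?addr0// => j /negPf jl; rewrite mxE jl andbF.
exists (exist (fun x => x \in std_simplex R n) _ h); rewrite /lin /= (bigD1 l)//= mxE !eqxx mul1r big1 ?addr0//.
by move=> j /negPf jl; rewrite mxE jl andbF mul0r.
Qed.

Lemma lin_cst n c (x : set_type (std_simplex R n)) : lin (fun=> c) x = c.
Proof. by rewrite /lin -mulr_suml std_simplex_sum mul1r. Qed.

Lemma lin_face n (w : 'I_n.+2 -> R) i (x : set_type (std_simplex R n)) :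
  lin w (face i x) = lin (fun l => w (lift i l)) x.
Proof.
rewrite /lin (bigD1_ord i)//= mxE unlift_none mul0r add0r.
by apply: eq_bigr => l _; rewrite mxE liftK.
Qed.

Lemma unit_clamp_id (t : R) : 0 <= t <= 1 -> unit_clamp t = t.
Proof. by move=> /andP[t0 t1]; rewrite /unit_clamp minEge t1 maxEle t0. Qed.

Lemma lin_cone n m (w : 'I_n.+1 -> R) (s : singular_simplex R m (set_type (std_simplex R n)))
    (x : set_type (std_simplex R m.+1)) :
  lin w (cone_simplex (bary_contraction n) s x) =
  (1 - val x ord0 ord0) * lin w (s (simplex_tail x)) +
  val x ord0 ord0 * lin w (barycenter n).
Proof.
rewrite /lin !mulr_sumr -big_split; apply: eq_bigr => l _.
rewrite /= unit_clamp_id ?std_simplex_ge0 ?std_simplex_le1// !mxE.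
by rewrite mulrDl !mulrA.
Qed.

(** At a vertex [l] the difference is the average of the [n.+1] numbers [w l - w k]. The one with
    [k = l] is 0 and the others are at most [D], hence the factor [n / n.+1]; a general point is a
    convex combination of vertices. *)
Lemma lin_osc_barycenter n (w : 'I_n.+1 -> R) D x : lin_osc w D ->
  `|lin w x - lin w (barycenter n)| <= n%:R / n.+1%:R * D.
Proof.
move=> wD; have D0 : 0 <= D by rewrite -(subrr (lin w x)).
have bE : lin w (barycenter n) = n.+1%:R^-1 * \sum_l w l.
  by rewrite /lin mulr_sumr; apply: eq_bigr => l _; rewrite mxE.
have wE l k : w l - w k <= D.
  by have [y <-] := lin_vertex w l; have [z <-] := lin_vertex w k.
have key l : `|w l - lin w (barycenter n)| <= n%:R / n.+1%:R * D.
  have -> : w l - lin w (barycenter n) = n.+1%:R^-1 * \sum_k (w l - w k).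
    rewrite bE sumrB sumr_const card_ord mulrBr -[w l *+ _]mulr_natl mulrA.
    by rewrite mulVf ?mul1r// pnatr_eq0.
  rewrite normrM ger0_norm ?invr_ge0// [n%:R / _]mulrC -mulrA ler_wpM2l ?invr_ge0//.
  rewrite (bigD1 l)//= subrr add0r (le_trans (ler_norm_sum _ _ _))//.
  apply: (@le_trans _ _ (\sum_(k < n.+1 | k != l) D)).
    by apply: ler_sum => k _; rewrite ler_norml wE lerNl opprB wE.
  rewrite sumr_const cardC1 card_ord -[X in X <= _]mulr_natl//.
have -> : lin w x - lin w (barycenter n) = lin (fun l => w l - lin w (barycenter n)) x.
  rewrite -[X in _ - X = _](lin_cst _ x) /lin -sumrB; apply: eq_bigr => l _.
  by rewrite mulrBr.
apply: le_trans (_ : lin (fun=> n%:R / n.+1%:R * D) x <= _); last by rewrite lin_cst.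
apply: le_trans (ler_norm_sum _ _ _) _; apply: ler_sum => l _.
by rewrite normrM ger0_norm ?std_simplex_ge0// ler_wpM2l// std_simplex_ge0.
Qed.

Lemma std_simplex_apex n (x : set_type (std_simplex R n.+1)) l :
  val x ord0 ord0 = 1 -> val x ord0 (lift ord0 l) = 0.
Proof.
move=> x1; apply/eqP; rewrite eq_le std_simplex_ge0 andbT.
have := std_simplex_sum x; rewrite big_ord_recl x1 => /(canRL (addKr _)).
rewrite addrC subrr => <-; rewrite (bigD1 l)//= lerDl sumr_ge0// => k _.
exact: std_simplex_ge0.
Qed.

(** The difference is a combination of [u - v] with [u - c] or [c - v], according to which of [a]
    and [b] is larger, with nonnegative weights of sum [1 - min(a, b)]. *)
Lemma cone_osc (a b u v c L : R) : 0 <= a <= 1 -> 0 <= b <= 1 -> u - v <= L ->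
  `|u - c| <= L -> `|v - c| <= L ->
  (1 - a) * u + a * c - ((1 - b) * v + b * c) <= L.
Proof.
move=> /andP[a0 a1] /andP[b0 b1] uv uc vc.
have L0 : 0 <= L by rewrite (le_trans _ uc).
have mix p q r t : 0 <= p -> 0 <= q -> p + q <= 1 -> r <= L -> t <= L ->
    p * r + q * t <= L.
  move=> p0 q0 pq rL tL; apply: (@le_trans _ _ ((p + q) * L)).
    by rewrite mulrDl lerD// ler_wpM2l.
  by rewrite ler_piMl.
move: uc vc; rewrite !ler_norml => /andP[_ uc] /andP[vc _].
have [ab|/ltW ba] := leP a b.
  have -> : (1 - a) * u + a * c - ((1 - b) * v + b * c) =
    (1 - b) * (u - v) + (b - a) * (u - c) by ring.
  by apply: mix; rewrite ?subr_ge0//; lra.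
have -> : (1 - a) * u + a * c - ((1 - b) * v + b * c) =
  (1 - a) * (u - v) + (a - b) * (c - v) by ring.
by apply: mix; rewrite ?subr_ge0//; lra.
Qed.

(** A simplex of the subdivision is the cone from the barycenter over a simplex [r] of a subdivided
    face, so the bound follows by induction, [n / n.+1] being increasing in [n]. The second clause
    expresses that [rho] is affine; it is what allows the estimate to be iterated. *)
Lemma sd_id_lin n (w : 'I_n.+1 -> R) D rho :
  rho \in freeg.dom (sd_id n) -> lin_osc w D ->
  (forall x y, lin w (rho x) - lin w (rho y) <= n%:R / n.+1%:R * D) /\
  exists v, forall x, lin w (rho x) = lin v x.
Proof.
elim: n w D rho => [|n IHn] w D rho.
  rewrite dom_fgen inE => /eqP -> wD; split=> [x y|]; last by exists w.
  rewrite mul0r mul0r /lin !big_ord1.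
  by have := std_simplex_sum x; have := std_simplex_sum y; rewrite !big_ord1 => -> ->; rewrite subrr.
move=> /dom_zlift[s /dom_sum_Mz[i /dom_zlift[r rn /mem_dom_fgen sr]]].
move=> /mem_dom_fgen -> wD {rho}.
have [rD [v vE]] : (forall x y, lin (fun l => w (lift i l)) (r x) -
    lin (fun l => w (lift i l)) (r y) <= n%:R / n.+1%:R * D) /\
    exists v, forall x, lin (fun l => w (lift i l)) (r x) = lin v x.
  by apply: IHn => // x y; rewrite -!lin_face.
have sE x : lin w (s x) = lin (fun l => w (lift i l)) (r x) by rewrite sr -lin_face.
have D0 : 0 <= D by rewrite -(subrr (lin w (barycenter n.+1))).
set L := n.+1%:R / n.+2%:R * D.
have sD x y : lin w (s x) - lin w (s y) <= L.
  rewrite !sE (le_trans (rD x y))// /L ler_wpM2r//.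
  rewrite ler_pdivrMr ?ltr0n// mulrAC ler_pdivlMr ?ltr0n// -!natrM ler_nat; lia.
have bD x : `|lin w (s x) - lin w (barycenter n.+1)| <= L by exact: lin_osc_barycenter.
split=> [x y|]; last first.
  exists (fun l => if unlift ord0 l is Some k then v k else lin w (barycenter n.+1)) => x.
  rewrite lin_cone sE vE /lin [RHS]big_ord_recl unlift_none [RHS]addrC; congr (_ + _).
  rewrite mulr_sumr; apply: eq_bigr => l _; rewrite liftK mulrA; congr (_ * _).
  have [x1|x1] := eqVneq (val x ord0 ord0) 1; last first.
    by rewrite simplex_tailE// mxE mulrC divfK// subr_eq0 eq_sym.
  by rewrite x1 subrr mul0r std_simplex_apex.
rewrite !lin_cone; apply: cone_osc; rewrite ?std_simplex_ge0 ?std_simplex_le1//.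
Qed.

Lemma iter_sd_fgen n (X : topologicalType) N (s : singular_simplex R n X) :
  iter N (@sd R n X) (fgen s) = push s (iter N (@sd R n _) (fgen (idsimplex n))).
Proof. by elim: N => [|N IHN]; rewrite ?simplex_pushE//= IHN push_sd. Qed.

Lemma iter_sd_lin n N (w : 'I_n.+1 -> R) D rho :
  rho \in freeg.dom (iter N (@sd R n _) (fgen (idsimplex n))) -> lin_osc w D ->
  (forall x y, lin w (rho x) - lin w (rho y) <= (n%:R / n.+1%:R) ^+ N * D) /\
  exists v, forall x, lin w (rho x) = lin v x.
Proof.
elim: N w D rho => [|N IHN] w D rho /=.
  rewrite dom_fgen inE => /eqP -> wD; split; last by exists w.
  by move=> x y; rewrite expr0 mul1r; exact: wD.
move=> /dom_zlift[s sN /dom_zlift[r rn /mem_dom_fgen ->]] wD.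
have [sD [v vE]] := IHN w D s sN wD.
have vD : lin_osc v ((n%:R / n.+1%:R) ^+ N * D) by move=> x y; rewrite -!vE.
have [rD [u uE]] := sd_id_lin rn vD.
split=> [x y|]; last by exists u => x; rewrite -uE -vE.
by rewrite exprS -mulrA !vE; exact: rD.
Qed.

Lemma lebesgue_number_simplex n (X : topologicalType) I (U : I -> set X)
    (s : singular_simplex R n X) :
  (forall i, open (U i)) -> range s `<=` \bigcup_i U i ->
  exists2 e : R, 0 < e & forall x : set_type (std_simplex R n), exists i,
    forall y : set_type (std_simplex R n), (forall l, `|val x ord0 l - val y ord0 l| < e) -> U i (s y).
Proof.
move=> Uop sU.
have Kc := (compact_near_coveringP _).1 (compact_set_typeT (@std_simplex_compact R n)).
pose P (e : R) (x : set_type (std_simplex R n)) := exists i, forall y : set_type (std_simplex R n),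
  (forall l, `|val x ord0 l - val y ord0 l| < e) -> U i (s y).
have : \forall e \near 0^'+, [set: set_type (std_simplex R n)] `<=` P e.
  apply: (Kc R (0^'+) P _) => x _; have [i _ Ui] := sU (s x) (ex_intro2 _ _ x Logic.I erefl).
  have /nbhs_set_typeP[V Vx VU] : nbhs x (s @^-1` (U i)).
    by apply: (@cts_fun _ _ s); apply: open_nbhs_nbhs.
  have /nbhs_ballP[e /= e0 eV] := Vx.
  have e20 : 0 < e / 2 by rewrite divr_gt0.
  exists (val @^-1` ball (val x) (e / 2), [set d | d < e / 2]).
    split=> /=; last exact: nbhs_right_lt.
    by apply: (@val_continuous _ _ x); exact: nbhsx_ballx.
  move=> [x' d] [/= [_ xx'] de]; exists i => y yd; apply: VU; apply: eV.
  split=> // k l; rewrite (ord1 k) /ball/= [e]splitr.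
  apply: le_lt_trans (ler_distD (val x' ord0 l) _ _) _.
  by apply: ltrD; [exact: xx'|exact: lt_trans (yd l) de].
case=> e /= e0 eP; exists (e / 2); first by rewrite divr_gt0.
by move=> x; apply: eP; rewrite ?divr_gt0//= sub0r normrN gtr0_norm ?divr_gt0// gtr_pMr// invf_lt1// ltr1n.
Qed.

(* Lebesgue number argument: each subdivision shrinks the diameter of affine
   simplices by the factor n / (n + 1). *)
Lemma iter_sd_small n (X : topologicalType) I (U : I -> set X) (c : chain R n X) :
  (forall i, open (U i)) -> chain_in (\bigcup_i U i) c ->
  exists N, forall s : singular_simplex R n X,
    s \in freeg.dom (iter N (@sd R n X) c) -> exists i, range s `<=` U i.
Proof.
move=> Uop.
(* Smallness survives further subdivision, so the two terms of a difference can be brought to a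
   common number of subdivisions. *)
have mono N (d : chain R n X) : (forall s : singular_simplex R n X,
    s \in freeg.dom d -> exists i, range s `<=` U i) ->
    forall s : singular_simplex R n X,
    s \in freeg.dom (iter N (@sd R n X) d) -> exists i, range s `<=` U i.
  move=> dU; elim: N => [|N IHN]//= s /dom_zlift[t /IHN[i ti]].
  move=> /dom_zlift[r _ /mem_dom_fgen ->]; exists i => _ [x _ <-]; apply: ti.
  by exists (r x).
apply: (chain_in_ind (P := fun c => exists N, forall s : singular_simplex R n X,
    s \in freeg.dom (iter N (@sd R n X) c) -> exists i, range s `<=` U i)).
- by exists 0%N => s; rewrite /= dom0.
- move=> x y [N1 h1] [N2 h2]; exists (N1 + N2)%N => s.
  have -> : iter (N1 + N2) (@sd R n X) (x - y) =
      iter N2 (@sd R n X) (iter N1 (@sd R n X) x) - iter N1 (@sd R n X) (iter N2 (@sd R n X) y).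
    rewrite -!iterD [(N2 + N1)%N]addnC; elim: (N1 + N2)%N => // N IHN.
    by rewrite !iterS IHN sdB.
  by move=> /domB; rewrite mem_cat => /orP[]; apply: mono.
move=> s sU; have [e e0 es] := lebesgue_number_simplex Uop sU.
have : (fun N => (n%:R / n.+1%:R : R) ^+ N) @ \oo --> (0 : R).
  by apply: cvg_expr; rewrite ger0_norm ?divr_ge0// ltr_pdivrMr// mul1r ltr_nat.
move=> /cvgrPdist_lt/(_ e e0)[N _ /(_ N (leqnn N))/=]; rewrite sub0r normrN.
rewrite ger0_norm ?exprn_ge0 ?divr_ge0// => Ne.
exists N => t; rewrite iter_sd_fgen => /dom_zlift[r rN /mem_dom_fgen ->].
have [i si] := es (r (barycenter n)).
exists i => _ [x _ <-]; apply: si => l.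
have coordE (y : set_type (std_simplex R n)) :
    val y ord0 l = lin (fun k => (k == l)%:R) y.
  rewrite /lin (bigD1 l)//= eqxx mulr1 big1 ?addr0// => k /negPf ->.
  by rewrite mulr0.
have osc1 : lin_osc (fun k : 'I_n.+1 => (k == l)%:R) (1 : R).
  move=> y z; rewrite -!coordE lerBlDr (le_trans (std_simplex_le1 y l))//.
  by rewrite lerDl std_simplex_ge0.
have [rD _] := iter_sd_lin rN osc1.
rewrite mulr1 in rD; apply: le_lt_trans Ne.
by rewrite !coordE ler_norml rD lerNl opprB rD.
Qed.

End SmallSimplices.

Section IteratedSubdivision.
Context {R : realType} {X : topologicalType}.

Definition sdN N n (c : chain R n X) : chain R n X := iter N (@sd R n X) c.

Definition sdN_htpy N n (c : chain R n X) : chain R n.+1 X :=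
  \sum_(k < N) sd_htpy (sdN k c).

Lemma sdNS N n (c : chain R n X) : sdN N.+1 c = sd (sdN N c).
Proof. by []. Qed.

Lemma sdNB N n : {morph @sdN N n : c c' / c - c'}.
Proof. by move=> c c'; elim: N => // N IHN; rewrite !sdNS IHN; exact: sdB. Qed.

Lemma sdN0 N n : @sdN N n 0 = 0.
Proof. by have := sdNB N (0 : chain R n X) 0; rewrite !subrr. Qed.

Lemma sdND N n : {morph @sdN N n : c c' / c + c'}.
Proof.
move=> c c'; rewrite -[c' in LHS]opprK sdNB -[- c']sub0r sdNB sdN0 sub0r.
by rewrite opprK.
Qed.

Lemma chain_in_sdN N n A (c : chain R n X) : chain_in A c -> chain_in A (sdN N c).
Proof. by move=> cA; elim: N => // N; exact: chain_in_sd. Qed.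

Lemma boundary_sdN N n (c : chain R n.+1 X) : boundary (sdN N c) = sdN N (boundary c).
Proof. by elim: N => // N IHN; rewrite !sdNS boundary_sd IHN. Qed.

Lemma sdN_htpyS N n (c : chain R n X) :
  sdN_htpy N.+1 c = sdN_htpy N c + sd_htpy (sdN N c).
Proof. by rewrite /sdN_htpy big_ord_recr. Qed.

Lemma sdN_htpyD N n : {morph @sdN_htpy N n : c c' / c + c'}.
Proof.
move=> c c'; rewrite /sdN_htpy -big_split; apply: eq_bigr => k _.
by rewrite sdND sd_htpyD.
Qed.

Lemma chain_in_sdN_htpy N n A (c : chain R n X) :
  chain_in A c -> chain_in A (sdN_htpy N c).
Proof.
move=> cA; apply: chain_in_sum => k _; apply: chain_in_sd_htpy.
exact: chain_in_sdN.
Qed.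

Lemma boundary_sdN_htpy N n (c : chain R n.+1 X) :
  boundary (sdN_htpy N c) = c - sdN N c - sdN_htpy N (boundary c).
Proof.
elim: N => [|N IHN]; first by rewrite /sdN_htpy !big_ord0 boundary0 subrr subr0.
rewrite !sdN_htpyS boundaryD IHN boundary_sd_htpy boundary_sdN.
by rewrite addrACA -opprD; congr (_ - _); rewrite addrA subrK.
Qed.

(** The form in which subdivision is used: up to a boundary, [c] is its subdivision plus a term
    supported wherever the boundary of [c] is, which is negligible relative to a set containing that
    boundary. *)
Lemma sdN_decomp N n (c : chain R n.+1 X) :
  c = sdN N c + sdN_htpy N (boundary c) + boundary (sdN_htpy N c).
Proof.
rewrite boundary_sdN_htpy -[c - _ - _]addrA -opprD; set d := _ + sdN_htpy _ _.
by rewrite [d + _]addrC subrK.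
Qed.

Lemma sdN_split n (U1 U2 : set X) (c : chain R n X) :
  open U1 -> open U2 -> chain_in (U1 `|` U2) c ->
  exists N a b, [/\ sdN N c = a + b, chain_in U1 a & chain_in U2 b].
Proof.
move=> oU1 oU2 cU.
have [||N cN] := @iter_sd_small R n X bool (fun b => if b then U1 else U2) c.
- by case.
- by apply: sub_chain_in cU => x [?|?]; [exists true|exists false].
exists N; apply: chain_in_split => s /cN[[] sU]; by [left|right].
Qed.

End IteratedSubdivision.

(** * Excision and Mayer-Vietoris *)

Section RelativeHomology.
Context {R : realType} {X : topologicalType}.
Implicit Types U V : set X.

(** Says that [c] is a relative cycle of the pair (X, U) with zero class: the support condition
    already forces the boundary of [c] into [U]. *)
Definition rel_bounds n U (c : chain R n X) :=
  exists b : chain R n.+1 X, chain_in U (c - boundary b).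

(* The vanishing of $H_n(X, U)$. *)
Definition rel_acyclic n U : Prop :=
  forall c : chain R n X, chain_in U (boundary c) -> rel_bounds U c.

Lemma rel_boundsP n U (c : chain R n X) :
  rel_bounds U c <-> exists (b : chain R n.+1 X) r, c = boundary b + r /\ chain_in U r.
Proof.
split=> [[b bU]|[b [r [-> rU]]]].
  by exists b, (c - boundary b); rewrite addrC subrK.
by exists b; rewrite addrC addrA addNr add0r.
Qed.

Lemma sub_rel_bounds n U V (c : chain R n X) :
  U `<=` V -> rel_bounds U c -> rel_bounds V c.
Proof. by move=> UV [b bU]; exists b; exact: sub_chain_in bU. Qed.

Lemma chain_in_rel_bounds n U (c : chain R n X) : chain_in U c -> rel_bounds U c.
Proof. by move=> cU; exists 0; rewrite boundary0 subr0. Qed.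

Lemma rel_boundsB n U (c c' : chain R n X) :
  rel_bounds U c -> rel_bounds U c' -> rel_bounds U (c - c').
Proof.
move=> [b bU] [b' bU']; exists (b - b').
by rewrite boundaryB subrACA; exact: chain_inB.
Qed.

Lemma rel_boundsN n U (c : chain R n X) : rel_bounds U c -> rel_bounds U (- c).
Proof.
move=> cU; rewrite -sub0r; apply: rel_boundsB cU.
by apply: chain_in_rel_bounds; exact: chain_in0.
Qed.

Lemma rel_boundsD n U (c c' : chain R n X) :
  rel_bounds U c -> rel_bounds U c' -> rel_bounds U (c + c').
Proof.
by move=> cU cU'; rewrite -[c']opprK; apply: rel_boundsB => //; exact: rel_boundsN.
Qed.

Lemma boundary_rel_bounds n U (b : chain R n.+1 X) : rel_bounds U (boundary b).
Proof. by exists b; rewrite subrr; exact: chain_in0. Qed.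

Lemma contraction_rel_acyclic n (H : contraction R X) U :
  (forall x t, U x -> 0 <= t <= 1 -> U (H (x, t))) -> rel_acyclic n.+1 U.
Proof.
move=> HU c cU; exists (cone H c); rewrite boundary_cone opprB addrC subrK.
exact: chain_in_cone cU.
Qed.

(** Excision: a sufficiently subdivided [c] splits into a part in [U], which is discarded, and a
    part in [V]. *)
Lemma rel_excise n U V (c : chain R n.+1 X) :
  open U -> open V -> U `|` V = setT -> chain_in U (boundary c) ->
  exists c' : chain R n.+1 X, chain_in V c' /\ rel_bounds U (c - c').
Proof.
move=> oU oV UV cU.
have [|N [a [b [e aU bV]]]] := @sdN_split _ _ _ _ _ c oU oV; first by rewrite UV.
exists b; split=> //; rewrite {1}(sdN_decomp N c) e.
rewrite 2!(addrAC _ _ (- b)) addrK; apply: rel_boundsD.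
  apply: rel_boundsD; apply: chain_in_rel_bounds => //.
  exact: chain_in_sdN_htpy.
exact: boundary_rel_bounds.
Qed.

(** The splitting of a small subdivision is corrected by the homotopy applied to [a] and to [b]
    separately, and these corrections stay in [U] and in [V]. *)
Lemma chain_split n U V (c : chain R n.+1 X) (a b : chain R n X) :
  open U -> open V -> chain_in (U `|` V) c -> boundary c = a + b ->
  chain_in U a -> chain_in V b ->
  exists (u v : chain R n.+1 X) (d : chain R n.+2 X),
    [/\ c = u + v + boundary d, chain_in U u & chain_in V v].
Proof.
move=> oU oV cUV cab aU bV.
have [N [u [v [e uU vV]]]] := sdN_split oU oV cUV.
exists (u + sdN_htpy N a), (v + sdN_htpy N b), (sdN_htpy N c); split.
- by rewrite {1}(sdN_decomp N c) e cab sdN_htpyD addrACA.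
- by apply: chain_inD => //; exact: chain_in_sdN_htpy.
- by apply: chain_inD => //; exact: chain_in_sdN_htpy.
Qed.

(* The next four lemmas are pieces of the Mayer-Vietoris sequences of the pairs
   (X, U), (X, V), (X, U `&` V) and (X, U `|` V). *)
Lemma rel_bounds_setI n U V (c : chain R n X) :
  open U -> open V -> rel_acyclic n.+1 (U `|` V) ->
  rel_bounds U c -> rel_bounds V c -> rel_bounds (U `&` V) c.
Proof.
move=> oU oV UV /rel_boundsP[b1 [r1 [c1 r1U]]] /rel_boundsP[b2 [r2 [c2 r2V]]].
have db : boundary (b1 - b2) = r2 - r1.
  by rewrite boundaryB; apply/eqP; rewrite subr_eq addrAC -subr_eq opprK -c1 addrC -c2.
have /rel_boundsP[d [e [bE eUV]]] : rel_bounds (U `|` V) (b1 - b2).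
  apply: UV; rewrite db; apply: chain_inB.
    by apply: sub_chain_in r2V => x; right.
  by apply: sub_chain_in r1U => x; left.
have de : boundary e = - r1 + r2.
  by rewrite addrC -db bE boundaryD boundary_boundaryS add0r.
have [u [v [f [eE uU vV]]]] := chain_split oU oV eUV de (chain_inN r1U) r2V.
(* This chain also equals [b2 + v]. The first expression shows that the remainder of [c] lies in
   [U], the second that it lies in [V]. *)
exists (b1 - u - boundary d - boundary f); apply: chain_inI.
  rewrite !boundaryB !boundary_boundaryS !subr0 c1 opprB addrC addrA subrK.
  by apply: chain_inD => //; exact: (chain_in_boundary uU).
have -> : b1 - u - boundary d - boundary f = b2 + v.
  have b1E : b1 = b2 + v + (u + (boundary d + boundary f)).
    by rewrite -[b1](subrK b2) bE eE [LHS](AC (1*3*1) (5*3*(2*(1*4)))).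
  by rewrite -!addrA -!opprD b1E addrK.
rewrite boundaryD c2 opprD addrA [boundary b2 + _]addrC addrK.
by apply: chain_inB => //; exact: (chain_in_boundary vV).
Qed.

Lemma rel_acyclic_setI n U V :
  open U -> open V -> rel_acyclic n U -> rel_acyclic n V ->
  rel_acyclic n.+1 (U `|` V) -> rel_acyclic n (U `&` V).
Proof.
move=> oU oV aU aV aUV c cUV; apply: rel_bounds_setI => //.
  by apply: aU; apply: sub_chain_in cUV => x [].
by apply: aV; apply: sub_chain_in cUV => x [].
Qed.

Lemma rel_acyclic_setU n U V :
  open U -> open V -> rel_acyclic n.+2 U -> rel_acyclic n.+2 V ->
  rel_acyclic n.+1 (U `&` V) -> rel_acyclic n.+2 (U `|` V).
Proof.
move=> oU oV aU aV aUV c cUV.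
have [N [u [v [e uU vV]]]] := sdN_split oU oV cUV.
rewrite (sdN_decomp N c); apply: rel_boundsD; last exact: boundary_rel_bounds.
apply: rel_boundsD; last by apply: chain_in_rel_bounds; exact: chain_in_sdN_htpy.
have dv : boundary v = - boundary u.
  apply/eqP; rewrite -addr_eq0 addrC -boundaryD -e.
  by rewrite -(boundary_sdN N c) boundary_boundaryS.
have /rel_boundsP[b [r [vE rUV]]] : rel_bounds (U `&` V) v.
  apply: aUV; apply: chain_inI; last exact: (chain_in_boundary vV).
  by rewrite dv; apply: chain_inN; exact: (chain_in_boundary uU).
(* The chain [b] carries the [V] part of the boundary: [b] is a relative cycle for [V], and the
   subdivision of [c] minus [b] is one for [U]. *)
rewrite -(subrK b (sdN N c)); apply: rel_boundsD.
  apply: (sub_rel_bounds (U := U)); first by move=> x; left.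
  apply: aU; rewrite boundaryB boundary_sdN e vE [boundary b + r]addrC addrA addrK.
  by apply: chain_inD => //; apply: sub_chain_in rUV => x [].
apply: (sub_rel_bounds (U := V)); first by move=> x; right.
apply: aV; rewrite (_ : boundary b = v - r); last by rewrite vE addrK.
by apply: chain_inB => //; apply: sub_chain_in rUV => x [].
Qed.

Lemma rel_cycle_glue n U V (c1 c2 : chain R n.+1 X) :
  open U -> open V -> chain_in U (boundary c1) -> chain_in V (boundary c2) ->
  rel_bounds (U `|` V) (c1 - c2) ->
  exists c : chain R n.+1 X, [/\ chain_in (U `&` V) (boundary c),
    rel_bounds U (c - c1) & rel_bounds V (c - c2)].
Proof.
move=> oU oV c1U c2V /rel_boundsP[d [e [cE eUV]]].
have de : boundary e = boundary c1 - boundary c2.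
  by rewrite -boundaryB cE boundaryD boundary_boundaryS add0r.
have [u [v [f [eE uU vV]]]] := chain_split oU oV eUV de c1U (chain_inN c2V).
have c12 : c1 - u = c2 + v + (boundary d + boundary f).
  by rewrite -[c1](subrK c2) cE eE [X in X - _](AC (1*3*1) (5*3*(1*4)*2)) addrK.
exists (c1 - u); split.
- apply: chain_inI.
    by rewrite boundaryB; apply: chain_inB => //; exact: (chain_in_boundary uU).
  rewrite c12 !boundaryD !boundary_boundaryS !addr0.
  by apply: chain_inD => //; exact: (chain_in_boundary vV).
- by rewrite addrAC subrr add0r; apply: chain_in_rel_bounds; exact: chain_inN.
- rewrite c12 addrAC [c2 + v]addrC addrK; apply: rel_boundsD.
    exact: chain_in_rel_bounds.
  by rewrite -boundaryD; exact: boundary_rel_bounds.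
Qed.

End RelativeHomology.
Arguments rel_acyclic R {X} n U.

(** * Existence of the fundamental cycle *)

Section EuclideanLocalHomology.
Context {R : realType}.

Definition segment_map n (p : 'rV[R]_n) (z : 'rV[R]_n * R) : 'rV[R]_n :=
  (1 - z.2) *: z.1 + z.2 *: p.

Lemma segment_map_continuous n (p : 'rV[R]_n) : continuous (segment_map p).
Proof.
move=> z; apply: cvg_mx => i j.
have -> : (fun y => segment_map p y i j) =
    (fun y : 'rV[R]_n * R => (1 - y.2) * y.1 i j + y.2 * p i j).
  by apply/funext => y; rewrite !mxE.
rewrite /segment_map !mxE; apply: cvgD; apply: cvgM.
- by apply: cvgB; [exact: cvg_cst|exact: cvg_snd].
- apply: (for_continuous_comp (f := fst) (g := fun A : 'rV[R]_n => A i j)).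
    exact: cvg_fst.
  exact: coord_continuous.
- exact: cvg_snd.
- exact: cvg_cst.
Qed.

Lemma segment_map0 n (p x : 'rV[R]_n) : segment_map p (x, 0) = x.
Proof. by rewrite /segment_map subr0 scale1r scale0r addr0. Qed.

Lemma segment_map1 n (p x : 'rV[R]_n) : segment_map p (x, 1) = p.
Proof. by rewrite /segment_map subrr scale1r scale0r add0r. Qed.

Definition segment_contraction n (p : 'rV[R]_n) : contraction R 'rV[R]_n :=
  Contraction (@segment_map_continuous n p) (segment_map0 p) (segment_map1 p).

(* The complement of the span of the first k basis vectors. *)
Definition tail_neq0 n k : set 'rV[R]_n :=
  [set x | exists j : 'I_n, (k <= j)%N /\ x ord0 j != 0].

Lemma open_coord n (j : 'I_n) (A : set R) :
  open A -> open [set x : 'rV[R]_n | A (x ord0 j)].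
Proof.
by move=> oA; apply: (open_comp (f := fun x : 'rV[R]_n => x ord0 j)) => // x _;
  exact: coord_continuous.
Qed.

Lemma open_tail_neq0 n k : open (@tail_neq0 n k).
Proof.
rewrite (_ : tail_neq0 k = \bigcup_(j in [set j : 'I_n | (k <= j)%N])
    [set x : 'rV[R]_n | x ord0 j != 0]).
  by apply: bigcup_open => j _; exact/(open_coord (A := [set t | t != 0]))/open_neq.
by apply/seteqP; split=> x [j]; [case; exists j|exists j].
Qed.

(* Induction on the codimension of the span: it is the intersection of two
   half-spaces, each of which can be pushed off itself. *)
Lemma tail_neq0_acyclic n k i :
  (k <= n)%N -> (n - k < i)%N -> rel_acyclic R i (@tail_neq0 n k).
Proof.
move=> kn; move Ed : (n - k)%N => d.
elim: d k i kn Ed => [|d IHd] k [|i]// kn nk ki.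
  (* Here [k = n] and the set is empty, so the claim is the absolute vanishing in positive degrees
     for Euclidean space. *)
  apply: (contraction_rel_acyclic (H := segment_contraction (0 : 'rV[R]_n))).
  by move=> x t [j [kj _]]; have := ltn_ord j; lia.
have k'n : (k < n)%N by lia.
pose k' := Ordinal k'n; case: i ki => // i ki.
(* The complement of the half of the span of the first [k.+1] basis vectors where [e * x_k] is
   nonnegative. Moving straight towards [- e] times basis vector [k] preserves it. For [e = 1] and
   [e = -1] the union is [tail_neq0 k] and the intersection is [tail_neq0 k.+1]. *)
pose half (e : R) := tail_neq0 k.+1 `|` [set x : 'rV[R]_n | e * x ord0 k' < 0].
have half_open e : open (half e).
  apply: openU; first exact: open_tail_neq0.
  apply: (@open_coord n k' [set t | e * t < 0]).
  apply: (open_comp (f := fun t => e * t) (D := [set t | t < 0])); last exact: open_lt.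
  by move=> t _; exact: mulrl_continuous.
have half_acyclic e : e != 0 -> rel_acyclic R i.+2 (half e).
  move=> e0; apply: (contraction_rel_acyclic
    (H := segment_contraction (- e *: delta_mx ord0 k' : 'rV[R]_n))).
  have pk : (- e *: delta_mx ord0 k' : 'rV[R]_n) ord0 k' = - e.
    by rewrite !mxE !eqxx mulr1.
  have ee : 0 < e * e by rewrite -expr2 exprn_even_gt0.
  move=> x t; rewrite /= /segment_map /= => xh /andP[t0 t1].
  have [->|tn1] := eqVneq t 1.
    by right; rewrite /= subrr scale0r add0r scale1r pk mulrN oppr_lt0.
  have t1' : 0 < 1 - t by rewrite subr_gt0 lt_neqAle tn1.
  case: xh => [[j [kj xj]]|xk]; [left|right].
    exists j; split=> //; rewrite !mxE (_ : (j == k') = false) ?andbF.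
      by rewrite !mulr0 addr0 mulf_neq0// gt_eqF.
    by apply/negbTE/eqP => /(congr1 val)/= jk; move: kj; rewrite jk ltnn.
  rewrite /= !mxE !eqxx mulr1.
  have -> : e * ((1 - t) * x ord0 k' + t * - e) =
    (1 - t) * (e * x ord0 k') - t * (e * e) by ring.
  rewrite subr_lt0; apply: (@lt_le_trans _ _ 0); first by rewrite pmulr_rlt0.
  by rewrite mulr_ge0// ltW.
have -> : tail_neq0 k = half 1 `|` half (-1).
  apply/seteqP; split=> x.
    move=> [j [kj xj]]; have [jk|jk] := eqVneq (j : nat) k.
      have jk' : j = k' by exact: val_inj.
      rewrite jk' in xj; have [xk|xk|xk] := ltgtP (x ord0 k') 0.
      - by left; right; rewrite /= mul1r.
      - by right; right; rewrite /= mulN1r oppr_lt0.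
      - by rewrite xk eqxx in xj.
    by left; left; exists j; split=> //; rewrite ltn_neqAle eq_sym jk.
  have K e : half e x -> tail_neq0 k x.
    case=> [[j [kj xj]]|/= xk]; first by exists j; split=> //; exact: ltnW.
    exists k'; split=> //; apply/eqP => xk0.
    by rewrite xk0 mulr0 ltxx in xk.
  by case=> /K.
apply: rel_acyclic_setU => //.
- by apply: half_acyclic; rewrite oner_eq0.
- by apply: half_acyclic; rewrite oppr_eq0 oner_eq0.
have -> : half 1 `&` half (-1) = tail_neq0 k.+1.
  apply/seteqP; split=> [x [[//|/= x1] [//|/= x2]]|x xk]; last by split; left.
  by move: x1 x2; rewrite mul1r mulN1r oppr_lt0 => /lt_trans/[apply]; rewrite ltxx.
by apply: IHd; lia.
Qed.

Lemma euclidean_point_acyclic n i :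
  (n < i)%N -> rel_acyclic R i (~` [set 0 : 'rV[R]_n]).
Proof.
move=> ni; have -> : ~` [set 0 : 'rV[R]_n] = tail_neq0 0.
  apply/seteqP; split=> [x x0|x [j [_ xj]] x0]; last by rewrite x0 mxE eqxx in xj.
  apply: contrapT => nx; apply: x0; apply/rowP => j; rewrite mxE.
  by apply: contrapT => /eqP xj; apply: nx; exists j.
by apply: tail_neq0_acyclic; rewrite ?subn0.
Qed.

End EuclideanLocalHomology.

Section OpenEmbedding.
Context {R : realType} {X Y : topologicalType}.

Definition open_embedding (e : continuousType Y X) (f : X -> Y) :=
  [/\ open (range e), forall y, f (e y) = y & {within range e, continuous f}].

Variables (e : continuousType Y X) (f : X -> Y).
Hypothesis ef : open_embedding e f.

Lemma embedding_lift n (c : chain R n X) :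
  chain_in (range e) c -> exists c' : chain R n Y, push e c' = c.
Proof.
have [oe fe fc] := ef.
apply: (chain_in_ind (P := fun c => exists c' : chain R n Y, push e c' = c)).
- by exists 0; rewrite push0.
- by move=> _ _ [x <-] [y <-]; exists (x - y); rewrite pushB.
move=> s sW; have sW' x : range e (s x) by apply: sW; exists x.
have fsc : continuous (f \o s).
  by apply: within_continuous_comp_in sW' fc; exact: cts_fun.
exists (fgen (continuous_bundle fsc : singular_simplex R n Y)).
rewrite push_fgen; congr fgen; apply: eq_simplex => x /=.
by have [y _ <-] := sW' x; rewrite fe.
Qed.

(** Composition with [e] is injective on simplices, so no terms cancel and each simplex of [c]
    survives in the push-forward with its coefficient. *)
Lemma chain_in_preimage n (A : set X) (c : chain R n Y) :
  chain_in A (push e c) -> chain_in (e @^-1` A) c.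
Proof.
have [oe fe fc] := ef => cA s sc y [x _ <-].
apply: (cA (simplex_push e s)); last by exists x.
rewrite mem_dom (_ : freeg.coeff _ _ = freeg.coeff s c) -?mem_dom//.
apply: (zlift_ind (phi := fun c => freeg.coeff (simplex_push e s) (push e c))
  (psi := freeg.coeff s)) => [u v|u v|t].
- by rewrite pushB coeffB.
- exact: coeffB.
rewrite push_fgen !coeffU !mul1r.
suff -> : (simplex_push e t == simplex_push e s) = (t == s) by [].
apply/idP/idP => [/eqP h|/eqP ->//]; apply/eqP.
apply: eq_simplex => z.
have /(congr1 (fun g : singular_simplex R n X => f (g z))) := h.
by rewrite /= !fe.
Qed.

(** Excision moves a relative cycle into the range of [e], where it lifts and bounds; pushing the
    bounding chain forward finishes. *)
Lemma embedding_acyclic n (A : set X) :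
  open A -> A `|` range e = setT -> rel_acyclic R n.+1 (e @^-1` A) ->
  rel_acyclic R n.+1 A.
Proof.
have [oe fe fc] := ef => oA Ae aA c cA.
have [c' [/embedding_lift[d dE] [b bA]]] := rel_excise oA oe Ae cA.
have : rel_bounds (e @^-1` A) d.
  apply: aA; apply: chain_in_preimage; rewrite -boundary_push dE.
  have -> : c' = c - (c - c' - boundary b) - boundary b.
    by rewrite -addrA -opprD subrK opprB addrC subrK.
  rewrite !boundaryB boundary_boundaryS subr0; apply: chain_inB => //.
  rewrite subr0; have := chain_in_boundary bA.
  by rewrite !boundaryB boundary_boundaryS subr0.
move=> [a aU]; exists (b + push e a).
rewrite boundaryD opprD addrA -(subrK c' c) [c - c' + c' - _]addrAC -addrA.
apply: chain_inD => //; rewrite -dE boundary_push -pushB.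
by apply: chain_in_push aU.
Qed.

End OpenEmbedding.

Section Charts.
Context {R : realType}.

(** A homeomorphism of the line onto the interval (-r, r), with inverse [unsquash r]; coordinatewise
    it identifies Euclidean space with an open cube in a chart. *)
Definition squash (r t : R) : R := r * t / (1 + `|t|).
Definition unsquash (r s : R) : R := s / (r - `|s|).

Lemma squash_lt r t : 0 < r -> `|squash r t| < r.
Proof.
move=> r0; have t1 : 0 < 1 + `|t| by rewrite ltr_pwDl.
rewrite /squash !normrM (gtr0_norm r0) normfV (gtr0_norm t1) ltr_pdivrMr//.
by rewrite ltr_pM2l// ltrDr.
Qed.

Lemma squashK r : 0 < r -> cancel (squash r) (unsquash r).
Proof.
move=> r0 t; have t1 : 0 < 1 + `|t| by rewrite ltr_pwDl.
rewrite /unsquash /squash !normrM (gtr0_norm r0) normfV (gtr0_norm t1).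
have -> : r - r * `|t| / (1 + `|t|) = r / (1 + `|t|).
  by field; rewrite gt_eqF.
by field; rewrite !gt_eqF.
Qed.

Lemma unsquashK r s : `|s| < r -> squash r (unsquash r s) = s.
Proof.
move=> sr; have r0 : 0 < r by rewrite (le_lt_trans _ sr).
have rs : 0 < r - `|s| by rewrite subr_gt0.
rewrite /unsquash /squash normrM normfV (gtr0_norm rs).
have -> : 1 + `|s| / (r - `|s|) = r / (r - `|s|).
  by field; rewrite gt_eqF.
by field; rewrite !gt_eqF.
Qed.

Lemma squash_continuous r : continuous (squash r).
Proof.
move=> t; apply: cvgM.
  by apply: cvgM; [exact: cvg_cst|exact: cvg_id].
apply: cvgV; first by rewrite gt_eqF// ltr_pwDl.
by apply: cvgD; [exact: cvg_cst|exact: norm_continuous].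
Qed.

Lemma unsquash_continuous r s : `|s| < r -> {for s, continuous (unsquash r)}.
Proof.
move=> sr; apply: cvgM; first exact: cvg_id.
apply: cvgV; first by rewrite gt_eqF// subr_gt0.
by apply: cvgB; [exact: cvg_cst|exact: norm_continuous].
Qed.

Lemma within_open_continuous (X Y : topologicalType) (U : set X) (f : X -> Y) x :
  open U -> U x -> {within U, continuous f} -> {for x, continuous f}.
Proof.
move=> oU Ux /subspace_continuousP fc N /(fc x Ux) fN.
have fN' : \forall y \near x, U y -> N (f y) by exact: fN.
have Un : \forall y \near x, U y by exact: open_nbhs_nbhs.
by apply: filterS2 fN' Un => y; exact.
Qed.

(** A small open cube of a chart, stretched to all of Euclidean space by [squash]. Having the full
    space as source makes contractions and arbitrary boxes available in every neighbourhood. *)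
Lemma manifold_embedding n (M : topologicalType) (x : M) (O : set M) :
  closed_manifold R n M -> open O -> O x ->
  exists (e : continuousType 'rV[R]_n M) (f : M -> 'rV[R]_n),
    [/\ open_embedding e f, e 0 = x & range e `<=` O].
Proof.
move=> [_ _ _ /(_ x)[U [V [phi [psi [[oU Ux oV] [UV VU phic psic [phiK psiK]]]]]]]] oO Ox.
have Vphi : \forall v \near phi x, V v by exact: open_nbhs_nbhs (conj oV (UV _ Ux)).
have Opsi : \forall v \near phi x, O (psi v).
  have psi_x : {for phi x, continuous psi}.
    exact: within_open_continuous oV (UV _ Ux) psic.
  by apply: psi_x; rewrite phiK//; exact: open_nbhs_nbhs.
have : nbhs (phi x) [set v | V v /\ O (psi v)] by exact: filterI.
move=> /nbhs_ballP[r /= r0 rVO].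
have rV v : ball (phi x) r v -> V v by move=> /rVO[].
pose h (v : 'rV[R]_n) : 'rV[R]_n := \row_j (phi x ord0 j + squash r (v ord0 j)).
have hV v : V (h v).
  apply: rV; split=> // i j; rewrite (ord1 i) /ball/= mxE opprD addrA subrr sub0r.
  by rewrite normrN squash_lt.
have hc : continuous h.
  move=> v; apply: cvg_mx => i j.
  have -> : (fun w => h w i j) = (fun w : 'rV[R]_n => phi x ord0 j + squash r (w ord0 j)).
    by apply/funext => w; rewrite mxE.
  have sc : {for v, continuous (fun w : 'rV[R]_n => squash r (w ord0 j))}.
    apply: (for_continuous_comp (f := fun w : 'rV[R]_n => w ord0 j)).
      exact: coord_continuous.
    exact: squash_continuous.
  by rewrite /h mxE; apply: (cvgD _ sc); exact: cvg_cst.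
have ec : continuous (psi \o h) by exact: within_continuous_comp_in psic.
pose f y : 'rV[R]_n := \row_j unsquash r (phi y ord0 j - phi x ord0 j).
have fe v : f (psi (h v)) = v.
  apply/rowP => j; rewrite mxE psiK// mxE addrC addrA addNr add0r.
  exact: squashK.
have eE : range (psi \o h) =
    U `&` [set y | forall j, `|phi y ord0 j - phi x ord0 j| < r].
  apply/seteqP; split=> [_ [v _ <-]|y [Uy yr]].
    split=> [|j]; first exact: VU.
    by rewrite /= psiK// mxE addrC addrA addNr add0r squash_lt.
  exists (f y) => //=; rewrite (_ : h (f y) = phi y) ?phiK//.
  by apply/rowP => j; rewrite !mxE unsquashK// addrC subrK.
have phic' y : U y -> {for y, continuous phi}.
  by move=> Uy; exact: within_open_continuous phic.
have coordc y j : U y -> {for y, continuous (fun y => phi y ord0 j - phi x ord0 j)}.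
  move=> Uy; apply: cvgB; last exact: cvg_cst.
  apply: (for_continuous_comp (f := phi) (g := fun w : 'rV[R]_n => w ord0 j)).
    exact: phic'.
  exact: coord_continuous.
exists (continuous_bundle ec), f; split; last first.
- move=> _ [v _ <-]; apply: (rVO (h v) _).2; split=> // i j.
  rewrite (ord1 i) /ball/= mxE opprD addrA subrr sub0r.
  by rewrite normrN squash_lt.
- rewrite /= -[RHS](phiK x Ux); congr psi; apply/rowP => j.
  by rewrite !mxE /squash mulr0 mul0r addr0.
split=> //=; rewrite -/(psi \o h) ?eE.
  rewrite openE => y [Uy yr].
  apply: filterI; first exact: open_nbhs_nbhs.
  apply: filter_forall => j.
  have := coordc y j Uy [set t | `|t| < r]; apply.
  apply: (@open_nbhs_nbhs _ _ [set t | `|t| < r]); split; last exact: yr.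
  apply: (open_comp (f := fun t : R => `|t|) (D := [set t | t < r])); last exact: open_lt.
  by move=> t _; exact: norm_continuous.
apply/subspace_continuousP => y [Uy yr].
apply: (cvg_trans (cvg_app f (cvg_within (F := nbhs y) _))).
apply: cvg_mx => i j.
have -> : (fun y => f y i j) = (fun y => unsquash r (phi y ord0 j - phi x ord0 j)).
  by apply/funext => z; rewrite mxE.
rewrite /f mxE.
apply: (for_continuous_comp (f := fun y => phi y ord0 j - phi x ord0 j)).
  exact: coordc.
exact: unsquash_continuous.
Qed.

End Charts.

(** * From vanishing at points to vanishing along compact sets *)

Section Cousin.
Context {R : realType}.

(** Cousin's lemma by real induction: the supremum of the endpoints reachable from [a] can be passed
    by the local hypothesis, unless it is [b]. *)
Lemma cousin_interval (P : R -> R -> Prop) (a b : R) : a <= b ->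
  (forall t, a <= t <= b -> exists2 e, 0 < e & forall s u,
    a <= s -> u <= b -> s <= t <= u -> t - e <= s -> u <= t + e -> P s u) ->
  (forall s t u, a <= s -> s <= t -> t <= u -> u <= b -> P s t -> P t u -> P s u) ->
  P a b.
Proof.
move=> ab loc cat; pose S := [set t | a <= t <= b /\ P a t].
have Sa : S a.
  split; first by rewrite lexx.
  have [|e e0] := loc a; first by rewrite lexx.
  by apply; rewrite ?lexx// ?gerBl ?lerDl ltW.
have Sub : has_ubound S by exists b => t [/andP[]].
have supS : a <= sup S <= b.
  apply/andP; split; first exact: ub_le_sup.
  by apply: ge_sup; [exists a|move=> t [/andP[]]].
have [e e0 eP] := loc (sup S) supS.
have [t St te] : exists2 t, S t & sup S - e < t.
  by apply: sup_adherent => //; split=> //; exists a.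
have [/andP[at_ tb] Pat] := St.
have tS : t <= sup S by exact: ub_le_sup.
pose u := Num.min b (sup S + e).
have [supSa supSb] := andP supS.
have Su : sup S <= u by rewrite le_min supSb lerDl ltW.
have ub : u <= b by rewrite ge_min lexx.
have Pau : P a u.
  apply: (cat a t u) => //; first exact: le_trans Su.
  apply: eP => //; rewrite ?tS ?Su//; first exact: ltW.
  by rewrite /u ge_min lexx orbT.
have : u <= sup S.
  by apply: ub_le_sup => //; split=> //; rewrite (le_trans at_ (le_trans tS Su)).
rewrite {1}/u ge_min gerDl (lt_geF e0) orbF => bS.
by have -> : b = u by apply/eqP; rewrite eq_le ub andbT (le_trans bS Su).
Qed.

End Cousin.

Section Boxes.
Context {R : realType} {n : nat}.
Implicit Types (a b x y : 'rV[R]_n).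

Definition box a b : set 'rV[R]_n :=
  [set x | forall j, a ord0 j <= x ord0 j <= b ord0 j].

Lemma box_compact a b : compact (box a b).
Proof.
have := @rV_compact R n (fun j => `[a ord0 j, b ord0 j]%classic)
  (fun j => @segment_compact _ _ _).
congr compact; apply/seteqP; split=> x xab j; have := xab j;
  by rewrite /= in_itv.
Qed.

Lemma box_setI a b a' b' :
  box a b `&` box a' b' = box (\row_j Num.max (a ord0 j) (a' ord0 j))
    (\row_j Num.min (b ord0 j) (b' ord0 j)).
Proof.
apply/seteqP; split=> [x [xab xab'] j|x xI].
  by rewrite !mxE ge_max le_min; have /andP[-> ->] := xab j; have /andP[-> ->] := xab' j.
by split=> j; have := xI j; rewrite !mxE ge_max le_min => /andP[/andP[? ?] /andP[? ?]];
  exact/andP.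
Qed.

Lemma open_cube x (d : R) : open [set y : 'rV[R]_n | forall j, `|y ord0 j - x ord0 j| < d].
Proof.
rewrite openE => y yx.
apply: (@filter_forall _ _ (fun j (z : 'rV[R]_n) => `|z ord0 j - x ord0 j| < d) (nbhs y)) => j.
have o : open [set z : 'rV[R]_n | `|z ord0 j - x ord0 j| < d].
  apply: (open_coord (A := [set t | `|t - x ord0 j| < d])).
  apply: (open_comp (f := fun t : R => `|t - x ord0 j|) (D := [set t | t < d])).
    move=> t _; apply: (for_continuous_comp (f := fun t => t - x ord0 j)).
      by apply: cvgB; [exact: cvg_id|exact: cvg_cst].
    exact: norm_continuous.
  exact: open_lt.
by apply: (open_nbhs_nbhs (conj o _)); exact: yx.
Qed.

Lemma compact_uniform_nbhs (K Q : set 'rV[R]_n) :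
  compact K -> (forall x, K x -> \forall y \near x, Q y) ->
  exists2 e : R, 0 < e & forall x y, K x ->
    (forall j, `|x ord0 j - y ord0 j| <= e) -> Q y.
Proof.
move=> /compact_near_coveringP Kc KQ.
pose P (e : R) x := forall y, (forall j, `|x ord0 j - y ord0 j| <= e) -> Q y.
have : \forall e \near 0^'+, K `<=` P e.
  apply: (Kc R (0^'+) P _) => x Kx.
  have /nbhs_ballP[d /= d0 dQ] := KQ x Kx.
  have d20 : 0 < d / 2 by rewrite divr_gt0.
  exists (ball x (d / 2), [set e | e < d / 2]).
    by split=> /=; [exact: nbhsx_ballx|exact: nbhs_right_lt].
  move=> [x' e] [/= [_ xx'] ed] y ye; apply: dQ; split=> // k l.
  rewrite (ord1 k) /ball/= [d]splitr.
  apply: le_lt_trans (ler_distD (x' ord0 l) _ _) _.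
  by apply: ltrD; [exact: xx'|exact: le_lt_trans (ye l) ed].
case=> e /= e0 eP; exists (e / 2); first by rewrite divr_gt0.
move=> x y Kx; apply: eP Kx y; last by rewrite divr_gt0.
by rewrite /= sub0r normrN gtr0_norm ?divr_gt0// gtr_pMr// invf_lt1// ltr1n.
Qed.

End Boxes.

Section LocalToGlobal.
Context {R : realType} {n : nat} {X : topologicalType}.
Variables (e : continuousType 'rV[R]_n X) (f : X -> 'rV[R]_n).
Hypothesis X_hausdorff : hausdorff_space X.
Hypothesis ef : open_embedding e f.
Hypothesis point_acyclic : forall x i, (n < i)%N -> rel_acyclic R i (~` [set x : X]).

Local Notation away K := (~` (e @` K)).

Lemma open_away K : compact K -> open (away K).
Proof.
move=> Kc; apply: closed_openC; apply: compact_closed => //.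
by apply: continuous_compact Kc; apply: continuous_subspaceT; exact: cts_fun.
Qed.

Lemma embedding_inj : injective e.
Proof. by have [_ fe _] := ef => x y exy; rewrite -(fe x) exy fe. Qed.

Lemma away_setI K L : away K `|` away L = away (K `&` L).
Proof.
rewrite -setCI; congr (~` _); apply/seteqP; split=> [x [[y Ky <-] [z Lz]]|x [y [Ky Ly] <-]].
  by move=> /embedding_inj zy; rewrite zy in Lz; exists y.
by split; exists y.
Qed.

Lemma away_setU K L : away K `&` away L = away (K `|` L).
Proof. by rewrite image_setU setCU. Qed.

Lemma chain_in_setCP i (A : set X) (c : chain R i X) :
  chain_in (~` A) c <-> forall x, A x -> chain_in (~` [set x]) c.
Proof.
split=> [cA x Ax|cA s sc _ [y _ <-] As].
  by apply: sub_chain_in cA => y nAy yx; apply: nAy; rewrite yx.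
by apply: (cA (s y) As s sc (s y)) => //; exists y.
Qed.

(** A simplex has compact image, hence closed in a Hausdorff space, and a chain involves only
    finitely many simplices. *)
Lemma chain_in_setC1_nbhs i x (c : chain R i X) :
  chain_in (~` [set x]) c -> \forall y \near x, chain_in (~` [set y]) c.
Proof.
apply: (chain_in_ind (P := fun c => \forall y \near x, chain_in (~` [set y]) c)).
- by apply: nearW => y; exact: chain_in0.
- by move=> u v; apply: filterS2 => y; exact: chain_inB.
move=> s sx; have sc : closed (range s).
  apply: compact_closed => //; apply: continuous_compact.
    by apply: continuous_subspaceT; exact: cts_fun.
  exact/compact_set_typeT/std_simplex_compact.
have : \forall y \near x, (~` range s) y.
  apply: open_nbhs_nbhs; split; first exact: closed_openC.
  by move=> /sx; exact.
apply: filterS => y ys; apply: chain_in_fgen => _ [z _ <-] sy.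
by apply: ys; exists z.
Qed.

(** One bounding chain [b] works for all the sets [L]: the remainder avoids the compact image of
    [K], hence a uniform neighbourhood of it. *)
Lemma rel_bounds_thicken i K (c : chain R i X) :
  compact K -> rel_bounds (away K) c ->
  exists2 d : R, 0 < d & forall L : set 'rV[R]_n, (forall y, L y -> exists2 x, K x &
    forall j, `|x ord0 j - y ord0 j| <= d) -> rel_bounds (away L) c.
Proof.
move=> Kc [b bK]; have [|d d0 dQ] := compact_uniform_nbhs
  (Q := [set y | chain_in (~` [set e y]) (c - boundary b)]) Kc.
  move=> x Kx; have : chain_in (~` [set e x]) (c - boundary b).
    by move/chain_in_setCP: bK; apply; exists x.
  by move=> /chain_in_setC1_nbhs; exact: (@cts_fun _ _ e).
exists d => // L LK; exists b; apply/chain_in_setCP => _ [y Ly <-].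
by have [x Kx xy] := LK y Ly; exact: dQ Kx xy.
Qed.

Definition upd (a : 'rV[R]_n) j (s : R) : 'rV[R]_n :=
  \row_k (if k == j then s else a ord0 k).

Lemma box_updP (a b : 'rV[R]_n) j s t (x : 'rV[R]_n) : box (upd a j s) (upd b j t) x <->
  s <= x ord0 j <= t /\ forall k, k != j -> a ord0 k <= x ord0 k <= b ord0 k.
Proof.
split=> [xab|[xj xab] k]; last first.
  by rewrite !mxE; case: eqVneq => [->//|]; exact: xab.
split=> [|k kj]; first by have := xab j; rewrite !mxE eqxx.
by have := xab k; rewrite !mxE (negPf kj).
Qed.

Lemma upd_id (a : 'rV[R]_n) j : upd a j (a ord0 j) = a.
Proof. by apply/rowP => k; rewrite mxE; case: eqVneq => [->|]. Qed.

(* Induction on the number of non-degenerate coordinates: slicing along one of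
   them, the local vanishing spreads along an interval, and two adjacent pieces
   are glued over a box of smaller dimension. *)
Lemma box_rel_bounds d i (a b : 'rV[R]_n) (c : chain R i X) : (n <= i)%N -> (d <= n)%N ->
  (forall j : 'I_n, (d <= j)%N -> a ord0 j = b ord0 j) ->
  (forall x, box a b x -> rel_bounds (~` [set e x]) c) -> rel_bounds (away (box a b)) c.
Proof.
elim: d i a b c => [|d IHd] i a b c ni dn ab cab.
  have ba : b = a by apply/rowP => j; rewrite ab.
  have box_a : box a b = [set a].
    apply/seteqP; split=> [x xab|x ->]; last by rewrite ba => j; rewrite lexx.
    by apply/rowP => j; have := xab j; rewrite ba -eq_le => /eqP.
  by rewrite box_a image_set1; apply: cab; rewrite box_a.
pose j := Ordinal dn.
have [abj|/ltW baj] := leP (a ord0 j) (b ord0 j); last first.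
  have [ba|abj] := eqVneq (b ord0 j) (a ord0 j).
    apply: IHd => //; first exact: ltnW.
    move=> k; rewrite leq_eqVlt => /orP[/eqP dk|]; last exact: ab.
    by have -> : k = j by [exact: val_inj|rewrite ba].
  have -> : box a b = set0.
    apply/seteqP; split=> // x /(_ j)/andP[ax xb]; move: abj; apply/negP/negPn.
    by rewrite eq_le baj (le_trans ax xb).
  by rewrite image_set0 setC0; apply: chain_in_rel_bounds.
rewrite -[a](upd_id a j) -[b](upd_id b j).
pose P s t := rel_bounds (away (box (upd a j s) (upd b j t))) c.
have slice_eq t (k : 'I_n) : (d <= k)%N -> upd a j t ord0 k = upd b j t ord0 k.
  move=> dk; rewrite !mxE; case: eqVneq => // kj; apply: ab.
  by rewrite ltn_neqAle dk andbT; apply: contra_neq kj => dk'; exact: val_inj.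
apply: (cousin_interval (P := P) abj) => [t /andP[at_ tb]|s t u as_ st tu ub Pst Ptu].
  have slice : rel_bounds (away (box (upd a j t) (upd b j t))) c.
    apply: IHd => //; [exact: ltnW|exact: slice_eq|].
    move=> x /box_updP[/andP[tx xt] xab]; apply: cab => k.
    have [->|/xab//] := eqVneq k j.
    by rewrite (le_trans at_ tx) (le_trans xt tb).
  have [h h0 hP] := rel_bounds_thicken (@box_compact _ _ _ _) slice.
  exists h => // s u as_ ub /andP[st tu] ts ut; apply: hP => y /box_updP[/andP[sy yu] yab].
  exists (upd y j t).
    by apply/box_updP; rewrite mxE eqxx lexx; split=> // k kj; rewrite mxE (negPf kj) yab.
  move=> k; rewrite mxE; case: eqVneq => [->|_]; last by rewrite subrr normr0 ltW.
  by rewrite ler_norml; lra.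
rewrite /P; have -> : box (upd a j s) (upd b j u) =
    box (upd a j s) (upd b j t) `|` box (upd a j t) (upd b j u).
  apply/seteqP; split=> x.
    move=> /box_updP[/andP[sx xu] xab].
    have [xt|/ltW tx] := leP (x ord0 j) t; [left|right]; apply/box_updP; split=> //.
      by rewrite sx.
    by rewrite tx.
  case=> /box_updP[/andP[sx xu] xab]; apply/box_updP; split=> //.
    by rewrite sx (le_trans xu tu).
  by rewrite (le_trans st sx).
rewrite -away_setU; apply: rel_bounds_setI => //.
- by apply: open_away; exact: box_compact.
- by apply: open_away; exact: box_compact.
rewrite away_setI.
have -> : box (upd a j s) (upd b j t) `&` box (upd a j t) (upd b j u) =
    box (upd a j t) (upd b j t).
  apply/seteqP; split=> x.
    move=> [/box_updP[/andP[sx xt] xab] /box_updP[/andP[tx xu] _]].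
    by apply/box_updP; rewrite tx xt.
  move=> /box_updP[/andP[tx xt] xab]; split; apply/box_updP; split=> //.
    by rewrite xt (le_trans st tx).
  by rewrite tx (le_trans xt tu).
move=> c' c'b; apply: IHd => //; [exact: leqW|exact: ltnW|exact: slice_eq|].
move=> x xb; apply: point_acyclic; first by rewrite ltnS.
by move/chain_in_setCP: c'b; apply; exists x.
Qed.

Lemma box_acyclic i (a b : 'rV[R]_n) : (n < i)%N -> rel_acyclic R i (away (box a b)).
Proof.
move=> ni c cab; apply: (@box_rel_bounds n) => //; first exact: ltnW.
  by move=> j; rewrite leqNgt ltn_ord.
move=> x xb; apply: point_acyclic => //.
by move/chain_in_setCP: cab; apply; exists x.
Qed.

Definition boxes (l : seq ('rV[R]_n * 'rV[R]_n)) : set 'rV[R]_n :=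
  [set x | exists2 ab, ab \in l & box ab.1 ab.2 x].

Lemma boxes_cons ab l : boxes (ab :: l) = box ab.1 ab.2 `|` boxes l.
Proof.
apply/seteqP; split=> x.
  by move=> [cd]; rewrite inE => /orP[/eqP ->|cdl] xcd; [left|right; exists cd].
by case=> [xab|[cd cdl xcd]]; [exists ab|exists cd]; rewrite // inE ?eqxx// cdl orbT.
Qed.

Lemma boxes_compact l : compact (boxes l).
Proof.
elim: l => [|ab l IHl].
  rewrite (_ : boxes [::] = set0); first exact: compact0.
  by apply/seteqP; split=> // x [].
by rewrite boxes_cons; apply: compactU => //; exact: box_compact.
Qed.

Lemma boxes_setI (a b : 'rV[R]_n) l : exists2 l', size l' = size l & box a b `&` boxes l = boxes l'.
Proof.
exists [seq (\row_j Num.max (a ord0 j) (cd.1 ord0 j),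
             \row_j Num.min (b ord0 j) (cd.2 ord0 j)) | cd : 'rV[R]_n * 'rV[R]_n <- l].
  by rewrite size_map.
apply/seteqP; split=> x.
  move=> [xab [cd cdl xcd]]; eexists; first by apply/mapP; exists cd.
  by rewrite /= -box_setI.
move=> [_ /mapP[cd cdl ->]] /=; rewrite -box_setI => -[xab xcd].
by split=> //; exists cd.
Qed.

(** The induction is on the number of boxes, because a box meets a union of [k] boxes in another
    union of [k] boxes, which controls the Mayer-Vietoris overlap. *)
Lemma boxes_acyclic l i : (n < i)%N -> rel_acyclic R i (away (boxes l)).
Proof.
move El : (size l) => k; elim: k l El i => [|k IHk] [|[a b] l]//= lk i ni.
  rewrite (_ : boxes [::] = set0); last by apply/seteqP; split=> // x [].
  by rewrite image_set0 setC0 => c _; exact: chain_in_rel_bounds.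
rewrite boxes_cons -away_setU; apply: rel_acyclic_setI.
- by apply: open_away; exact: box_compact.
- by apply: open_away; exact: boxes_compact.
- exact: box_acyclic.
- by apply: IHk => //; case: lk.
case: lk => lk; by rewrite away_setI; have [l' l'l ->] := boxes_setI a b l; apply: IHk; rewrite ?l'l// ltnW.
Qed.

(** Each point of [K] has a cube along which the class still vanishes. Finitely many of them cover
    [K] and are glued one at a time, the overlaps being acyclic one degree higher. *)
Lemma compact_rel_bounds i K (c : chain R i X) : (n <= i)%N -> compact K ->
  (forall x, K x -> rel_bounds (~` [set e x]) c) -> rel_bounds (away K) c.
Proof.
move=> ni Kc cK.
have loc x : K x -> exists2 d : R, 0 < d &
    rel_bounds (away (box (x - const_mx d) (x + const_mx d))) c.
  move=> Kx; have := cK x Kx; rewrite -(image_set1 e) => cx.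
  have [d d0 dP] := rel_bounds_thicken (@compact_set1 _ x) cx.
  exists d => //; apply: dP => y xy; exists x => // j.
  by have := xy j; rewrite !mxE ler_norml; lra.
have [l lc Kl] : exists2 l, (forall ab, ab \in l -> rel_bounds (away (box ab.1 ab.2)) c) &
    K `<=` boxes l.
  move: Kc; rewrite compact_cover.
  have /choice[d dP] : forall x : 'rV[R]_n, exists d : R, K x -> 0 < d /\
      rel_bounds (away (box (x - const_mx d) (x + const_mx d))) c.
    move=> x; have [Kx|nKx] := pselect (K x); last by exists 0.
    by have [d d0 dP] := loc x Kx; exists d.
  case/(_ _ K (fun x => [set y : 'rV[R]_n | forall j, `|y ord0 j - x ord0 j| < d x])).
  - by move=> x _; exact: open_cube.
  - by move=> x Kx; exists x => // j; rewrite subrr normr0; exact: (dP x Kx).1.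
  move=> D DK KD; exists [seq (x - const_mx (d x), x + const_mx (d x)) | x : 'rV[R]_n <- finmap.enum_fset D].
    by move=> _ /mapP[x xD ->]; apply: (dP x _).2; have /set_mem := DK x xD.
  move=> x /KD[z zD xz]; eexists; first by apply/mapP; exists z.
  by move=> j; have := xz j; rewrite !mxE ltr_norml => /andP[h1 h2]; apply/andP; split; lra.
have lb : rel_bounds (away (boxes l)) c.
  elim: l lc {Kl} => [|[a b] l IHl] lc.
    rewrite (_ : boxes [::] = set0); last by apply/seteqP; split=> // x [].
    by rewrite image_set0 setC0; exact: chain_in_rel_bounds.
  rewrite boxes_cons -away_setU; apply: rel_bounds_setI.
  - by apply: open_away; exact: box_compact.
  - by apply: open_away; exact: boxes_compact.
  - rewrite away_setI; have [l' l'l ->] := boxes_setI a b l.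
    by apply: boxes_acyclic; rewrite ltnS.
  - by apply: (lc (a, b)); rewrite inE eqxx.
  - by apply: IHl => ab abl; apply: lc; rewrite inE abl orbT.
apply: sub_rel_bounds lb => x xl [y Ky yx]; apply: xl; exists y => //.
exact: Kl.
Qed.

End LocalToGlobal.

(** Compactness is applied to the filter of lists that contain a given finite list. *)
Lemma compact_finite_nbhs_cover (X : topologicalType) (K : X -> set X) :
  compact [set: X] -> (forall x, nbhs x (K x)) ->
  exists l : seq X, forall y, exists2 x, x \in l & K x y.
Proof.
move=> /compact_near_coveringP Xc Kx.
pose F : set_system (seq X) := [set P | exists l0 : seq X,
  forall l : seq X, {subset l0 <= l} -> P l].
have FF : Filter F.
  split=> [|P Q [l1 P1] [l2 Q2]|P Q PQ [l0 P0]].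
  - by exists [::].
  - exists (l1 ++ l2) => l l12; split.
      by apply: P1 => x x1; apply: l12; rewrite mem_cat x1.
    by apply: Q2 => x x2; apply: l12; rewrite mem_cat x2 orbT.
  - by exists l0 => l /P0/PQ.
have [|l lP] := Xc _ F (fun l y => exists2 x, x \in l & K x y) FF.
  move=> x _; exists (K x, [set l : seq X | x \in l]) => /=.
    by split; [exact: Kx|exists [:: x] => l; apply; rewrite inE eqxx].
  by move=> [y l] /= [Kxy xl]; exists x.
by exists l => y; exact: (lP l (fun _ => id) y Logic.I).
Qed.

(** * Gluing local orientations into a fundamental cycle *)

Section FundamentalClass.
Context {R : realType}.

Lemma chain_in_set0 n (X : topologicalType) (c : chain R n X) :
  chain_in set0 c -> c = 0.
Proof.
apply: (chain_in_ind (P := fun c => c = 0)) => [//|x y -> ->|s s0]; first exact: subrr.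
by case: (s0 (s (barycenter n))); exists (barycenter n).
Qed.

Lemma manifold_point_acyclic n (M : topologicalType) (x : M) i :
  closed_manifold R n M -> (n < i)%N -> rel_acyclic R i (~` [set x]).
Proof.
move=> Mn; have [e [f [ef <- _]]] := manifold_embedding Mn openT (Logic.I : setT x).
case: i => // i ni; have [_ fe _] := ef; have [hM _ _ _] := Mn.
apply: (embedding_acyclic ef).
- by apply: closed_openC; apply: compact_closed => //; exact: compact_set1.
- apply/seteqP; split=> // y _; have [->|ye] := pselect (y = e 0); last by left.
  by right; exists 0.
rewrite (_ : _ @^-1` _ = ~` [set 0]); first exact: euclidean_point_acyclic.
apply/seteqP; split=> y; first by move=> ye y0; apply: ye; rewrite /= y0.
by move=> y0 /= /(congr1 f); rewrite !fe.
Qed.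

(** A closed set is [good] when it carries a relative cycle that restricts to the orientation at
    each of its points. Chart cubes are good, and good sets are added one cube at a time. Once the
    cubes cover [M], the boundary has empty support and is 0. *)
Lemma fundamental_cycle_exists n (M : topologicalType) (o : M -> chain R n.+1 M) :
  closed_manifold R n.+1 M -> is_orientation o -> exists z, is_fundamental_cycle o z.
Proof.
move=> Mn [_ _ oloc]; have [hM _ Mc _] := Mn.
have pa x i : (n.+1 < i)%N -> rel_acyclic R i (~` [set x : M]).
  exact: manifold_point_acyclic.
pose good (K : set M) := closed K /\ exists c : chain R n.+1 M,
  chain_in (~` K) (boundary c) /\ forall y, K y -> rel_bounds (~` [set y]) (c - o y).
have loc (x : M) : exists (K : set M), nbhs x K /\ exists (e : continuousType 'rV[R]_n.+1 M) f L,
    [/\ open_embedding e f, compact L, K = e @` L & good K].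
  have [e [f [ef ex _]]] := manifold_embedding Mn openT (Logic.I : setT x).
  have [oe fe fc] := ef; have [U [oU Ux [b bU bo]]] := oloc x.
  have : \forall v \near (0 : 'rV[R]_n.+1), U (e v).
    by apply: (@cts_fun _ _ e); rewrite ex; exact: open_nbhs_nbhs.
  move=> /nbhs_ballP[r /= r0 rU].
  pose L := box (const_mx (- (r / 2))) (const_mx (r / 2)) : set 'rV[R]_n.+1.
  have LU v : L v -> U (e v).
    move=> Lv; apply: rU; split=> // i j; rewrite (ord1 i) /ball/= mxE sub0r normrN.
    have := Lv j; rewrite !mxE => /andP[h1 h2].
    by rewrite (@le_lt_trans _ _ (r / 2))// ?ler_norml ?h1//; lra.
  have eLU : e @` L `<=` U by move=> _ [v Lv <-]; exact: LU.
  have Lc : compact L by exact: box_compact.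
  have eL : closed (e @` L).
    apply: compact_closed => //; apply: continuous_compact Lc.
    by apply: continuous_subspaceT; exact: cts_fun.
  exists (e @` L); split; last first.
    exists e, f, L; split=> //; split=> //; exists b; split.
      by apply: sub_chain_in bU => y nUy /eLU.
    by move=> y /eLU; exact: bo.
  have Rx : range e x by exists 0.
  have fx : {for x, continuous f} by exact: within_open_continuous fc.
  have near_f : \forall y \near x, (fun v : 'rV[R]_n.+1 => forall j, `|v ord0 j| < r / 2) (f y).
    have o2 : open [set v : 'rV[R]_n.+1 | forall j, `|v ord0 j| < r / 2].
      have := @open_cube R n.+1 0 (r / 2); congr open.
      by apply/seteqP; split=> v vr j; have := vr j; rewrite mxE subr0.
    have := fx [set v : 'rV[R]_n.+1 | forall j, `|v ord0 j| < r / 2]; apply.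
    rewrite -ex fe; apply: open_nbhs_nbhs; split=> // j.
    by rewrite mxE normr0 divr_gt0.
  have near_e : \forall y \near x, range e y by exact: open_nbhs_nbhs.
  apply: filterS2 near_f near_e => y fy [v _ vy]; exists v => // j.
  have := fy j; rewrite -vy fe !mxE ltr_norml => /andP[h1 h2].
  by rewrite !ltW.
have [K KP] := choice loc; pose un (l : seq M) := [set y | exists2 x, x \in l & K x y].
have goodl l : good (un l).
  elim: l => [|x l [cl [c2 [c2b c2o]]]].
    rewrite (_ : un [::] = set0); last by apply/seteqP; split=> // y [].
    by split; [exact: closed0|exists 0; split=> //; rewrite setC0].
  have -> : un (x :: l) = K x `|` un l.
    apply/seteqP; split=> y.
      by move=> [z]; rewrite inE => /orP[/eqP ->|zl] Kzy; [left|right; exists z].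
    by case=> [Kxy|[z zl Kzy]]; [exists x|exists z]; rewrite // inE ?eqxx// zl orbT.
  have [_ [e [f [L [ef Lc KL [cK [c1 [c1b c1o]]]]]]]] := KP x.
  split; first exact: closedU.
  have [|||c [cb cc1 cc2]] := rel_cycle_glue (c1 := c1) (c2 := c2) _ _ c1b c2b.
  - exact: closed_openC.
  - exact: closed_openC.
  (* The overlap is a compact subset of one chart. At each of its points both cycles give the
     orientation, so their difference vanishes there and hence along the whole overlap. *)
  - have -> : ~` K x `|` ~` un l = ~` (e @` (L `&` e @^-1` un l)).
      rewrite -setCI KL; congr (~` _); apply/seteqP; split=> y.
        by move=> [[v Lv <-] vl]; exists v.
      by move=> [v [Lv vl] <-]; split=> //; exists v.
    apply: (compact_rel_bounds hM ef pa (leqnn _)).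
      apply: compact_closedI => //.
      by have /continuous_closedP := @cts_fun _ _ e; exact.
    move=> v [Lv vl]; have -> : c1 - c2 = (c1 - o (e v)) - (c2 - o (e v)).
      by rewrite opprB addrA subrK.
    by apply: rel_boundsB; [apply: c1o; rewrite KL; exists v|exact: c2o].
  exists c; split; first by rewrite setCU.
  move=> y [Ky|ly].
    rewrite -(subrK c1 c) -addrA; apply: rel_boundsD; last exact: c1o.
    by apply: sub_rel_bounds cc1 => z nKz zy; apply: nKz; rewrite zy.
  rewrite -(subrK c2 c) -addrA; apply: rel_boundsD; last exact: c2o.
  by apply: sub_rel_bounds cc2 => z nKz zy; apply: nKz; rewrite zy.
have [l lM] := compact_finite_nbhs_cover Mc (fun x => (KP x).1).
have [_ [z [zb zo]]] := goodl l.
have unT : un l = setT by apply/seteqP; split=> // y _; exact: lM.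
exists z; split; last by move=> x; apply: zo; rewrite unT.
by apply: chain_in_set0; move: zb; rewrite unT setCT.
Qed.

End FundamentalClass.

(** * Coverings and deck transformations *)

Section Connectedness.
Context {R : realType}.

Lemma connected_locally_constant (X : topologicalType) (S : set X) x :
  connected [set: X] -> (forall y, \forall z \near y, S y <-> S z) -> S x ->
  forall y, S y.
Proof.
move=> Xc Sloc Sx y; have -> // : S = setT.
have opS (B : set X) : (forall y, B y -> \forall z \near y, B z) -> open B.
  by rewrite openE.
apply: Xc; first by exists x.
  exists S; last by rewrite setTI.
  by apply: opS => z Sz; apply: filterS (Sloc z) => w [+ _]; apply.
exists S; last by rewrite setTI.
rewrite -[S]setCK; apply: open_closedC; apply: opS => z nSz.
by apply: filterS (Sloc z) => w [_ +] Sw; move/(_ Sw).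
Qed.

Lemma path_connected (X : topologicalType) (x : X) :
  (forall y, exists g : R -> X, is_path x y g) -> connected [set: X].
Proof.
move=> /choice[g gP].
have -> : [set: X] = \bigcup_y (g y @` `[0, 1]%classic).
  apply/seteqP; split=> // y _; exists y => //; have [_ _ gy] := gP y.
  by exists 1 => //; rewrite /= in_itv/= ler01 lexx.
apply: bigcup_connected => [|y _].
  exists x => y _; have [_ gx _] := gP y.
  by exists 0 => //; rewrite /= in_itv/= ler01 lexx.
apply: connected_continuous_connected; first exact: segment_connected.
by have [] := gP y.
Qed.

Lemma contraction_connected (X : topologicalType) (H : contraction R X) :
  connected [set: X].
Proof.
apply: (path_connected (x := contraction_pt H)) => y.
exists (fun t => H (y, 1 - t)); split.
- apply: continuous_subspaceT.
  have c : continuous (fun t : R => (y, 1 - t)).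
    move=> t; apply: (@for_continuous_pair R X R (fun=> y) (fun t => 1 - t)).
      exact: cvg_cst.
    by apply: cvgB; [exact: cvg_cst|exact: cvg_id].
  by move=> t; apply: (for_continuous_comp (c t)); exact: contraction_continuous.
- by rewrite subr0 contraction_map1.
- by rewrite subrr contraction_map0.
Qed.

End Connectedness.

Section Coverings.
Context {R : realType} {E M : topologicalType}.
Variable p : continuousType E M.
Hypothesis p_covering : is_covering p.

(* Two points of one fibre lie in the same sheet, on which [p] is injective,
   exactly when they are equal; otherwise they lie in disjoint sheets. *)
Lemma covering_separates (e1 e2 : E) : p e1 = p e2 ->
  exists W1 W2, [/\ open W1 /\ W1 e1, open W2 /\ W2 e2 &
    forall a b, W1 a -> W2 b -> p a = p b -> (a = b <-> e1 = e2)].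
Proof.
move=> e12; have [_ _ /(_ (p e1))[U [oU Ue [I [V [Vo Vtriv UV Vs]]]]]] := p_covering.
have [i _ Vi] : (\bigcup_i V i) e1 by rewrite -UV.
have [j _ Vj] : (\bigcup_i V i) e2 by rewrite -UV /preimage/= -e12.
have sheet k a b : V k a -> V k b -> p a = p b -> a = b.
  by have [s [_ _ _ sK]] := Vs k; move=> Va Vb ab; rewrite -(sK a Va) ab sK.
have [e12'|ne12] := pselect (e1 = e2).
  exists (V i), (V i); split=> [||a b Va Vb pab]; [by []|by rewrite -e12'|].
  by split=> // _; exact: (sheet i).
exists (V i), (V j); split=> // a b Va Vb pab; split=> // ab.
exfalso; apply: ne12.
have ij : i = j by apply: (Vtriv i j) => //; exists a; split=> //; rewrite ab.
by apply: (sheet i) => //; rewrite ij.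
Qed.

Lemma lift_unique (Z : topologicalType) (f g : Z -> E) z0 :
  connected [set: Z] -> continuous f -> continuous g ->
  (forall z, p (f z) = p (g z)) -> f z0 = g z0 -> forall z, f z = g z.
Proof.
move=> Zc fc gc pfg fg0; apply: (connected_locally_constant (S := fun z => f z = g z) Zc) fg0.
move=> z; have [W1 [W2 [[oW1 W1f] [oW2 W2g] W12]]] := covering_separates (pfg z).
have n1 : \forall w \near z, W1 (f w) by apply: fc; exact: open_nbhs_nbhs.
have n2 : \forall w \near z, W2 (g w) by apply: gc; exact: open_nbhs_nbhs.
by apply: filterS2 n1 n2 => w W1w W2w; have := W12 _ _ W1w W2w (pfg w) => -[? ?]; split.
Qed.

Lemma chain_lift n (c : chain R n M) :
  exists N (c' : chain R n E), push p c' = sdN N c.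
Proof.
have [_ p_surj p_local] := p_covering.
have /choice[U UP] := p_local.
have [|//|N cN] := @iter_sd_small R n M M U c; first by move=> b; have [] := UP b.
  by move=> s _ x _; exists x => //; have [] := UP x.
exists N; apply: (freeg_subgroup_ind (P := fun c => exists c' : chain R n E, push p c' = c)).
- by exists 0; rewrite push0.
- by move=> _ _ [x <-] [y <-]; exists (x - y); rewrite pushB.
move=> s /cN[b sU]; have [oU Ub [I [V [Vo Vtriv UV Vs]]]] := UP b.
have [e eb] := p_surj b.
have [i _ _] : (\bigcup_i V i) e by rewrite -UV /preimage/= eb.
have [t [tc _ tU _]] := Vs i.
have sU' x : U b (s x) by apply: sU; exists x.
have tsc : continuous (t \o s) by apply: within_continuous_comp_in sU' tc; exact: cts_fun.
exists (fgen (continuous_bundle tsc : singular_simplex R n E)).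
by rewrite push_fgen; congr fgen; apply: eq_simplex => x; rewrite /= tU.
Qed.

End Coverings.

Section DeckTransformations.
Context {R : realType} {n : nat} {G : groupType} {E M : topologicalType}.
Variables (p : continuousType E M) (e0 : E) (cls : (R -> M) -> G).
Variable deck : G -> continuousType E E.
Hypothesis M_manifold : closed_manifold R n M.
Hypothesis p_universal : is_universal_covering R p.
Hypothesis deckP : is_deck_action p e0 cls deck.

(** The action of loops yields transitivity on the fibre of [e0] only. The property spreads to all
    fibres because it is locally constant: over a connected chart inside an evenly covered set, a
    translated section is again a section. *)
Lemma deck_transitive e e' : p e = p e' -> exists g, deck g e = e'.
Proof.
have [p_covering [Epath _]] := p_universal.
have [deck1 deckM pdeck deck_loop] := deckP.
have [pc p_surj p_local] := p_covering.
pose S e := forall e', p e = p e' -> exists g, deck g e = e'.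
suff : S e by exact.
have Ec : connected [set: E] by exact: (path_connected (Epath e0)).
apply: (connected_locally_constant (S := S) Ec (x := e0)); last first.
  move=> f pf; have [g gP] := Epath e0 f.
  by exists (cls (p \o g)); apply: deck_loop.
move=> {e e'} e; have [U [oU Ue [I [V [Vo Vtriv UV Vs]]]]] := p_local (p e).
have [h [k [[oh kh hc] h0 hU]]] := manifold_embedding M_manifold oU Ue.
have [i _ Vi] : (\bigcup_i V i) e by rewrite -UV.
have [s [sc sV ps sK]] := Vs i.
have hU' v : U (h v) by apply: hU; exists v.
have ne : \forall f \near e, V i f /\ range h (p f).
  apply: filterI; first exact: open_nbhs_nbhs.
  by apply: pc; apply: open_nbhs_nbhs; split=> //; rewrite -h0; exists 0.
have Hc := contraction_connected (segment_contraction (0 : 'rV[R]_n)).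
(* Deck transformations and local sections agree over a connected set as soon
   as they do at one point. *)
have move_S a b : V i a -> V i b -> range h (p a) -> range h (p b) -> S a -> S b.
  move=> Va Vb [va _ hva] [vb _ hvb] Sa b' pbb'.
  have [j _ Vj] : (\bigcup_j V j) b' by rewrite -UV /preimage/= -pbb' -hvb.
  have [t [tc _ pt tK]] := Vs j.
  have [|g ga] := Sa (t (h va)); first by rewrite pt// hva.
  exists g; rewrite -(sK b Vb) -(tK b' Vj) -pbb' -hvb.
  apply: (lift_unique p_covering (f := fun v => deck g (s (h v))) (g := fun v => t (h v))
    (z0 := va) Hc).
  - have shc : continuous (s \o h).
      by apply: (within_continuous_comp_in _ hU' sc); exact: cts_fun.
    move=> v; apply: (for_continuous_comp (shc v)).
    exact: (@cts_fun _ _ (deck g)).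
  - by apply: (within_continuous_comp_in _ hU' tc); exact: cts_fun.
  - by move=> v; rewrite pdeck ps// pt.
  - by rewrite -ga hva sK.
apply: filterS ne => f [Vf hf]; have he : range h (p e) by rewrite -h0; exists 0.
by split; apply: move_S.
Qed.

Lemma simplex_deck m (s t : singular_simplex R m E) :
  simplex_push p s = simplex_push p t -> exists g, simplex_push (deck g) s = t.
Proof.
have [p_covering _] := p_universal; have [_ _ pdeck _] := deckP.
move=> st; have pst x : p (s x) = p (t x).
  by have /(congr1 (fun u : singular_simplex R m M => u x)) := st.
have [g gb] := deck_transitive (pst (barycenter m)).
exists g; apply: eq_simplex.
apply: (lift_unique p_covering (z0 := barycenter m)) => //.
- exact: (contraction_connected (bary_contraction m)).
- exact: cts_fun.
- exact: cts_fun.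
- by move=> x; rewrite /= pdeck pst.
Qed.

(** A reference lift [D t] is chosen for each simplex [t] below, with 0 if there is none. Replacing
    every simplex of [c] by the reference lift of its projection changes [c] by terms of the
    required shape, and turns it into 0 when its projection vanishes. *)
Lemma push_ker m (c : chain R m E) : push p c = 0 ->
  exists l : seq (G * singular_simplex R m E),
    c = \sum_(gs <- l) (fgen gs.2 - push (deck gs.1) (fgen gs.2)).
Proof.
have [deck1 deckM pdeck _] := deckP.
pose P (c : chain R m E) := exists l : seq (G * singular_simplex R m E),
  c = \sum_(gs <- l) (fgen gs.2 - push (deck gs.1) (fgen gs.2)).
have PD x y : P x -> P y -> P (x + y).
  by move=> [l1 ->] [l2 ->]; exists (l1 ++ l2); rewrite big_cat.
have PN x : P x -> P (- x).
  move=> [l ->]; exists [seq (gs.1^-1%g, simplex_push (deck gs.1) gs.2) | gs <- l].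
  rewrite big_map -sumrN; apply: eq_bigr => -[g s] _ /=.
  rewrite opprB push_fgen; congr (_ - _).
  rewrite push_fgen; congr fgen; apply: eq_simplex => y /=.
  by rewrite -deckM mulVg deck1.
have /choice[D DP] : forall t : singular_simplex R m M, exists d : chain R m E,
    forall s, simplex_push p s = t -> exists g, d = push (deck g) (fgen s).
  move=> t; have [[s0 s0t]|nt] := pselect (exists s : singular_simplex R m E, simplex_push p s = t).
    exists (fgen s0) => s st; have [g gs] : exists g, simplex_push (deck g) s = s0.
      by apply: simplex_deck; rewrite st s0t.
    by exists g; rewrite push_fgen gs.
  by exists 0 => s st; case: nt; exists s.
move=> pc0; suff : P (c - zlift D (push p c)) by rewrite pc0 zlift0 subr0.
apply: (freeg_subgroup_ind (P := fun c => P (c - zlift D (push p c)))).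
- by rewrite push0 zlift0 subrr; exists [::]; rewrite big_nil.
- move=> x y Px Py; rewrite pushB zliftB subrACA; apply: PD => //; exact: PN.
move=> s _; rewrite push_fgen zlift_fgen; have [g ->] := DP _ s erefl.
by exists [:: (g, s)]; rewrite big_seq1.
Qed.

End DeckTransformations.

(** * Folner sets in amenable groups *)

Section HahnBanach.
Context {R : realType} {V : lmodType R}.
(* [U v] is a set of upper bounds for the value at [v], so that the dominating
   sublinear functional is the infimum of [U]. *)
Variable U : V -> set R.
Hypothesis U_nonempty : forall v, exists r, U v r.
Hypothesis U_add : forall v w r s, U v r -> U w s -> U (v + w) (r + s).
Hypothesis U_scale : forall v r t, 0 < t -> U v r -> U (t *: v) (t * r).
Hypothesis U_zero : forall r, U 0 r -> 0 <= r.

(** Zorn's lemma is applied to linear subspaces of [V * R] dominated by [U], as graphs of partial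
    functionals. Being single-valued is not imposed on them; it follows from the domination. *)
Lemma hahn_banach : exists L : V -> R,
  [/\ forall v w, L (v + w) = L v + L w, forall t v, L (t *: v) = t * L v &
      forall v r, U v r -> L v <= r].
Proof.
pose P (A : set (V * R)) := [/\ forall x y, A x -> A y -> A (x.1 + y.1, x.2 + y.2),
  forall t x, A x -> A (t *: x.1, t * x.2) & forall x r, A x -> U x.1 r -> x.2 <= r].
have [F FP Ftot|A [[AD AZ AU] Amax]] := @Zorn_bigcup (V * R)%type P.
  split=> [x y [X FX Xx] [Y FY Yy]|t x [X FX Xx]|x r [X FX Xx]].
  - have [XY|YX] := Ftot X Y FX FY.
      by exists Y => //; have [YD _ _] := FP Y FY; apply: YD => //; exact: XY.
    by exists X => //; have [XD _ _] := FP X FX; apply: XD => //; exact: YX.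
  - by exists X => //; have [_ XZ _] := FP X FX; exact: XZ.
  - by have [_ _ XU] := FP X FX; exact: XU.
(* The empty set satisfies [P] too. A maximal set without the origin would be empty, by scaling with
   0, and the singleton of the origin is larger. *)
have A0 : A (0, 0).
  apply: contrapT => nA0; have A_empty x : ~ A x.
    by move=> /(AZ 0); rewrite scale0r mul0r.
  apply: (Amax [set (0, 0)]).
    by split=> [x /A_empty//|/(_ (0, 0) erefl)].
  split=> [x y -> -> /=|t x -> /=|x r -> /=]; last exact: U_zero.
    by rewrite !addr0.
  by rewrite scaler0 mulr0.
have Adom v0 : exists r, A (v0, r).
  (* The lower bounds that domination imposes on the value at [v0]. By additivity of [U] they all
     lie below the upper bounds, so their supremum [r0] is an admissible value. *)
  pose S := [set x | exists v r u, [/\ A (v, r), U (v - v0) u & x = r - u]].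
  have Sle x w s u : S x -> A (w, s) -> U (w + v0) u -> x <= u - s.
    move=> [v [r [u' [Avr Uu' ->]]]] Aws Uu.
    rewrite lerBlDr addrAC lerBrDr; apply: (AU (v + w, r + s)); first exact: (AD (v, r) (w, s)).
    by have := U_add Uu' Uu; rewrite /= addrACA addNr addr0 addrC [u' + u]addrC.
  have S0 : S !=set0 by have [u Uu] := U_nonempty (0 - v0); exists (0 - u), 0, 0, u.
  have Sub : has_ubound S.
    have [u Uu] := U_nonempty (0 + v0); exists (u - 0) => x Sx.
    exact: (Sle x 0 0 u).
  pose r0 := sup S.
  have r0_ge v r u : A (v, r) -> U (v - v0) u -> r - u <= r0.
    by move=> Avr Uu; apply: ub_le_sup => //; exists v, r, u.
  have r0_le w s u : A (w, s) -> U (w + v0) u -> r0 <= u - s.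
    by move=> Aws Uu; apply: ge_sup => // x Sx; exact: (Sle x w).
  pose B := [set x | exists v r t, A (v, r) /\ x = (v + t *: v0, r + t * r0)].
  have AB : A `<=` B by move=> [v r] Avr; exists v, r, 0; rewrite scale0r mul0r !addr0.
  have Bv0 : B (v0, r0) by exists 0, 0, 1; rewrite scale1r mul1r !add0r.
  exists r0; apply: contrapT => nA; apply: (Amax B).
    by split=> // BA; apply: nA; exact: BA.
  split=> [_ _ [v [r [t [Avr ->]]]] [w [s [t' [Aws ->]]]]|t' _ [v [r [t [Avr ->]]]]|].
  - exists (v + w), (r + s), (t + t'); split; first exact: (AD (v, r) (w, s)).
    by rewrite /= scalerDl mulrDl addrACA [X in (_, X)]addrACA.
  - exists (t' *: v), (t' * r), (t' * t); split; first exact: (AZ t' (v, r)).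
    by rewrite /= scalerDr mulrDr scalerA mulrA.
  move=> _ u [v [r [t [Avr ->]]]] /=.
  have [t0|t0|->] := ltgtP t 0; last first.
  - by rewrite scale0r mul0r !addr0; exact: (AU (v, r)).
  - have ti : 0 < t^-1 by rewrite invr_gt0.
    move=> /(U_scale ti); rewrite scalerDr scalerA mulVf ?gt_eqF// scale1r.
    move=> /(r0_le _ _ _ (AZ t^-1 (v, r) Avr)) /=.
    by rewrite -mulrBr -(ler_pM2l t0) mulrA mulfV ?gt_eqF// mul1r lerBrDr addrC.
  - have nt : 0 < - t by rewrite oppr_gt0.
    have ti : 0 < (- t)^-1 by rewrite invr_gt0.
    move=> /(U_scale ti); rewrite scalerDr scalerA.
    have -> : (- t)^-1 * t = -1 by rewrite invrN mulNr mulVf ?lt_eqF.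
    rewrite scaleN1r => /(r0_ge _ _ _ (AZ (- t)^-1 (v, r) Avr)) /=.
    rewrite -mulrBr -(ler_pM2l nt) mulrA mulfV ?gt_eqF// mul1r mulNr.
    by rewrite lerBlDr -lerBlDl opprK addrC.
(* Two values at [v] would put every multiple of their difference in the fibre over 0, yet a single
   element of [U 0] bounds that fibre. *)
have Afun v r s : A (v, r) -> A (v, s) -> r = s.
  move=> Avr Avs; have le a b : A (v, a) -> A (v, b) -> a <= b.
    move=> Ava Avb; rewrite -subr_le0.
    have /= A0ab := AD _ _ Ava (AZ (-1) _ Avb).
    rewrite scaleN1r subrr mulN1r in A0ab.
    have [u Uu] := U_nonempty 0.
    have key t : 0 < t -> t * (a - b) <= u.
      by move=> t0; have /= := AZ t _ A0ab; rewrite scaler0 => /AU; exact.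
    rewrite leNgt; apply/negP => ab.
    have u0 : 0 <= u by exact: U_zero.
    have t0 : 0 < (u + 1) / (a - b) by apply: divr_gt0 => //; exact: ltr_wpDl.
    have := key _ t0.
    by rewrite divfK ?gt_eqF// gerDl ler10.
  by apply/eqP; rewrite eq_le !le.
have [L LA] := choice Adom; exists L; split=> [v w|t v|v r].
- by apply: (Afun (v + w)) => //; exact: (AD _ _ (LA v) (LA w)).
- by apply: (Afun (t *: v)) => //; exact: (AZ t _ (LA v)).
- exact: (AU _ _ (LA v)).
Qed.

End HahnBanach.

Section FreeModuleTotal.
Context {R : realType} {K : choiceType}.
Implicit Types D : {freeg K / R}.

Definition total D : R := \sum_(k <- freeg.dom D) freeg.coeff k D.

Lemma totalE D l : uniq l -> {subset freeg.dom D <= l} ->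
  total D = \sum_(k <- l) freeg.coeff k D.
Proof.
move=> ul Dl; rewrite /total [RHS](bigID (fun k => k \in freeg.dom D)) /=.
rewrite [X in _ + X]big1 ?addr0 => [|k]; last exact: coeff_outdom.
rewrite -[RHS]big_filter.
rewrite (perm_big [seq k <- l | k \in freeg.dom D])//.
apply: uniq_perm; [exact: uniq_dom|exact: filter_uniq|].
by move=> k; rewrite mem_filter; case: (boolP (k \in freeg.dom D)) => // /Dl ->.
Qed.

Lemma totalD D D' : total (D + D') = total D + total D'.
Proof.
pose l := undup (freeg.dom D ++ freeg.dom D').
have ul : uniq l by exact: undup_uniq.
rewrite !(@totalE _ l)//; first 1 last.
- by move=> k kD; rewrite mem_undup mem_cat kD orbT.
- by move=> k kD; rewrite mem_undup mem_cat kD.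
- by move=> k /domD_subset; rewrite mem_undup.
by rewrite -big_split; apply: eq_bigr => k _; rewrite coeffD.
Qed.

Lemma totalZ t D : total (t *: D) = t * total D.
Proof.
rewrite (@totalE (t *: D) (freeg.dom D)) ?uniq_dom//; last exact: domZ_subset.
by rewrite /total mulr_sumr; apply: eq_bigr => k _; rewrite coeffZ.
Qed.

Lemma ler_sum_total D l : (forall k, 0 <= freeg.coeff k D) -> uniq l ->
  \sum_(k <- l) freeg.coeff k D <= total D.
Proof.
move=> D0 ul; pose l' := l ++ [seq k <- freeg.dom D | k \notin l].
have ul' : uniq l'.
  rewrite cat_uniq ul filter_uniq ?uniq_dom// andbT.
  by apply/hasPn => k; rewrite mem_filter => /andP[].
rewrite (@totalE D l')//.
  by rewrite big_cat lerDl sumr_ge0.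
by move=> k kD; rewrite mem_cat mem_filter kD andbT orbN.
Qed.

Lemma total_unit k : total (<< (1 : R) *g k >> : {freeg K / R}) = 1.
Proof.
rewrite (@totalE _ [:: k])//; first by rewrite big_seq1 coeffU eqxx mul1r.
by move=> x; rewrite domU1.
Qed.

End FreeModuleTotal.

Section Folner.
Context {R : realType} {G : groupType}.

Definition folner (S : seq G) (e : R) (T : seq G) :=
  [/\ uniq T, T != [::] & forall s, s \in S ->
    (count (fun t => (s * t)%g \notin T) T)%:R <= e * (size T)%:R].

Lemma min_seq (T : eqType) (phi : T -> R) (l : seq T) : l != [::] ->
  exists2 x, x \in l & forall y, y \in l -> phi x <= phi y.
Proof.
elim: l => // a [|b l] IHl _; first by exists a; rewrite ?inE// => y; rewrite inE => /eqP ->.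
have [//|x xl xmin] := IHl; have [ax|/ltW xa] := leP (phi a) (phi x).
  by exists a; rewrite ?inE ?eqxx// => y; rewrite inE => /orP[/eqP ->//|/xmin]; exact: le_trans.
exists x; first by rewrite inE xl orbT.
by move=> y; rewrite inE => /orP[/eqP ->//|/xmin].
Qed.

(* Layer-cake decomposition: an isoperimetric inequality for finite sets gives
   one for finitely supported functions. *)
Lemma isoperimetric_functions (S : seq G) (d : R) :
  (forall T : seq G, uniq T ->
    d * (size T)%:R <= \sum_(s <- S) (count (fun t => (s * t)%g \notin T) T)%:R) ->
  forall (T : seq G) (phi : G -> R), uniq T -> (forall x, 0 <= phi x) ->
    (forall x, x \notin T -> phi x = 0) ->
    d * \sum_(x <- T) phi x <=
      \sum_(s <- S) \sum_(x <- T) Num.max 0 (phi x - phi (s * x)%g).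
Proof.
move=> iso T; move En : (size T) => k.
elim: k T En => [|k IHk] T Tk phi uT phi0 phiT.
  rewrite (size0nil Tk) big_nil mulr0; apply: sumr_ge0 => s _.
  by rewrite big_nil.
have T0 : T != [::] by rewrite -size_eq0 Tk.
have [t0 t0T t0min] := min_seq phi T0.
(* Subtracting the minimum of [phi] on [T] removes one layer, to which the inequality for sets
   applies; the remainder vanishes at [t0], so its support is smaller. *)
pose m := phi t0; pose psi x := if x \in T then phi x - m else 0.
have psi0 x : 0 <= psi x.
  by rewrite /psi; case: ifP => // xT; rewrite subr_ge0 t0min.
have phiE x : x \in T -> phi x = m + psi x by move=> xT; rewrite /psi xT addrC subrK.
have psiT x : x \notin rem t0 T -> psi x = 0.
  rewrite (mem_rem_uniq _ uT) inE negb_and negbK => /orP[/eqP ->|xT].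
    by rewrite /psi t0T subrr.
  by rewrite /psi (negPf xT).
have IH := IHk (rem t0 T) _ psi (rem_uniq _ uT) psi0 psiT.
have {}IH : d * \sum_(x <- T) psi x <=
    \sum_(s <- S) \sum_(x <- T) Num.max 0 (psi x - psi (s * x)%g).
  apply: le_trans (le_trans (IH _) _).
  - by rewrite (perm_big _ (perm_to_rem t0T))/= big_cons [psi t0]psiT ?add0r// mem_rem_uniq ?inE ?eqxx.
  - by rewrite size_rem// Tk.
  - apply: ler_sum => s _; rewrite [leRHS](perm_big _ (perm_to_rem t0T))/= big_cons.
    by rewrite lerDr le_max lexx.
have step s : \sum_(x <- T) Num.max 0 (phi x - phi (s * x)%g) =
    m * (count (fun t => (s * t)%g \notin T) T)%:R +
    \sum_(x <- T) Num.max 0 (psi x - psi (s * x)%g).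
  rewrite -sum1_count natr_sum mulr_sumr [X in _ = X + _]big_mkcond -big_split /=.
  rewrite big_seq [RHS]big_seq; apply: eq_bigr => x xT; rewrite (phiE x xT).
  case: ifPn => [sxT|]; last first.
    by rewrite negbK => sxT; rewrite (phiE _ sxT) opprD addrACA subrr add0r add0r.
  have -> : psi (s * x)%g = 0 by rewrite /psi (negPf sxT).
  rewrite phiT// !subr0 mulr1 !max_r//.
  by rewrite addr_ge0// phi0.
under [leRHS]eq_bigr do rewrite step.
rewrite big_split /= -mulr_sumr.
have -> : \sum_(x <- T) phi x = m * (size T)%:R + \sum_(x <- T) psi x.
  rewrite -sum1_size natr_sum mulr_sumr -big_split/= big_seq [RHS]big_seq.
  by apply: eq_bigr => x xT; rewrite mulr1 phiE.
rewrite mulrDr lerD// mulrCA ler_wpM2l//; first exact: phi0.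
exact: iso.
Qed.

(** Without Folner sets there is an isoperimetric inequality. By duality it produces bounded
    functions [f i] for which the sum of [f i x - f i (s_i^-1 x)] is at least [e] at every [x]. An
    invariant mean gives that sum the value 0, a contradiction. *)
Lemma amenable_folner (S : seq G) (e : R) : amenable R G -> 0 < e ->
  exists T, folner S e T.
Proof.
move=> [m [mD mZ m0 m1 minv]] e0; apply: contrapT => noT.
have iso T : uniq T ->
    e * (size T)%:R <= \sum_(s <- S) (count (fun t => (s * t)%g \notin T) T)%:R.
  move=> uT; have [->|T0] := eqVneq T [::].
    by rewrite mulr0 sumr_ge0.
  have [s sS sT] : exists2 s, s \in S &
      e * (size T)%:R < (count (fun t => (s * t)%g \notin T) T)%:R.
    apply: contrapT => h; apply: noT; exists T; split=> // s sS.
    by rewrite leNgt; apply/negP => sT; apply: h; exists s.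
  rewrite (perm_big _ (perm_to_rem sS))/= big_cons (le_trans (ltW sT))//.
  by rewrite lerDl sumr_ge0.
pose k := size S; pose sg (i : 'I_k) := tnth (in_tuple S) i.
pose V := {freeg ('I_k * G)%type / R}.
(* The nonnegativity of [U 0] is exactly the isoperimetric inequality for the finitely supported
   function [phi], with [w] dominating its differences along [S]. *)
pose U (v : V) : set R := [set r | exists (w : V) (phi : {freeg G / R}),
  [/\ forall x, 0 <= freeg.coeff x w, forall x, 0 <= freeg.coeff x phi,
   forall i x, freeg.coeff (i, x) v + freeg.coeff x phi - freeg.coeff (sg i * x)%g phi <=
     freeg.coeff (i, x) w & r = total w - e * total phi]].
have [] := @hahn_banach R V U.
- move=> v; exists (total (fgpos v)), (fgpos v), 0; split.
  + by move=> x; rewrite coeff_fgposE le_max lexx.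
  + by move=> x; rewrite coeff0.
  + by move=> i x; rewrite !coeff0 addr0 subr0 coeff_fgposE le_max lexx orbT.
  + by rewrite {3}/total dom0 big_nil mulr0 subr0.
- move=> v v' _ _ [w [phi [w0 p0 vw ->]]] [w' [phi' [w0' p0' vw' ->]]].
  exists (w + w'), (phi + phi'); split.
  + by move=> x; rewrite coeffD addr_ge0.
  + by move=> x; rewrite coeffD addr_ge0.
  + move=> i x; rewrite !coeffD; have := lerD (vw i x) (vw' i x).
    by move=> h; lra.
  + by rewrite !totalD mulrDr opprD addrACA.
- move=> v _ t t0 [w [phi [w0 p0 vw ->]]]; exists (t *: w), (t *: phi); split.
  + by move=> x; rewrite coeffZ mulr_ge0// ltW.
  + by move=> x; rewrite coeffZ mulr_ge0// ltW.
  + by move=> i x; rewrite !coeffZ -mulrDr -mulrBr ler_wpM2l// ltW.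
  + by rewrite !totalZ mulrBr mulrCA.
- move=> _ [w [phi [w0 p0 vw ->]]]; rewrite subr_ge0.
  pose T := freeg.dom phi.
  have h : e * total phi <= \sum_(s <- S) \sum_(x <- T)
      Num.max 0 (freeg.coeff x phi - freeg.coeff (s * x)%g phi).
    apply: (isoperimetric_functions iso (phi := fun x => freeg.coeff x phi)) => //.
      exact: uniq_dom.
    by move=> x; exact: coeff_outdom.
  apply: le_trans h _.
  apply: le_trans (ler_sum_total (l := [seq (i, x) | i <- enum 'I_k, x <- T]) w0 _); last first.
    apply: allpairs_uniq; [exact: enum_uniq|exact: uniq_dom|].
    by move=> [? ?] [? ?] _ _ [-> ->].
  rewrite big_allpairs big_enum /= big_tnth; apply: ler_sum => i _; apply: ler_sum => x _.
  by rewrite ge_max w0; have := vw i x; rewrite coeff0 add0r.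
move=> L [LD LZ LU].
have LN v : L (- v) = - L v by rewrite -scaleN1r LZ mulN1r.
have L0 : L 0 = 0 by rewrite -(scale0r (0 : V)) LZ mul0r.
pose f i x : R := L << (1 : R) *g (i, x) >>.
have total0 (K : choiceType) : total (0 : {freeg K / R}) = 0.
  by rewrite /total dom0 big_nil.
have f0 i x : 0 <= f i x.
  rewrite -oppr_le0 -LN; apply: LU; exists 0, 0; split.
  - by move=> y; rewrite coeff0.
  - by move=> y; rewrite coeff0.
  - by move=> j y; rewrite !coeff0 addr0 subr0 coeffN coeffU mul1r oppr_le0 ler0n.
  - by rewrite !total0 mulr0 subrr.
have f1 i x : f i x <= 1.
  apply: LU; exists << (1 : R) *g (i, x) >>, 0; split.
  - by move=> y; rewrite coeffU mul1r ler0n.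
  - by move=> y; rewrite coeff0.
  - by move=> j y; rewrite !coeff0 addr0 subr0.
  - by rewrite total_unit total0 mulr0 subr0.
(* The bound comes from [w = 0] and the unit mass at [x] as [phi], whose differences along [S]
   cancel [v]. *)
have fe x : e <= \sum_(i < k) (f i x - f i ((sg i)^-1 * x)%g).
  pose v : V := \sum_(i < k) (<< (1 : R) *g (i, ((sg i)^-1 * x)%g) >> - << (1 : R) *g (i, x) >>).
  have : L v <= - e.
    apply: LU; exists 0, << (1 : R) *g x >>; split.
    - by move=> y; rewrite coeff0.
    - by move=> y; rewrite coeffU mul1r ler0n.
    - move=> i y; rewrite coeff0 raddf_sum (bigD1 i)//= big1 ?addr0 => [|j ji].
        rewrite coeffB !coeffU !mul1r !xpair_eqE !eqxx /=.
        have -> : ((sg i)^-1 * x == y)%g = (x == sg i * y)%g.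
          by apply/eqP/eqP => [<-|->]; rewrite mulgA ?mulgV ?mulVg mul1g.
        by lra.
      by rewrite coeffB !coeffU !xpair_eqE (negPf ji) !mulr0 subrr.
    - by rewrite total0 total_unit mulr1 sub0r.
  have -> : L v = \sum_(i < k) (f i ((sg i)^-1 * x)%g - f i x).
    rewrite /v; elim/big_ind2: _ => [//|u r u' r' <- <-|i _]; first by rewrite LD.
    by rewrite LD LN.
  rewrite -lerN2 opprK => /le_trans; apply.
  by rewrite -sumrN; apply: ler_sum => i _; rewrite opprB.
pose u i x := f i x - f i ((sg i)^-1 * x)%g.
have fb i : fun_bounded (f i) by exists 1 => x; rewrite ger0_norm.
have fb' i : fun_bounded (fun x => -1 * f i ((sg i)^-1 * x)%g).
  by exists 1 => x; rewrite normrM normrN1 mul1r ger0_norm.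
have uE i : u i = f i \+ (fun x => -1 * f i ((sg i)^-1 * x)%g).
  by apply/funext => x; rewrite /u /= mulN1r.
have ub i : fun_bounded (u i).
  exists 2 => x; rewrite /u (le_trans (ler_normB _ _))// !ger0_norm//.
  by have := f1 i x; have := f1 i ((sg i)^-1 * x)%g; lra.
have mu i : m (u i) = 0.
  rewrite uE mD// mZ ?minv ?mulN1r ?subrr//.
  by exists 1 => x; rewrite ger0_norm.
have sum_u (r : seq 'I_k) : fun_bounded (fun x => \sum_(i <- r) u i x) /\
    m (fun x => \sum_(i <- r) u i x) = 0.
  elim: r => [|i r [[B rB] IHr]].
    have -> : (fun x => \sum_(i <- [::]) u i x) = (fun x => 0 * cst 1 x).
      by apply/funext => x; rewrite big_nil mul0r.
    split; first by exists 0 => x; rewrite mul0r normr0.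
    by rewrite mZ ?mul0r//; exists 1 => x; rewrite normr1.
  have -> : (fun x => \sum_(j <- i :: r) u j x) = u i \+ (fun x => \sum_(j <- r) u j x).
    by apply/funext => x; rewrite big_cons.
  have [C uC] := ub i; split; last by rewrite mD ?mu ?add0r//; exists B.
  by exists (C + B) => x; rewrite (le_trans (ler_normD _ _))// lerD.
have [[B sB] ms] := sum_u (index_enum 'I_k).
have eb : fun_bounded (fun x : G => - e * cst 1 x).
  by exists e => x; rewrite mulr1 normrN gtr0_norm.
have : 0 <= m ((fun x => \sum_(i < k) u i x) \+ (fun x => - e * cst 1 x)).
  apply: m0 => [|x]; last by rewrite /= mulr1 subr_ge0; exact: fe.
  by have [C eC] := eb; exists (B + C) => x; rewrite (le_trans (ler_normD _ _))// lerD.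
have cb : fun_bounded (cst 1 : G -> R) by exists 1 => x; rewrite normr1.
by rewrite mD ?mZ ?ms ?m1//; [rewrite add0r mulr1 oppr_ge0 leNgt e0|exists B].
Qed.

End Folner.

(** * The Rokhlin lemma *)

Section ProbabilityCounting.
Context {R : realType} {d : measure_display} {X : measurableType d}.
Variable mu : probability X R.

Definition prob (A : set X) : R := fine (mu A).

Lemma probE A : measurable A -> mu A = (prob A)%:E.
Proof. by move=> mA; rewrite /prob fineK// fin_num_measure. Qed.

Lemma prob_ge0 A : 0 <= prob A.
Proof. exact/fine_ge0/measure_ge0. Qed.

Lemma prob_le A B : measurable A -> measurable B -> A `<=` B -> prob A <= prob B.
Proof. by move=> mA mB AB; rewrite -lee_fin -!probE// le_measure ?inE. Qed.

Lemma prob_setU_le A B : measurable A -> measurable B ->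
  prob (A `|` B) <= prob A + prob B.
Proof.
move=> mA mB; rewrite -lee_fin EFinD -!probE//; first exact: measureU2.
exact: measurableU.
Qed.

Lemma prob_setU A B : measurable A -> measurable B -> A `&` B = set0 ->
  prob (A `|` B) = prob A + prob B.
Proof.
move=> mA mB AB; apply: EFin_inj; rewrite EFinD -!probE//; first exact: measureU.
exact: measurableU.
Qed.

Lemma prob_setT : prob setT = 1.
Proof. by rewrite /prob probability_setT. Qed.

Lemma prob_setC A : measurable A -> prob (~` A) = 1 - prob A.
Proof.
move=> mA; rewrite -prob_setT -(setUv A) prob_setU ?setICr//; last exact: measurableC.
by rewrite addrC addrA addNr add0r.
Qed.

Lemma prob_set0 : prob set0 = 0.
Proof. by rewrite /prob measure0. Qed.

Definition seqU (I : Type) (l : seq I) (A : I -> set X) : set X :=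
  \big[setU/set0]_(i <- l) A i.

Lemma seqUP (I : eqType) (l : seq I) (A : I -> set X) x :
  seqU l A x <-> exists2 i, i \in l & A i x.
Proof.
elim: l => [|i l IHl]; first by rewrite /seqU big_nil; split=> // -[].
rewrite /seqU big_cons; split.
  move=> [Aix|/IHl[j jl Ajx]]; first by exists i; rewrite ?inE ?eqxx.
  by exists j; rewrite // inE jl orbT.
move=> [j]; rewrite inE => /orP[/eqP ->|jl] Ajx; first by left.
by right; apply/IHl; exists j.
Qed.

Lemma measurable_seqU (I : Type) (l : seq I) (A : I -> set X) :
  (forall i, measurable (A i)) -> measurable (seqU l A).
Proof. by move=> mA; apply: bigsetU_measurable. Qed.

Lemma prob_seqU_le (I : Type) (l : seq I) (A : I -> set X) :
  (forall i, measurable (A i)) -> prob (seqU l A) <= \sum_(i <- l) prob (A i).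
Proof.
move=> mA; rewrite /seqU; elim: l => [|i l IHl].
  by rewrite !big_nil prob_set0.
rewrite !big_cons (le_trans (prob_setU_le _ _))//; first exact: measurable_seqU.
by rewrite lerD2l.
Qed.

Lemma prob_seqU (I : eqType) (l : seq I) (A : I -> set X) : uniq l ->
  (forall i, measurable (A i)) ->
  (forall i j x, i \in l -> j \in l -> A i x -> A j x -> i = j) ->
  prob (seqU l A) = \sum_(i <- l) prob (A i).
Proof.
move=> + mA; elim: l => [_ _|i l IHl /= /andP[il ul] Adisj].
  by rewrite /seqU !big_nil prob_set0.
rewrite [RHS]big_cons -IHl// => [|j k x jl kl]; last first.
  by apply: Adisj; rewrite inE ?jl ?kl orbT.
rewrite -prob_setU//; first by rewrite /seqU big_cons.
  exact: measurable_seqU.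
apply/seteqP; split=> // x [Aix /seqUP[j jl Ajx]].
have ij := Adisj i j x; rewrite !inE eqxx jl orbT in ij.
by rewrite (ij isT isT Aix Ajx) jl in il.
Qed.

Section Counting.
Context {I : eqType} (l : seq I) (N : I -> set X) (B : set X) (a : R).
Hypotheses (mN : forall i, measurable (N i)) (mB : measurable B) (a0 : 0 <= a).

Let count_integral : (\int[mu]_(x in B) (\sum_(i <- l) \1_(N i) x)%:E)%E =
  (\sum_(i <- l) prob (N i `&` B))%:E.
Proof.
under eq_integral do rewrite -sumEFin.
rewrite ge0_integral_sum//.
  rewrite -[RHS]sumEFin; apply: eq_bigr => i _.
  by rewrite integral_indic//; apply: probE; exact: measurableI.
move=> i; apply/measurable_EFinP; exact: measurable_indic.
Qed.

Lemma count_measurable : measurable_fun setT (fun x => \sum_(i <- l) \1_(N i) x : R).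
Proof. by apply: measurable_sum => i; exact: measurable_indic. Qed.

Lemma le_count_prob : (forall x, B x -> a <= \sum_(i <- l) \1_(N i) x) ->
  a * prob B <= \sum_(i <- l) prob (N i `&` B).
Proof.
move=> aB; rewrite -lee_fin -count_integral EFinM -probE// -integral_cst//.
apply: ge0_le_integral => //.
- apply/measurable_EFinP; apply: measurable_funTS; exact: count_measurable.
Qed.

Lemma ge_count_prob : (forall x, B x -> \sum_(i <- l) \1_(N i) x <= a) ->
  \sum_(i <- l) prob (N i `&` B) <= a * prob B.
Proof.
move=> aB; rewrite -lee_fin -count_integral EFinM -probE// -integral_cst//.
apply: ge0_le_integral => //.
- by move=> x _; rewrite lee_fin sumr_ge0.
- apply/measurable_EFinP; apply: measurable_funTS; exact: count_measurable.
Qed.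

End Counting.
End ProbabilityCounting.

Lemma separating_sets {R : realType} d (X : measurableType d) :
  @standard_borel R d X -> exists U : nat -> set X,
    (forall n, measurable (U n)) /\ forall x y, x <> y -> exists n, U n x /\ ~ U n y.
Proof.
move=> [T [f [_ [D /countable_injP[i iD] dD] [f' fK f'K] mX]]].
pose V k m := \bigcup_(a in D `&` [set a | i a = k]) interior (ball a (m.+1%:R^-1 : R)).
exists (fun n => if unpickle n is Some km then f @^-1` V km.1 km.2 else set0); split.
  move=> n; case: unpickle => [[k m]|//] /=; apply/mX.
  rewrite (_ : f @` _ = V k m); last first.
    apply/seteqP; split=> [t [x Vx <-]//|t Vt].
    by exists (f' t); rewrite // /preimage/= f'K.
  by apply: sub_sigma_algebra; apply: bigcup_open => a _; exact: open_interior.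
move=> x y xy; pose e := mdist (f x) (f y).
have e0 : 0 < e by rewrite mdist_gt0; apply/eqP => /(can_inj fK).
have e20 : 0 < e / 2 by rewrite divr_gt0.
have [m _ /(_ m (leqnn m)) /= me] := near_infty_natSinv_lt (PosNum e20).
have m0 : 0 < m.+1%:R^-1 / 2 :> R by rewrite divr_gt0.
have [a [ax Da]] : interior (ball (f x) (m.+1%:R^-1 / 2 : R)) `&` D !=set0.
  apply: dD; last exact: open_interior.
  by exists (f x); exact: nbhsx_ballx.
have {}ax := interior_subset ax.
have ax' : interior (ball a (m.+1%:R^-1 : R)) (f x).
  apply: filterS (nbhsx_ballx (f x) (m.+1%:R^-1 / 2) m0) => z xz.
  by rewrite [_^-1]splitr; exact: ball_triangle (ball_sym ax) xz.
exists (pickle (i a, m)); rewrite pickleK /=; split; first by exists a.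
move=> [b [Db /= iab] yb].
have {iab} ba : b = a by apply: iD => //; exact/mem_set.
rewrite {b Db}ba in yb; have {}yb := interior_subset yb.
have := ball_triangle (ball_sym (interior_subset ax')) yb.
rewrite ballEmdist/= -/e => /lt_trans/(_ (ltrD me me)).
by rewrite -splitr ltxx.
Qed.

Section Rokhlin.
Context {R : realType} {G : groupType} (alpha : standard_space R G).
Local Notation act := (@space_act R G alpha).
Local Notation prob := (prob (space_prob alpha)).
Implicit Types (S T : seq G) (A B C : set alpha).

Lemma act_measurable a B : measurable B -> measurable (act a @^-1` B).
Proof. by move=> mB; rewrite -[_ @^-1` _]setTI; exact: space_act_measurable. Qed.

Lemma prob_act a B : measurable B -> prob (act a @^-1` B) = prob B.
Proof. by move=> mB; rewrite /prob space_act_preserving. Qed.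

Lemma act_inv a x : act a^-1%g (act a x) = x.
Proof. by rewrite -space_actM mulVg space_act1. Qed.

Lemma act_invK a x : act a (act a^-1%g x) = x.
Proof. by rewrite -space_actM mulgV space_act1. Qed.

Section Towers.
Variables (S T : seq G) (delta c : R).
Hypotheses (delta0 : 0 <= delta) (c0 : 0 < c) (T0 : T != [::]) (uT : uniq T).
Hypothesis folT : folner (S ++ [seq g^-1%g | g <- S]) delta T.

Definition undefd (tau : alpha -> option G) : set alpha := tau @^-1` [set None].

Definition undef_count (tau : alpha -> option G) x : R :=
  \sum_(t <- T) \1_(act t @^-1` undefd tau) x.

(* [tau y] carries y to the base of its tower, so tau (g y) * g = tau y whenever
   y and g y lie in the same tower. *)
Record partial_tower (tau : alpha -> option G) : Prop := PartialTower {
  partial_tower_measurable : forall h, measurable (tau @^-1` [set h]);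
  partial_tower_range : forall x h, tau x = Some h -> h^-1%g \in T;
  partial_tower_bad : forall g, g \in S -> exists Z : set alpha,
    [/\ measurable Z, prob Z <= 2 * delta / c * prob (~` undefd tau) &
      forall x, ~ Z x -> tau x = omap (fun h => h * g)%g (tau (act g x))] }.

Lemma empty_tower : partial_tower (fun=> None).
Proof.
split=> // [h|g gS].
  rewrite (_ : _ @^-1` _ = if h is None then setT else set0).
    by case: h.
  by apply/seteqP; split=> x; case: h.
exists set0; split=> //; rewrite prob_set0 mulr_ge0// ?prob_ge0//.
by rewrite divr_ge0// ?(ltW c0)// mulr_ge0.
Qed.

(* A new tower over the points of C whose T-orbit is still mostly unassigned.
   The new bad points come from the boundary of T, a fraction of order delta / c
   of the points newly assigned. *)
Lemma tower_step tau C : partial_tower tau -> measurable C ->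
  (forall s t x, s \in T -> t \in T -> C x -> C (act (s^-1 * t)%g x) -> s = t) ->
  exists tau', [/\ partial_tower tau', undefd tau' `<=` undefd tau &
    forall x, C x -> undef_count tau' x < c * (size T)%:R].
Proof.
move=> [mtau rtau btau] mC dC.
have sT0 : 0 < (size T)%:R :> R by rewrite ltr0n lt0n size_eq0.
have mU : measurable (undefd tau) by exact: mtau.
(* Base of the new tower. Its translates by elements of [T] are disjoint, by the hypothesis on [C],
   and the threshold makes the newly assigned mass at least [c * size T * prob B]. *)
pose B := C `&` [set x | c * (size T)%:R <= undef_count tau x].
have mB : measurable B.
  apply: measurableI => //.
  have -> : [set x | c * (size T)%:R <= undef_count tau x] =
      setT `&` undef_count tau @^-1` `[c * (size T)%:R, +oo[%classic.
    by rewrite setTI; apply/seteqP; split=> x /=; rewrite in_itv/= andbT.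
  by apply: count_measurable => // t; exact: act_measurable.
have disjB s t y : s \in T -> t \in T -> B (act s^-1%g y) -> B (act t^-1%g y) ->
    s = t.
  move=> sT tT [Cs _] [Ct _]; apply: esym; apply: (dC _ _ (act s^-1%g y)) => //.
  by rewrite -space_actM -mulgA mulgV mulg1.
pose here y := [seq t <- T | `[< B (act t^-1%g y) >]].
have here1 t y : t \in T -> B (act t^-1%g y) -> ohead (here y) = Some t.
  move=> tT Bt; have : t \in here y by rewrite mem_filter tT andbT; exact/asboolP.
  rewrite /here; case E : [seq _ <- _ | _] => [//|s r] _ /=; congr Some.
  have : s \in s :: r by rewrite inE eqxx.
  by rewrite -E mem_filter => /andP[/asboolP Bs sT]; exact: (disjB _ _ y).
have here0 y : (forall t, t \in T -> ~ B (act t^-1%g y)) -> ohead (here y) = None.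
  move=> nB; rewrite /here; case E : [seq _ <- _ | _] => [//|s r].
  have : s \in s :: r by rewrite inE eqxx.
  by rewrite -E mem_filter => /andP[/asboolP Bs sT]; case: (nB _ sT).
have hereP y : (exists2 t, t \in T & B (act t^-1%g y)) \/
    (forall t, t \in T -> ~ B (act t^-1%g y)).
  have [[t [tT Bt]]|nt] := pselect (exists t, t \in T /\ B (act t^-1%g y)).
    by left; exists t.
  by right=> t tT Bt; apply: nt; exists t.
pose tau' y := if tau y is Some h then Some h else
  omap (fun t => t^-1)%g (ohead (here y)).
pose N t := undefd tau `&` act t^-1%g @^-1` B.
have mN t : measurable (N t) by apply: measurableI => //; exact: act_measurable.
have tauS y h : tau y = Some h -> tau' y = Some h by rewrite /tau' => ->.
have tauN y t : tau y = None -> t \in T -> B (act t^-1%g y) ->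
    tau' y = Some t^-1%g.
  by rewrite /tau' => -> tT Bt; rewrite (here1 _ _ tT Bt).
have tau0 y : tau y = None -> (forall t, t \in T -> ~ B (act t^-1%g y)) ->
    tau' y = None.
  by rewrite /tau' => -> nB; rewrite here0.
have defd : ~` undefd tau' = ~` undefd tau `|` seqU T N.
  apply/seteqP; split=> y /=; rewrite /undefd/=; last first.
    case E : (tau y) => [h|]; first by rewrite (tauS _ _ E).
    by case=> [//|/seqUP[t tT [_ Bt]]]; rewrite (tauN _ _ E tT Bt).
  case E : (tau y) => [h|]; first by left.
  case: (hereP y) => [[t tT Bt] _|nB]; last by rewrite (tau0 _ E nB).
  by right; apply/seqUP; exists t.
exists tau'; split; last 2 first.
- by move=> y; rewrite /undefd/=; case E : (tau y) => [h|//]; rewrite (tauS _ _ E).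
- move=> x Cx; have [le|lt] := leP (c * (size T)%:R) (undef_count tau x); last first.
    apply: le_lt_trans lt; apply: ler_sum => t _; rewrite !indicE.
    case E : (tau (act t x)) => [h|].
      by rewrite memNset// /undefd/= (tauS _ _ E).
    by rewrite [in leRHS]mem_set// ler_nat leq_b1.
  rewrite (_ : undef_count _ _ = 0) ?mulr_gt0// /undef_count big_seq big1// => t tT.
  rewrite indicE memNset//= /undefd/=; case E : (tau (act t x)) => [h|].
    by rewrite (tauS _ _ E).
  by rewrite (tauN _ _ E tT)// act_inv.
split.
- case=> [h|]; last first.
    change (measurable (undefd tau')); rewrite -(setCK (undefd tau')) defd.
    by apply: measurableC; apply: measurableU;
      [exact: measurableC|exact: measurable_seqU].
  rewrite (_ : _ @^-1` _ = tau @^-1` [set Some h] `|`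
      (if h^-1%g \in T then N h^-1%g else set0)).
    by apply: measurableU => //; case: ifP.
  apply/seteqP; split=> y /=.
    case E : (tau y) => [k|]; first by rewrite (tauS _ _ E); left.
    case: (hereP y) => [[t tT Bt]|nB]; last by rewrite (tau0 _ E nB).
    by rewrite (tauN _ _ E tT Bt) => -[<-]; right; rewrite invgK tT.
  case=> [/tauS//|]; case: ifP => // hT [E Bt].
  by rewrite (tauN _ _ E hT Bt) invgK.
- move=> y h; case E : (tau y) => [k|].
    by rewrite (tauS _ _ E) => -[<-]; exact: rtau E.
  case: (hereP y) => [[t tT Bt]|nB]; last by rewrite (tau0 _ E nB).
  by rewrite (tauN _ _ E tT Bt) => -[<-]; rewrite invgK.
move=> g gS; have [Z [mZ Zle ZE]] := btau _ gS.
pose out a := [seq t <- T | (a * t)%g \notin T].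
have mB' a : measurable (act a @^-1` B) by exact: act_measurable.
have outle a : a \in S ++ [seq g^-1%g | g <- S] ->
    \sum_(t <- out a) prob B <= delta * (size T)%:R * prob B.
  case: folT => _ _ fT aS; rewrite big_const_seq iter_addr_0 count_predT.
  rewrite -[leLHS]mulr_natl ler_wpM2r ?prob_ge0//; have := fT _ aS.
  by rewrite size_filter.
(* New failures occur where [x] is at a level [t] of the tower with [g t] outside [T], or [g x] is
   at a level [t] with [g^-1 t] outside [T]. Each kind has measure at most
   [delta * size T * prob B], which is why [T] has to be Folner for the inverses too. *)
exists (Z `|` (seqU (out g) (fun t => act t^-1%g @^-1` B) `|`
  seqU (out g^-1%g) (fun t => act (t^-1 * g)%g @^-1` B))); split.
- by apply: measurableU => //; apply: measurableU; exact: measurable_seqU.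
- have defdE : prob (~` undefd tau') = prob (~` undefd tau) + prob (seqU T N).
    rewrite defd prob_setU//.
    + exact: measurableC.
    + exact: measurable_seqU.
    + by apply/seteqP; split=> // y [] nU /seqUP[t _ [/nU]].
  have NE : prob (seqU T N) = \sum_(t <- T) prob (act t @^-1` undefd tau `&` B).
    rewrite prob_seqU//; last first.
      by move=> s t y sT tT [_ Bs] [_ Bt]; exact: (disjB _ _ y).
    apply: eq_bigr => t _; rewrite -[RHS](prob_act t^-1%g); last first.
      by apply: measurableI => //; exact: act_measurable.
    by congr prob; apply/seteqP; split=> y [] /=; rewrite act_invK.
  have Nge : c * (size T)%:R * prob B <= prob (seqU T N).
    rewrite NE; apply: le_count_prob => //; last by move=> x [].
      by move=> t; exact: act_measurable.
    by rewrite mulr_ge0// ltW.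
  rewrite (le_trans (prob_setU_le _ _ _))//.
    by apply: measurableU; exact: measurable_seqU.
  rewrite defdE mulrDr lerD//.
  rewrite (le_trans (prob_setU_le _ _ _))//; do ?exact: measurable_seqU.
  have le1 : prob (seqU (out g) (fun t => act t^-1%g @^-1` B)) <=
      delta * (size T)%:R * prob B.
    rewrite (le_trans (prob_seqU_le _ _ _))//.
    rewrite (le_trans _ (outle g _)) ?mem_cat ?gS//.
    by apply: ler_sum => t _; rewrite prob_act.
  have le2 : prob (seqU (out g^-1%g) (fun t => act (t^-1 * g)%g @^-1` B)) <=
      delta * (size T)%:R * prob B.
    rewrite (le_trans (prob_seqU_le _ _ _))//.
    rewrite (le_trans _ (outle g^-1%g _)) ?mem_cat ?map_f ?orbT//.
    by apply: ler_sum => t _; rewrite prob_act.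
  rewrite (le_trans (lerD le1 le2))//.
  apply: (@le_trans _ _ (2 * delta / c * (c * (size T)%:R * prob B))).
    by rewrite le_eqVlt; apply/orP; left; apply/eqP; field; exact: lt0r_neq0.
  by rewrite ler_wpM2l// divr_ge0// ?(ltW c0)// mulr_ge0.
move=> y /not_orP[nZ /not_orP[nout1 nout2]]; have tauE := ZE _ nZ.
case E : (tau y) tauE => [h|] /=.
  case E' : (tau (act g y)) => [k|//] /= [hE].
  by rewrite (tauS _ _ E) (tauS _ _ E') /= hE.
case E' : (tau (act g y)) => [//|] _.
case: (hereP y) => [[t tT Bt]|nB].
  rewrite (tauN _ _ E tT Bt).
  have gtT : (g * t)%g \in T.
    apply: contrapT => /negP gtT; apply: nout1; apply/seqUP; exists t => //.
    by rewrite mem_filter gtT.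
  rewrite (tauN _ (g * t)%g E')//=; rewrite invgM -?space_actM -mulgA mulVg mulg1//.
rewrite (tau0 _ E nB).
case: (hereP (act g y)) => [[t tT Bt]|nB']; last by rewrite (tau0 _ E').
have gtT : (g^-1 * t)%g \in T.
  apply: contrapT => /negP gtT; apply: nout2; apply/seqUP; exists t => //.
    by rewrite mem_filter gtT.
  by rewrite /preimage/= space_actM.
case: (nB _ gtT); rewrite invgM invgK space_actM; exact: Bt.
Qed.

(** The pieces are treated one after the other. Undefined sets only shrink, so the bound reached on
    an earlier piece persists. *)
Lemma tower_family (I : eqType) (l : seq I) (C : I -> set alpha) :
    (forall i, measurable (C i)) ->
    (forall i s t x, s \in T -> t \in T -> C i x -> C i (act (s^-1 * t)%g x) ->
      s = t) ->
  exists2 tau, partial_tower tau &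
    forall x, seqU l C x -> undef_count tau x < c * (size T)%:R.
Proof.
move=> mC dC; elim: l => [|i l [tau tauT tauC]].
  exists (fun=> None); first exact: empty_tower.
  by move=> x /seqUP[].
have [tau' [tau'T le tau'C]] := tower_step tauT (mC i) (@dC i).
exists tau' => // x /seqUP[j]; rewrite inE => /orP[/eqP ->|jl] Cjx.
  exact: tau'C.
apply: le_lt_trans (tauC x _); last by apply/seqUP; exists j.
apply: ler_sum => t _; rewrite !indicE ler_nat.
case: (boolP (x \in _)) => //= /set_mem/le h.
by rewrite mem_set.
Qed.

(** By invariance, [size T] times the undefined measure is the integral of [undef_count]; it is
    bounded by the hypothesis on [W] and by [size T * eta] off [W]. *)
Lemma prob_undefd tau W eta : partial_tower tau -> measurable W ->
    prob (~` W) <= eta ->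
    (forall x, W x -> undef_count tau x < c * (size T)%:R) ->
  prob (undefd tau) <= c + eta.
Proof.
move=> [mtau _ _] mW Weta Wc.
have sT0 : 0 < (size T)%:R :> R by rewrite ltr0n lt0n size_eq0.
have mU t : measurable (act t @^-1` undefd tau) by exact/act_measurable/mtau.
rewrite -(ler_pM2l sT0).
have -> : (size T)%:R * prob (undefd tau) =
    \sum_(t <- T) prob (act t @^-1` undefd tau).
  rewrite (eq_bigr (fun=> prob (undefd tau))) => [|t _]; last first.
    by rewrite prob_act//; exact: mtau.
  by rewrite big_const_seq iter_addr_0 count_predT mulr_natl.
apply: (@le_trans _ _ (\sum_(t <- T) (prob (act t @^-1` undefd tau `&` W) + eta))).
  apply: ler_sum => t _; rewrite (le_trans _ (lerD (lexx _) Weta))//.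
  rewrite (le_trans _ (prob_setU_le _ _ _))//.
  - apply: prob_le => //; first by apply: measurableU;
      [exact: measurableI|exact: measurableC].
    by move=> x Ux; have [Wx|nWx] := pselect (W x); [left|right].
  - exact: measurableI.
  - exact: measurableC.
rewrite big_split /= big_const_seq iter_addr_0 count_predT mulrDr [_ * eta]mulr_natl.
rewrite lerD2r.
apply: (@le_trans _ _ (c * (size T)%:R * prob W)).
  by apply: ge_count_prob => // x /Wc/ltW.
rewrite [leRHS]mulrC ler_piMr//; first by rewrite mulr_ge0// ltW.
by rewrite -(prob_setT (space_prob alpha)); exact: prob_le.
Qed.

End Towers.

(** For almost every [x] one has [g x <> x], so some separating set contains [x] and not [g x].
    Countably many such pieces cover almost everything, and continuity from below leaves finitely
    many. *)
Lemma free_piece g eta : essentially_free alpha -> g <> 1%g -> 0 < eta ->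
  exists (C : nat -> set alpha) N, [/\ forall n, measurable (C n),
    forall n x, C n x -> ~ C n (act g x) & prob (~` seqU (iota 0 N) C) <= eta].
Proof.
move=> [A [mA A1 freeA]] g1 eta0.
have [U [mU sepU]] := separating_sets (space_standard alpha).
pose C n := U n `&` ~` (act g @^-1` U n).
have mC n : measurable (C n).
  by apply: measurableI => //; apply: measurableC; exact: act_measurable.
exists C; pose F N := seqU (iota 0 N) C.
have mF N : measurable (F N) by exact: measurable_seqU.
suff [N le] : exists N, 1 - eta <= prob (F N).
  exists N; split=> // [n x [_ nU] [gU _]|]; first exact: nU.
  by rewrite (prob_setC _ (mF N)) lerBlDr addrC -lerBlDr.
apply: contrapT => /forallNP lt.
have ndF : nondecreasing_seq F.
  move=> m n mn; apply/subsetPset => x /seqUP[i]; rewrite mem_iota add0n => im Cx.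
  by apply/seqUP; exists i; rewrite // mem_iota add0n (leq_trans im).
have mUF : measurable (\bigcup_n F n) by exact: bigcupT_measurable.
have cF := nondecreasing_cvg_mu (mu := space_prob alpha) mF mUF ndF.
have : (1%:E <= (1 - eta)%:E :> \bar R)%E.
  apply: (@le_trans _ _ (space_prob alpha (\bigcup_n F n))).
    rewrite -A1 le_measure ?inE// => x Ax.
    have [n [Ux nUx]] : exists n, U n x /\ ~ U n (act g x).
      by apply: sepU => xg; apply: g1; exact: freeA Ax (esym xg).
    by exists n.+1 => //; apply/seqUP; exists n; rewrite // mem_iota add0n ltnSn.
  rewrite -(cvg_lim _ cF)//; apply: lime_le; first by apply/cvg_ex; eexists; exact: cF.
  apply: nearW => N /=; rewrite (_ : space_prob alpha (F N) = (prob (F N))%:E) ?probE//.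
  by rewrite lee_fin leNgt; apply/negP => /ltW; exact: lt.
by rewrite lee_fin; lra.
Qed.

(** Pieces for the elements of [K] are intersected one by one, half of the allowed loss being spent
    at each stage. *)
Lemma free_pieces (K : seq G) eta : essentially_free alpha ->
    (forall g, g \in K -> g <> 1%g) -> 0 < eta ->
  exists (I : eqType) (C : I -> set alpha) (l : seq I),
  [/\ forall i, measurable (C i),
      forall i g x, g \in K -> C i x -> ~ C i (act g x) &
      prob (~` seqU l C) <= eta].
Proof.
move=> free; elim: K eta => [|g K IHK] eta K1 eta0.
  exists bool, (fun=> setT), [:: true]; split=> //.
  by rewrite (_ : seqU _ _ = setT) ?setCT ?prob_set0 ?ltW// /seqU big_seq1.
have eta20 : 0 < eta / 2 by rewrite divr_gt0.
have [|I [C [l [mC dC lC]]]] := IHK (eta / 2) _ eta20.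
  by move=> h hK; apply: K1; rewrite inE hK orbT.
have [|D [N [mD dD ND]]] := free_piece free _ eta20 (g := g).
  by apply: K1; rewrite inE eqxx.
exists (I * nat)%type, (fun i => C i.1 `&` D i.2),
  [seq (i, n) | i <- l, n <- iota 0 N]; split.
- by move=> i; exact: measurableI.
- move=> i h x; rewrite inE => /orP[/eqP ->|hK] [Cx Dx] [Ch Dh].
    exact: dD Dx Dh.
  exact: dC hK Cx Ch.
- have mlC : measurable (seqU l C) by exact: measurable_seqU.
  have mND : measurable (seqU (iota 0 N) D) by exact: measurable_seqU.
  apply: (@le_trans _ _ (prob (~` seqU l C `|` ~` seqU (iota 0 N) D))).
    apply: prob_le.
    + by apply: measurableC; apply: measurable_seqU => i; exact: measurableI.
    + by apply: measurableU; exact: measurableC.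
    rewrite -setCI; apply: subsetC => x [/seqUP[i il Cix] /seqUP[n nN Dnx]].
    by apply/seqUP; exists (i, n) => //; exact: allpairs_f.
  rewrite (le_trans (prob_setU_le _ _ _))//; do ?exact: measurableC.
  by rewrite [leRHS]splitr lerD.
Qed.

Lemma rokhlin S e : amenable R G -> essentially_free alpha -> 0 < e ->
  exists (tau : alpha -> G) (F : seq G), [/\ forall x, tau x \in F,
    forall h, measurable (tau @^-1` [set h]) &
    forall g, g \in S -> exists Z, [/\ measurable Z, prob Z <= e &
      forall x, ~ Z x -> (tau (act g x) * g)%g = tau x]].
Proof.
(* The failures of the partial towers cost [2 * delta / c = e / 4]. The undefined points cost at
   most [c] plus the measure missed by the pieces, again at most [c]; the total is at most
   [3 * e / 4]. *)
move=> amenG free e0; pose c := e / 4; pose delta := c * e / 8.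
have c0 : 0 < c by rewrite divr_gt0.
have delta0 : 0 < delta by rewrite divr_gt0// mulr_gt0.
have [T folT] := amenable_folner (S ++ [seq g^-1%g | g <- S]) amenG delta0.
have [uT T0 _] := folT.
(* A piece disjoint from its translates by these quotients has pairwise disjoint translates along
   [T], as a tower base must. *)
pose K := [seq (s^-1 * t)%g | s <- T, t <- [seq t <- T | t != s]].
have K1 g : g \in K -> g <> 1%g.
  move=> /allpairsPdep[s [t [_ + ->]]]; rewrite mem_filter => /andP[/eqP ts _].
  by move=> st; apply: ts; rewrite -[t](mulKg s^-1%g) st invgK mulg1.
have [I [C [l [mC dC lC]]]] := free_pieces free K1 c0.
have [|tau tauT tauC] := tower_family (ltW delta0) c0 T0 uT folT l mC.
  move=> i s t x sT tT Cx Ctx; apply/eqP; apply: contraPT Ctx => st.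
  apply: dC Cx; apply/allpairsPdep; exists s, t; split=> //.
  by rewrite mem_filter tT eq_sym st.
have mU : measurable (undefd tau) by exact: partial_tower_measurable tauT None.
have Ule := prob_undefd c0 T0 tauT (measurable_seqU l mC) lC tauC.
exists (fun x => odflt 1%g (tau x)), (1%g :: [seq t^-1%g | t <- T]); split.
- move=> x; case E : (tau x) => [h|] /=; last by rewrite inE eqxx.
  by rewrite inE; apply/orP; right; apply/mapP; exists h^-1%g;
    [exact: partial_tower_range tauT _ _ E|rewrite invgK].
- move=> h; rewrite (_ : _ @^-1` _ = tau @^-1` [set Some h] `|`
      (if h == 1%g then undefd tau else set0)).
    apply: measurableU; first exact: partial_tower_measurable tauT _.
    by case: ifP.
  apply/seteqP; split=> x /=; rewrite /undefd/=.
    case E : (tau x) => [k|] /= <-; first by left.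
    by right; rewrite eqxx.
  by case=> [->//|]; case: eqP => // -> /= ->.
move=> g gS; have [Z [mZ Zle ZE]] := partial_tower_bad tauT gS.
exists (Z `|` undefd tau); split; first exact: measurableU.
- rewrite (le_trans (prob_setU_le _ _ _))// (le_trans (lerD Zle Ule))//.
  have -> : 2 * delta / c = e / 4 by rewrite /delta; field; exact: lt0r_neq0.
  have : prob (~` undefd tau) <= 1.
    by rewrite -(prob_setT (space_prob alpha)); apply: prob_le => //; exact: measurableC.
  rewrite /c => Ule1; nra.
- move=> x /not_orP[/ZE + nU]; rewrite /undefd/= in nU.
  case: (tau x) nU => [h _|//]; case: (tau (act g x)) => [k|//] /= [->] //.
Qed.

End Rokhlin.

(** * Parametrized chains *)

Section LinfTheory.
Context {R : realType} {d : measure_display} {X : measurableType d}.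
Variable mu : probability X R.
Local Notation bounded := (ess_bounded_fun mu).

Lemma Linf_repr_pi (f : Defs.bounded_fun mu) :
  {ae mu, forall x, Linf_repr (Linf_pi f) x = f x}.
Proof.
have : Linf_repr (Linf_pi f) - f \in @ae_zero _ _ _ mu.
  by rewrite Quotient.idealrBE reprK.
by move/asboolP; apply: filterS => x /eqP; rewrite subr_eq0 => /eqP.
Qed.

Lemma Linf_piK (f : Linf mu) : Linf_pi (Linf_repr f) = f.
Proof. exact: reprK. Qed.

Lemma Linf_piD (f g : Defs.bounded_fun mu) : Linf_pi (f + g) = Linf_pi f + Linf_pi g.
Proof. exact: (raddfD (\pi_(Quotient.quot (@ae_zero _ _ _ mu)))%qT). Qed.

Lemma measurable_abs_bounded (f : Defs.bounded_fun mu) :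
  measurable_fun setT (fun x => (`|f x|%:~R)%:E : \bar R).
Proof.
case: f => f /= /asboolP[mf _] _ Y mY; rewrite setTI.
exact: (mf [set k | Y (`|k|%:~R)%:E]).
Qed.

Lemma Linf_norm_pi (f : Defs.bounded_fun mu) :
  Linf_norm (Linf_pi f) = (\int[mu]_x (`|f x|%:~R)%:E)%E.
Proof.
apply: ae_eq_integral => //; do ?exact: measurable_abs_bounded.
by apply: filterS (Linf_repr_pi f) => x -> _.
Qed.

Lemma Linf_norm_ge0 (f : Linf mu) : (0 <= Linf_norm f)%E.
Proof. by apply: integral_ge0 => x _; rewrite lee_fin ler0z normr_ge0. Qed.

Lemma Linf_normD (f g : Linf mu) : (Linf_norm (f + g) <= Linf_norm f + Linf_norm g)%E.
Proof.
rewrite -(Linf_piK f) -(Linf_piK g) -Linf_piD !Linf_norm_pi -ge0_integralD//;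
  do ?[exact: measurable_abs_bounded|by move=> x _; rewrite lee_fin ler0z normr_ge0].
apply: ge0_le_integral => //.
- exact: measurable_abs_bounded.
- by apply: emeasurable_funD; exact: measurable_abs_bounded.
- by move=> x _; rewrite -EFinD lee_fin -intrD ler_int ler_normD.
Qed.

(* A junk value (0) unless [f] is essentially bounded. *)
Definition Linf_fun (f : X -> int) : Linf mu := Linf_pi (insubd 0 f).

Lemma Linf_funE f (bf : f \in bounded) : Linf_fun f = Linf_pi (BoundedFun bf).
Proof. by congr Linf_pi; apply: val_inj; rewrite val_insubd bf. Qed.

Lemma Linf_fun_cst k : Linf_fun (fun=> k) = Linf_cst mu k.
Proof. by rewrite (Linf_funE (cst_ess_bounded mu k)). Qed.

Lemma Linf_norm_fun f : f \in bounded ->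
  Linf_norm (Linf_fun f) = (\int[mu]_x (`|f x|%:~R)%:E)%E.
Proof. by move=> bf; rewrite (Linf_funE bf) Linf_norm_pi. Qed.

Lemma Linf_funB f g : f \in bounded -> g \in bounded ->
  Linf_fun (fun x => f x - g x) = Linf_fun f - Linf_fun g.
Proof.
move=> bf bg; have bfg : f - g \in bounded by exact: rpredB.
rewrite (Linf_funE bf) (Linf_funE bg) (@Linf_funE (fun x => f x - g x) bfg).
rewrite /Linf_pi -(raddfB (\pi_(Quotient.quot (@ae_zero _ _ _ mu)))%qT).
by congr (\pi _)%qT; exact: val_inj.
Qed.

Lemma Linf_fun_sum (I : Type) (r : seq I) (F : I -> X -> int) :
    (forall i, F i \in bounded) ->
  Linf_fun (fun x => \sum_(i <- r) F i x) = \sum_(i <- r) Linf_fun (F i).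
Proof.
move=> bF; elim: r => [|i r IHr].
  rewrite big_nil (_ : (fun=> _) = fun=> 0); last by apply/funext => x; rewrite big_nil.
  by rewrite Linf_fun_cst; apply: (addrI (Linf_cst mu 0)); rewrite -Linf_cstD !addr0.
rewrite big_cons -IHr; have br : (fun x => \sum_(i <- r) F i x) \in bounded.
  rewrite (_ : (fun _ => _) = \sum_(i <- r) F i); first exact: rpred_sum.
  by apply/funext => x; rewrite fct_sumE.
have bir : F i + (fun x => \sum_(i <- r) F i x) \in bounded by exact: rpredD.
rewrite (_ : (fun x => _) = F i + (fun x => \sum_(i <- r) F i x)); last first.
  by apply/funext => x; rewrite big_cons.
rewrite (Linf_funE (bF i)) (Linf_funE br) (Linf_funE bir) -Linf_piD.
by congr Linf_pi; exact: val_inj.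
Qed.

Lemma indicator_bounded (P : X -> bool) : measurable [set x | P x] ->
  (fun x => (P x)%:Z) \in bounded.
Proof.
move=> mP; apply/asboolP; split=> [B|]; last first.
  by exists 1%N; apply: aeW => x; case: (P x).
rewrite (_ : _ @^-1` B = ([set x | P x] `&` (if 1 \in B then setT else set0)) `|`
   (~` [set x | P x] `&` (if 0 \in B then setT else set0))).
  apply: measurableU; apply: measurableI => //; do ?exact: measurableC; by case: ifP.
apply/seteqP; split=> x /=; case E : (P x) => /=.
- by move=> B1; left; split=> //; rewrite mem_set.
- by move=> B0; right; split=> //; rewrite mem_set.
- by case=> [[_]|[/(_ isT)]//]; case: ifP => // /set_mem.
- by case=> [[]//|[_]]; case: ifP => // /set_mem.
Qed.

End LinfTheory.

Section LinfAction.
Context {R : realType} {G : groupType} (alpha : standard_space R G).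
Local Notation mu := (space_prob alpha).

Lemma Linf_act_fun (f : alpha -> int) a : f \in ess_bounded_fun mu ->
  Linf_act (Linf_fun mu f) a = Linf_fun mu (f \o space_act a).
Proof.
move=> bf; rewrite (Linf_funE bf) Linf_act_pi.
rewrite (Linf_funE (comp_act_ess_bounded (BoundedFun bf) a)).
by [].
Qed.

Lemma Linf_norm_act (f : Linf mu) a : Linf_norm (Linf_act f a) = Linf_norm f.
Proof.
rewrite /Linf_act Linf_norm_pi /=.
pose g x : \bar R := (`|Linf_repr f x|%:~R)%:E.
have mg : measurable_fun setT g by exact: measurable_abs_bounded.
have ma := space_act_measurable (s := alpha) a.
transitivity (\int[pushforward mu (space_act a)]_x g x)%E.
  rewrite ge0_integral_pushforward//.
  by move=> x; rewrite lee_fin ler0z normr_ge0.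
apply: eq_measure_integral => A mA _; exact: space_act_preserving.
Qed.

End LinfAction.

Section SubtractiveMaps.
Context {U V : zmodType} (f : U -> V) (fB : {morph f : x y / x - y}).

Lemma morphB0 : f 0 = 0.
Proof. by have := fB 0 0; rewrite !subrr. Qed.

Lemma morphBN : {morph f : x / - x}.
Proof. by move=> x; have := fB 0 x; rewrite morphB0 !sub0r. Qed.

Lemma morphBD : {morph f : x y / x + y}.
Proof. by move=> x y; have := fB x (- y); rewrite morphBN !opprK. Qed.

Lemma morphB_sum I (r : seq I) (F : I -> U) :
  f (\sum_(i <- r) F i) = \sum_(i <- r) f (F i).
Proof.
elim: r => [|i r IHr]; first by rewrite !big_nil morphB0.
by rewrite !big_cons morphBD IHr.
Qed.

End SubtractiveMaps.

Section ParametrizedTheory.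
Context {R : realType} {G : groupType} {M E : topologicalType}.
Variables (p : continuousType E M) (deck : G -> continuousType E E).
Variable alpha : standard_space R G.
Local Notation mu := (space_prob alpha).
Local Notation pt := (param_tens deck (alpha := alpha)).

Lemma param_tensDl n f f' (c : chain R n E) : pt (f + f') c = pt f c + pt f' c.
Proof. exact: tensDl. Qed.

Lemma param_tensDr n f (c c' : chain R n E) : pt f (c + c') = pt f c + pt f c'.
Proof. exact: tensDr. Qed.

Lemma param_tensG n f g (c : chain R n E) : pt (Linf_act f g) c = pt f (push (deck g) c).
Proof. exact: tensG. Qed.

Lemma param_tens0l n (c : chain R n E) : pt 0 c = 0.
Proof. by apply: (addrI (pt 0 c)); rewrite -param_tensDl !addr0. Qed.

Lemma param_tens0r n f : pt f (0 : chain R n E) = 0.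
Proof. by apply: (addrI (pt f 0)); rewrite -param_tensDr !addr0. Qed.

Lemma param_tensNl n f (c : chain R n E) : pt (- f) c = - pt f c.
Proof. by apply/eqP; rewrite -addr_eq0 -param_tensDl addNr param_tens0l. Qed.

Lemma param_tensNr n f (c : chain R n E) : pt f (- c) = - pt f c.
Proof. by apply/eqP; rewrite -addr_eq0 -param_tensDr addNr param_tens0r. Qed.

Lemma param_tens_suml n I (r : seq I) (F : I -> Linf mu) (c : chain R n E) :
  pt (\sum_(i <- r) F i) c = \sum_(i <- r) pt (F i) c.
Proof.
elim: r => [|i r IHr]; first by rewrite !big_nil param_tens0l.
by rewrite !big_cons param_tensDl IHr.
Qed.

Lemma param_tens_sumr n I (r : seq I) f (F : I -> chain R n E) :
  pt f (\sum_(i <- r) F i) = \sum_(i <- r) pt f (F i).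
Proof.
elim: r => [|i r IHr]; first by rewrite !big_nil param_tens0r.
by rewrite !big_cons param_tensDr IHr.
Qed.

Lemma param_boundaryB n : {morph @param_boundary R G E deck alpha n : x y / x - y}.
Proof.
apply: tens_liftB => [g h e|g e e'|g a e].
- exact: tensDl.
- by rewrite boundaryD; exact: tensDr.
- by rewrite /param_tens tensG /deck_push boundary_push.
Qed.

Lemma param_boundary_sum n I (r : seq I) (F : I -> param_chain deck alpha n) :
  param_boundary (\sum_(i <- r) F i) = \sum_(i <- r) param_boundary (F i).
Proof.
exact: (morphB_sum (U := param_chain deck alpha n) (V := param_chain deck alpha n.-1)
  (@param_boundaryB n)).
Qed.

(* Simplices with the same projection differ by a deck transformation, which
   the tensor product moves to the coefficients. *)
Lemma reduced_form_exists n (s : seq (Linf mu * singular_simplex R n E)) :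
    (forall t u : singular_simplex R n E, simplex_push p t = simplex_push p u ->
      exists g, simplex_push (deck g) t = u) ->
  exists2 s', is_reduced_form p s' (\sum_(fs <- s) pt fs.1 (fgen fs.2)) &
    (\sum_(fs <- s') Linf_norm fs.1 <= \sum_(fs <- s) Linf_norm fs.1)%E.
Proof.
move=> pdeck; elim: s => [|[f t] s [s' [us' sE] sle]].
  by exists [::]; rewrite ?big_nil//; split; rewrite ?big_nil.
rewrite !big_cons /= sE.
have [|new] := boolP (simplex_push p t \in [seq simplex_push p fs.2 | fs <- s']); last first.
  exists ((f, t) :: s'); last by rewrite big_cons leeD2l.
  by split; rewrite /= ?new// big_cons.
move=> /mapP[[f1 t1] t1s' tt1].
have [g gt] := pdeck _ _ (esym tt1).
have tE : pt f (fgen t) = pt (Linf_act f g) (fgen t1).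
  by rewrite param_tensG push_fgen gt.
case/splitPr: t1s' us' sE sle => s1 s2 us' sE sle.
exists (s1 ++ (f1 + Linf_act f g, t1) :: s2).
  split; first by move: us'; rewrite !map_cat.
  rewrite tE !big_cat !big_cons /= param_tensDl [LHS]addrCA; congr (_ + _).
  by rewrite addrA; congr (_ + _); exact: addrC.
apply: le_trans (leeD2l _ sle); rewrite !big_cat !big_cons /=.
have aux (x y z u v : \bar R) : (v <= u + z)%E ->
    ((x + (v + y))%R <= u + (x + (z + y))%R)%E.
  move=> vuz; change (x + (v + y) <= u + (x + (z + y)))%E.
  by rewrite [leRHS]addeCA leeD2l// addeA leeD2r.
apply: aux; rewrite addeC -(Linf_norm_act f g); exact: Linf_normD.
Qed.

Lemma sum_Linf_norm_ge0 (I : Type) (r : seq I) (F : I -> Linf mu) :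
  (0 <= \sum_(i <- r) Linf_norm (F i))%E.
Proof. by apply: sume_ge0 => i _; exact: Linf_norm_ge0. Qed.

End ParametrizedTheory.

Lemma big_subset_support (I : eqType) (V : zmodType) (r s : seq I) (f : I -> V) :
    uniq r -> uniq s -> {subset r <= s} -> (forall i, i \notin r -> f i = 0) ->
  \sum_(i <- r) f i = \sum_(i <- s) f i.
Proof.
move=> ur us rs f0; rewrite [RHS](bigID (mem r)) /= [X in _ + X]big1 => [|i /f0//].
rewrite addr0 -[RHS]big_filter; apply: perm_big; apply: uniq_perm => //.
  exact: filter_uniq.
by move=> i; rewrite mem_filter /=; case: (boolP (i \in r)) => //= /rs ->.
Qed.

Lemma sum_eq_le1 (I : eqType) (r : seq I) (i : I) : uniq r ->
  \sum_(j <- r) (i == j)%:Z <= 1.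
Proof.
move=> ur; case: (boolP (i \in r)) => ir; last first.
  rewrite big_seq big1// => j jr; rewrite (_ : i == j = false)//.
  by apply: contraNF ir => /eqP ->.
rewrite (bigD1_seq i)//= eqxx big1 ?addr0// => j; rewrite eq_sym.
by move/negbTE => ->.
Qed.

Section Levels.
Context {R : realType} {G : groupType} (alpha : standard_space R G).
Local Notation mu := (space_prob alpha).
Local Notation act := (@space_act R G alpha).
Implicit Types (phi psi : alpha -> G).

Definition level phi (h : G) : Linf mu := Linf_fun mu (fun x => (phi x == h)%:Z).

Lemma level_bounded phi h : measurable (phi @^-1` [set h]) ->
  (fun x => (phi x == h)%:Z) \in ess_bounded_fun mu.
Proof.
move=> mphi; apply: (indicator_bounded mu (P := fun x => phi x == h)).
by rewrite (_ : [set _ | _] = phi @^-1` [set h])//; apply/seteqP; split=> x /eqP.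
Qed.

Lemma level_sum phi (F : seq G) : (forall h, measurable (phi @^-1` [set h])) ->
  uniq F -> (forall x, phi x \in F) -> \sum_(h <- F) level phi h = Linf_cst mu 1.
Proof.
move=> mphi uF phiF; rewrite -Linf_fun_sum => [|h]; last exact: level_bounded.
rewrite -Linf_fun_cst; congr Linf_fun; apply/funext => x.
rewrite (bigD1_seq (phi x))//= eqxx big1 ?addr0// => h; rewrite eq_sym.
by move/negbTE => ->.
Qed.

Lemma level_out phi h : (forall x, phi x != h) -> level phi h = 0.
Proof.
move=> phih; rewrite /level (_ : (fun=> _) = fun=> 0).
  by rewrite Linf_fun_cst; apply: (addrI (Linf_cst mu 0)); rewrite -Linf_cstD !addr0.
by apply/funext => x; rewrite (negbTE (phih x)).
Qed.

(** Indexing the translated level by [h * g] rather than [h] is what lines it up with the level of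
    [phi] that it should cancel. *)
Lemma level_act phi g h : measurable (phi @^-1` [set h]) ->
  Linf_act (level phi h) g = level (fun x => phi (act g x) * g)%g (h * g)%g.
Proof.
move=> mphi; rewrite Linf_act_fun; last exact: level_bounded.
congr Linf_fun; apply/funext => x /=.
by rewrite (inj_eq (mulIg g)).
Qed.

(** Off [Z] all differences vanish. On [Z] each of the two families of indicators contributes at
    most 1 in total, however many indices there are. *)
Lemma level_diff_norm phi psi (Z : set alpha) (L : seq G) : uniq L ->
    (forall h, measurable (phi @^-1` [set h])) ->
    (forall h, measurable (psi @^-1` [set h])) -> measurable Z ->
    (forall x, ~ Z x -> phi x = psi x) ->
  (\sum_(h <- L) Linf_norm (level phi h - level psi h) <= (2 * prob mu Z)%:E)%E.
Proof.
move=> uL mphi mpsi mZ phipsi.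
pose f h x : int := (phi x == h)%:Z - (psi x == h)%:Z.
have bf h : f h \in ess_bounded_fun mu.
  by apply: rpredB; exact: level_bounded.
have mf h : measurable_fun setT (fun x => (`|f h x|%:~R)%:E : \bar R).
  exact: (measurable_abs_bounded (BoundedFun (bf h))).
have -> : (\sum_(h <- L) Linf_norm (level phi h - level psi h) =
    \int[mu]_x \sum_(h <- L) (`|f h x|%:~R)%:E)%E.
  rewrite ge0_integral_sum//.
  apply: eq_bigr => h _; rewrite -Linf_norm_fun//.
  by congr Linf_norm; rewrite -Linf_funB//; exact: level_bounded.
have -> : (2 * prob mu Z)%:E = (\int[mu]_x (2 * \1_Z x)%:E)%E.
  under eq_integral do rewrite EFinM.
  rewrite ge0_integralZl//; last first.
    by apply/measurable_EFinP; exact: measurable_indic.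
  by rewrite integral_indic// setIT EFinM -probE.
apply: ge0_le_integral => //.
- by move=> x _; rewrite sumEFin lee_fin sumr_ge0// => h _; rewrite ler0z normr_ge0.
- by apply: emeasurable_sum => h; exact: mf.
- apply/measurable_EFinP; apply: measurable_funM => //; exact: measurable_indic.
move=> x _; rewrite sumEFin lee_fin -[X in X <= _](raddf_sum (intmul 1)).
rewrite indicE; case: (boolP (x \in Z)) => xZ /=.
  rewrite mulr1 (_ : 2 = 2%:~R)// ler_int.
  apply: (@le_trans _ _ (\sum_(h <- L) ((phi x == h)%:Z + (psi x == h)%:Z))).
    by apply: ler_sum => h _; rewrite /f; case: eqP; case: eqP.
  by rewrite big_split /= (_ : 2 = 1 + 1)// lerD// sum_eq_le1.
rewrite mulr0 big1// => h _; rewrite /f phipsi ?subrr//.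
by move/mem_set; rewrite (negbTE xZ).
Qed.

End Levels.

(** * The cone operator made almost equivariant by the tower map *)

Section Transfer.
Context {R : realType} {G : groupType} {E : topologicalType}.
Variables (deck : G -> continuousType E E) (H : contraction R E).
Hypothesis deck1 : forall e, deck 1%g e = e.
Hypothesis deckM : forall a b e, deck (a * b)%g e = deck a (deck b e).

Definition conj_cone n (a : G) (c : chain R n E) : chain R n.+1 E :=
  push (deck a^-1%g) (cone H (push (deck a) c)).

Definition conj_cone_simplex n (a : G) (s : singular_simplex R n E) :=
  simplex_push (deck a^-1%g) (cone_simplex H (simplex_push (deck a) s)).

Lemma conj_coneB n a : {morph @conj_cone n a : c c' / c - c'}.
Proof. by move=> c c'; rewrite /conj_cone pushB coneB pushB. Qed.

Lemma conj_cone_fgen n a (s : singular_simplex R n E) :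
  conj_cone a (fgen s) = fgen (conj_cone_simplex a s).
Proof. by rewrite /conj_cone push_fgen cone_fgen push_fgen. Qed.

Lemma push_deckK n a (c : chain R n E) : push (deck a^-1%g) (push (deck a) c) = c.
Proof.
rewrite (push_comp (h := deck (a^-1 * a)%g)) => [|x]; last exact: deckM.
by apply: push_id => x; rewrite mulVg.
Qed.

Lemma boundary_conj_cone n a (c : chain R n.+1 E) :
  boundary (conj_cone a c) = c - conj_cone a (boundary c).
Proof.
by rewrite /conj_cone boundary_push boundary_cone pushB push_deckK boundary_push.
Qed.

(** Conjugation gives no equivariance for a fixed [a], but it turns a translation of the chain into
    the shift from [a] to [a * g], which the coefficients can absorb. *)
Lemma conj_cone_deck n a g (c : chain R n E) :
  conj_cone a (push (deck g) c) = push (deck g) (conj_cone (a * g)%g c).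
Proof.
rewrite /conj_cone (push_comp (h := deck (a * g)%g)) => [|x]; last exact: deckM.
by rewrite (push_comp (h := deck a^-1%g))// => x; rewrite -deckM invgM mulVKg.
Qed.

Section Space.
Variable alpha : standard_space R G.
Local Notation mu := (space_prob alpha).
Local Notation act := (@space_act R G alpha).
Local Notation pt := (param_tens deck (alpha := alpha)).
Variables (tau : alpha -> G) (F : seq G).
Hypotheses (uF : uniq F) (tauF : forall x, tau x \in F).
Hypothesis mtau : forall h, measurable (tau @^-1` [set h]).

Definition transfer n (c : chain R n E) : param_chain deck alpha n.+1 :=
  \sum_(h <- F) pt (level tau h) (conj_cone h c).

(** Each conjugated cone satisfies the cone formula, and the levels of [tau] form a partition of
    unity. *)
Lemma transfer_homologous n (c : chain R n.+1 E) :
  param_boundary (transfer c) = pt (Linf_cst mu 1) c - transfer (boundary c).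
Proof.
rewrite /transfer param_boundary_sum -(level_sum mtau uF tauF) param_tens_suml -sumrB.
apply: eq_bigr => h _; rewrite param_boundary_tens boundary_conj_cone.
by rewrite param_tensDr param_tensNr.
Qed.

Lemma boundary_boundary_transfer n (c : chain R n.+1 E) :
  param_boundary (param_boundary (transfer c)) = 0.
Proof.
rewrite /transfer !param_boundary_sum big1// => h _.
by rewrite !param_boundary_tens boundary_boundaryS param_tens0r.
Qed.

(** Constant functions are invariant. This is why the lifted cycle becomes a cycle after tensoring
    although it is none upstairs. *)
Lemma cst_tens_coinvariant n (l : seq (G * singular_simplex R n E)) :
  pt (Linf_cst mu 1) (\sum_(gs <- l) (fgen gs.2 - push (deck gs.1) (fgen gs.2))) = 0.
Proof.
rewrite param_tens_sumr big1// => gs _; rewrite param_tensDr param_tensNr.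
by rewrite -[in X in _ - X](param_tensG deck) Linf_act_cst subrr.
Qed.

Lemma transferB n : {morph @transfer n : c c' / c - c'}.
Proof.
move=> c c'; rewrite /transfer -sumrB; apply: eq_bigr => h _.
by rewrite conj_coneB param_tensDr param_tensNr.
Qed.

Definition translate g x := (tau (act g x) * g)%g.

Lemma translate_measurable g h : measurable (translate g @^-1` [set h]).
Proof.
rewrite (_ : _ @^-1` _ = act g @^-1` (tau @^-1` [set (h * g^-1)%g])).
  exact: act_measurable.
apply/seteqP; split=> x; rewrite /translate /preimage/=.
  by move=> <-; rewrite mulgK.
by move=> ->; rewrite mulgVK.
Qed.

(** Moving [g] into the coefficients sends the term of index [h] to index [h * g] with the same
    conjugated cone, so the two sums can be subtracted coefficientwise. The list contains both index
    sets; levels outside the range of their map are 0. *)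
Lemma transfer_diff n g (s : singular_simplex R n E) :
  transfer (fgen s - push (deck g) (fgen s)) =
  \sum_(h <- undup (F ++ [seq h * g | h <- F]%g))
    pt (level tau h - level (translate g) h) (fgen (conj_cone_simplex h s)).
Proof.
set L := undup _; have uL : uniq L by exact: undup_uniq.
rewrite transferB; under [RHS]eq_bigr do rewrite param_tensDl param_tensNl.
rewrite sumrB; congr (_ - _).
  rewrite /transfer; under eq_bigr do rewrite conj_cone_fgen.
  apply: big_subset_support => // [h hF|h hF]; first by rewrite mem_undup mem_cat hF.
  rewrite level_out ?param_tens0l// => x.
  by apply: contraNneq hF => <-.
transitivity (\sum_(h <- [seq h * g | h <- F]%g)
    pt (level (translate g) h) (fgen (conj_cone_simplex h s))).
  rewrite big_map; apply: eq_bigr => h _.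
  by rewrite conj_cone_deck -param_tensG level_act// conj_cone_fgen.
apply: big_subset_support => // [|h hF|h hF].
- by rewrite map_inj_uniq//; exact: mulIg.
- by rewrite mem_undup mem_cat hF orbT.
- rewrite level_out ?param_tens0l// => x.
  by apply: contraNneq hF => <-; apply/mapP; exists (tau (act g x)).
Qed.

End Space.
End Transfer.

Lemma subdivided_fundamental_cycle {R : realType} n (M : topologicalType)
    (o : M -> chain R n.+1 M) z N :
  is_fundamental_cycle o z -> is_fundamental_cycle o (sdN N z).
Proof.
move=> [z0 zo]; split; first by rewrite boundary_sdN z0 sdN0.
move=> x; have [b zob] := zo x; exists (b - sdN_htpy N z).
have h0 : sdN_htpy N (0 : chain R n M) = 0.
  by apply: (addrI (sdN_htpy N 0)); rewrite -sdN_htpyD !addr0.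
rewrite boundaryB boundary_sdN_htpy z0 h0 subr0 opprB addrA.
by rewrite [sdN N z - _ + _]addrC subrKA.
Qed.

(** * Parametrized fundamental cycles of arbitrarily small norm *)

Section SmallCycles.
Context {R : realType} {n : nat} {M E : topologicalType} {G : groupType}.
Variables (p : continuousType E M) (e0 : E) (cls : (R -> M) -> G).
Variables (deck : G -> continuousType E E) (o : M -> chain R n.+1 M).
Variable alpha : standard_space R G.
Hypothesis M_manifold : closed_manifold R n.+1 M.
Hypothesis oP : is_orientation o.
Hypothesis p_universal : is_universal_covering R p.
Hypothesis deckP : is_deck_action p e0 cls deck.
Hypothesis E_contractible : contractible R E.
Hypothesis G_amenable : amenable R G.
Hypothesis alpha_free : essentially_free alpha.

Lemma small_fundamental_cycle (e : R) : 0 < e ->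
  exists c : param_chain deck alpha n.+1, is_param_fundamental_cycle p o c /\
    exists2 v, is_param_norm p c v & (v <= e%:E)%E.
Proof.
move=> egt0; have [deck1 deckM pdeck _] := deckP.
have [z zP] := fundamental_cycle_exists M_manifold oP.
have [p_covering _] := p_universal.
have [N [z' z'E]] := chain_lift p_covering z.
have z'P : is_fundamental_cycle o (push p z').
  by rewrite z'E; exact: subdivided_fundamental_cycle.
have [l lE] : exists l : seq (G * singular_simplex R n E),
    boundary z' = \sum_(gs <- l) (fgen gs.2 - push (deck gs.1) (fgen gs.2)).
  apply: (push_ker M_manifold p_universal deckP).
  by have := z'P.1; rewrite boundary_push.
have [H] := contractible_contraction E_contractible.
(* Each of the [size l] terms of the boundary contributes at most [2 * e'] to the norm; the
   successor keeps the denominator nonzero when [l] is empty. *)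
pose e' := e / (2 * (size l).+1%:R).
have e'0 : 0 < e' by rewrite divr_gt0// mulr_gt0.
have [tau [F' [tauF' mtau tauS]]] :=
  rokhlin [seq gs.1 | gs <- l] G_amenable alpha_free e'0.
pose F := undup F'; have uF : uniq F by exact: undup_uniq.
have tauF x : tau x \in F by rewrite mem_undup.
pose c := transfer deck H tau F (boundary z').
pose L g := undup (F ++ [seq h * g | h <- F]%g).
pose s := [seq (level tau h - level (translate tau gs.1) h,
  conj_cone_simplex deck H h gs.2) | gs <- l, h <- L gs.1].
have cE : c = \sum_(fs <- s) param_tens deck fs.1 (fgen fs.2).
  rewrite /s big_allpairs_dep /c lE.
  rewrite (morphB_sum (transferB deck H tau F (n := n))); apply: eq_bigr => gs _.
  by rewrite transfer_diff.
exists c; split.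
  have cz : param_boundary (transfer deck H tau F z') =
      param_tens deck (Linf_cst (space_prob alpha) 1) z' - c.
    exact: transfer_homologous.
  have {}cE : c = param_tens deck (Linf_cst (space_prob alpha) 1) z' -
      param_boundary (transfer deck H tau F z').
    by rewrite cz opprB addrC subrK.
  split.
    have cst0 : param_boundary (param_tens deck (Linf_cst (space_prob alpha) 1) z') = 0.
      by rewrite param_boundary_tens lE; exact: cst_tens_coinvariant.
    rewrite cE; apply: etrans (param_boundaryB _ _) _.
    apply: etrans (f_equal2 (fun u v => u - v) cst0 (boundary_boundary_transfer _ _ _ _ _)) _.
    exact: subrr.
  exists (tens (fun (k : int) (_ : G) => k) (@deck_push R G E deck n.+1) 1 z'); split.
    by rewrite coinv_to_base_tens// mulr1z.
  exists (- transfer deck H tau F z').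
  rewrite cst_to_param_tens (morphBN (@param_boundaryB _ _ _ deck alpha n.+2)).
  by rewrite {1}cE; rewrite addrC addKr.
have [s' s'P s'le] := reduced_form_exists s (simplex_deck M_manifold p_universal deckP (m := n.+1)).
exists (\sum_(fs <- s') Linf_norm fs.1)%E; first by exists s' => //; rewrite cE.
apply: le_trans s'le _; rewrite /s big_allpairs_dep /=.
apply: (@le_trans _ _ (\sum_(gs <- l) (2 * e')%:E)%E).
  rewrite big_seq [leRHS]big_seq; apply: lee_sum => gs gsl.
  have [|Z [mZ Zle Ztau]] := tauS gs.1; first exact: map_f.
  apply: le_trans (level_diff_norm (undup_uniq _) mtau
    (translate_measurable mtau gs.1) mZ _) _.
    by move=> x /Ztau.
  by rewrite lee_fin ler_pM2l.
rewrite sumEFin lee_fin big_const_seq iter_addr_0 count_predT -[leLHS]mulr_natr.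
have -> : 2 * e' = e / (size l).+1%:R.
  by rewrite /e' invfM mulrCA mulVKf.
by rewrite mulrAC ler_pdivrMr// ler_pM2l// ler_nat.
Qed.

End SmallCycles.

Lemma param_simplicial_volume_ge0 {R : realType} n (M E : topologicalType) (G : groupType)
    (p : continuousType E M) (deck : G -> continuousType E E) (o : M -> chain R n M)
    (alpha : standard_space R G) :
  (0 <= param_simplicial_volume p deck alpha o)%E.
Proof.
by apply: le_ereal_inf_tmp => v [c _ [s _ ->]]; exact: sum_Linf_norm_ge0.
Qed.


Theorem theorem1p9 (R : realType) (n : nat) (M E : topologicalType)
    (p : continuousType E M) (e0 : E) (G : groupType) (cls : (R -> M) -> G)
    (deck : G -> continuousType E E) (o : M -> chain R n M)
    (alpha : standard_space R G) :
  (0 < n)%N ->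
  closed_manifold R n M ->
  connected [set: M] ->
  is_orientation o ->
  is_universal_covering R p ->
  is_fundamental_group (p e0) cls ->
  is_deck_action p e0 cls deck ->
  contractible R E ->
  amenable R G ->
  essentially_free alpha ->
  integral_foliated_simplicial_volume p deck o =
    param_simplicial_volume p deck alpha o /\
  param_simplicial_volume p deck alpha o = 0%E.
Proof.
case: n o => [//|n] o _ Mn _ oP p_universal _ deckP Ec amen free.
have vol0 : param_simplicial_volume p deck alpha o = 0%E.
  apply/eqP; rewrite eq_le param_simplicial_volume_ge0 andbT.
  apply/lee_addgt0Pr => e egt0; rewrite add0e.
  have [c [cP [v vP ve]]] :=
    small_fundamental_cycle Mn oP p_universal deckP Ec amen free egt0.
  by apply: le_trans ve; apply: ereal_inf_lbound; exists c.
(* The infimum over all actions is squeezed between 0 and its value at [alpha]. *)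
split=> //; rewrite vol0; apply/eqP; rewrite eq_le; apply/andP; split.
  by apply: ereal_inf_lbound; exists alpha.
by apply: le_ereal_inf_tmp => v [beta ->]; exact: param_simplicial_volume_ge0.
Qed.
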